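(* Let $k$ be a positive integer. For every non-empty index $\boldsymbol{k}=(k_1,\dots,k_r)$ with $\mathrm{wt}(\boldsymbol{k})=k$, the following equality holds in $\mathcal{Z}[[t]]$: \begin{align*} &\sum_{i=1}^r \sum_{j=0}^{k_i-2} \zeta^{\star,KY}_{\widehat{\mathcal{S}}}(j+1,k_{i+1},\ldots,k_r,k_1,\ldots,k_{i-1},k_i-j)\\ &=\sum_{i=1}^r \sum_{j=0}^\infty \zeta^{\star,KY}_{\widehat{\mathcal{S}}}(j+1,k_{i+1},\ldots,k_r,k_1,\ldots,k_i)\,t^j+k\,\zeta^{\star,KY}_{\widehat{\mathcal{S}}}(k+1)-\delta_{\boldsymbol{k},(\{1\}^r)}\cdot(1+(-1)^{k+1})\,k\,\zeta(k+1). \end{align*} Here $\delta_{\boldsymbol{k},(\{1\}^r)}$ is $1$ if $\boldsymbol{k}=(1,\dots,1)$ ($r$ ones) and $0$ otherwise.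
   Context: An index is a tuple $\boldsymbol{k}=(k_1,\dots,k_r)$ of positive integers ($r\ge 0$; $r=0$ gives the empty index $\varnothing$); $\mathrm{wt}(\boldsymbol{k})=k_1+\cdots+k_r$. It is admissible if it is empty or $k_r\ge 2$. For admissible $\boldsymbol{k}$, $\zeta(k_1,\dots,k_r)=\sum_{1\le n_1<\cdots<n_r}\frac{1}{n_1^{k_1}\cdots n_r^{k_r}}$, $\zeta(\varnothing)=1$. $\mathcal{Z}\subset\mathbb{R}$ is the $\mathbb{Q}$-linear span of $1$ and all multiple zeta values; it is a $\mathbb{Q}$-algebra. Empty sums (e.g. $\sum_{j=0}^{k_i-2}$ with $k_i=1$) are $0$; for $i=r$ the string $k_{i+1},\dots,k_r$ is empty, and for $i=1$ the string $k_1,\dots,k_{i-1}$ is empty. Let $\mathfrak{H}=\mathbb{Q}\langle x,y\rangle$, $\mathfrak{H}^1=\mathbb{Q}+y\mathfrak{H}\supset\mathfrak{H}^0=\mathbb{Q}+y\mathfrak{H}x$, $z_k=yx^{k-1}$, $z_{\boldsymbol{k}}=z_{k_1}\cdots z_{k_r}$. Let $Z:\mathfrak{H}^0\to\mathbb{R}$ be the $\mathbb{Q}$-linear map with $Z(z_{\boldsymbol{k}})=\zeta(\boldsymbol{k})$ for admissible $\boldsymbol{k}$. The shuffle product $\mathrm{sh}$ on $\mathfrak{H}$ is the $\mathbb{Q}$-bilinear product with $w\,\mathrm{sh}\,1=1\,\mathrm{sh}\,w=w$ and $w_1u_1\,\mathrm{sh}\,w_2u_2=(w_1\,\mathrm{sh}\,w_2u_2)u_1+(w_1u_1\,\mathrm{sh}\,w_2)u_2$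 for $u_1,u_2\in\{x,y\}$. Then $Z$ is a homomorphism for $\mathrm{sh}$ on $\mathfrak{H}^0$, $(\mathfrak{H}^1,\mathrm{sh})\cong(\mathfrak{H}^0,\mathrm{sh})[y]$, and $Z^{\mathrm{sh}}:(\mathfrak{H}^1,\mathrm{sh})\to\mathbb{R}[T]$, $w\mapsto Z^{\mathrm{sh}}(w;T)$, is the unique $\mathbb{Q}$-algebra homomorphism extending $Z$ with $Z^{\mathrm{sh}}(y;T)=T$; its image lies in $\mathcal{Z}[T]$. A 2-poset is a finite poset $X$ with a label map $\delta_X:X\to\{x,y\}$. Put $W(X)=\sum_f \delta_X(f^{-1}(1))\cdots\delta_X(f^{-1}(\#X))\in\mathfrak{H}$, summed over all bijections $f:X\to\{1,\dots,\#X\}$ such that $p<q$ implies $f(p)<f(q)$ ($W(\varnothing)=1$). For $\boldsymbol{k}=(k_1,\dots,k_r)$, let $X^\star(\boldsymbol{k})$ be the 2-poset with elements $p_{i,m}$ ($1\le i\le r$, $1\le m\le k_i$), with order generated by $p_{i,1}<p_{i,2}<\cdots<p_{i,k_i}$ for each $i$ and $p_{i,1}<p_{i+1,k_{i+1}}$ for $1\le i\le r-1$, and with $p_{i,1}$ labelled $y$ and $p_{i,m}$ ($m\ge2$) labelled $x$. Put $w^\star(\boldsymbol{k})=W(X^\star(\boldsymbol{k}))\in\mathfrak{H}^1$ and $\zeta^{\star,KY}(\boldsymbol{k})=Z^{\mathrm{sh}}(w^\star(\boldsymbol{k});0)\in\mathcal{Z}$ (so $\zeta^{\star,KY}(\varnothing)=1$).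 Define in $\mathcal{Z}[[t]]$ $$\zeta_{\widehat{\mathcal{S}}}^{\star,KY}(k_1,\dots,k_r)=\sum_{i=0}^{r}(-1)^{k_{i+1}+\cdots+k_r}\zeta^{\star,KY}(k_1,\ldots,k_i)\sum_{l_{i+1},\ldots,l_r\ge0}\ \prod_{j=i+1}^r\binom{k_j+l_j-1}{l_j}\,\zeta^{\star,KY}(k_r+l_r,\ldots,k_{i+1}+l_{i+1})\,t^{l_{i+1}+\cdots+l_r}.$$ *)

(* Defs.v *)
From HB Require Import structures.
From mathcomp Require Import all_boot all_order all_algebra.
From mathcomp Require Import finmap.
(* The notations of monalg clash with those of MathComp-Analysis. *)
From mathcomp Require Import -(notations) monalg.
From mathcomp Require Import boolp classical_sets functions reals topology normedtype.
From mathcomp Require Import sequences.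

Set Implicit Arguments.
Unset Strict Implicit.
Unset Printing Implicit Defensive.

Import Order.TTheory GRing.Theory Num.Theory.
Import numFieldNormedType.Exports.

Local Open Scope ring_scope.

(* An index (k_1, ..., k_r) is a list of type [seq nat] with positive entries;
   list positions start at 0, so k_i is [nth 0 k i.-1].  On lists with a zero
   entry the functions below take junk values. *)
Definition is_index (k : seq nat) : bool := all (leq 1) k.

Section Zeta.
Variable R : realType.

(* [path ltn 0 n] says 0 < n_1 < ... < n_r. *)
Definition zeta_trunc (k : seq nat) (N : nat) : R :=
  \sum_(n : (size k).-tuple 'I_N.+1 | path ltn 0%N [seq val m | m <- n])
     \prod_(i < size k) (tnth n i)%:R ^- nth 0%N k i.

Definition zeta (k : seq nat) : R := limn (zeta_trunc k).

End Zeta.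

Notation letter := bool.
Definition lx : letter := false.
Definition ly : letter := true.

(* Q<x,y>, the monoid algebra over Q of the free monoid on {x, y}. *)
Notation HH := (malg (fmonom letter) rat).

Definition word (w : seq letter) : HH := mkmalgU (FMonom w) 1.

Definition H1 (w : HH) : Prop :=
  exists (c : rat) (h : HH), w = c *: 1 + word [:: ly] * h.

Definition H0 (w : HH) : Prop :=
  exists (c : rat) (h : HH), w = c *: 1 + word [:: ly] * h * word [:: lx].

Definition zword (k : seq nat) : seq letter :=
  flatten [seq ly :: nseq m.-1 lx | m <- k].

(* The inverse of [zword], see [index_of_zword]. *)
Definition index_of_word (w : seq letter) : seq nat :=
  (foldr (fun (a : letter) (st : nat * seq nat) =>
            if a then (0%N, st.1.+1 :: st.2) else (st.1.+1, st.2))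
         (0%N, [::]) w).2.

Lemma index_of_zword k : is_index k -> index_of_word (zword k) = k.
Proof.
rewrite /index_of_word; set F := fun _ _ => _.
suff H : is_index k -> foldr F (0%N, [::]) (zword k) = (0%N, k).
  by move=> /H ->.
elim: k => [|m k IH] //= /andP[m0 /IH e].
rewrite foldr_cat e.
have -> (n : nat) : foldr F (0%N, k) (nseq n lx) = (n, k).
  by elim: n => //= n ->.
by rewrite /= prednK.
Qed.

Section MapZ.
Variable R : realType.

(* The Q-linear map with Z(z_k) = zeta(k); only its values on H0 matter. *)
Definition Zmap (w : HH) : R :=
  mmap (ratr : rat -> R) (fun u : fmonom letter => zeta R (index_of_word u)) w.

Lemma Zmap_zword k : is_index k -> Zmap (word (zword k)) = zeta R k.
Proof.
move=> hk; rewrite /Zmap mmapU /=.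
have -> : ratr 1 = 1 :> R by exact: rmorph1.
by rewrite mul1r index_of_zword.
Qed.

End MapZ.

(* Shuffle product of two words given in reverse order. *)
Fixpoint shrev (u : seq letter) : seq letter -> HH :=
  if u is a :: u' then
    fix shu (v : seq letter) : HH :=
      if v is b :: v' then
        shrev u' v * word [:: a] + shu v' * word [:: b]
      else word (rev u)
  else fun v => word (rev v).

Definition shword (u v : seq letter) : HH := shrev (rev u) (rev v).

Lemma shword1l v : shword [::] v = word v.
Proof. by rewrite /shword /= revK. Qed.

Lemma shword1r u : shword u [::] = word u.
Proof.
by rewrite /shword -{2}(revK u); case: (rev u) => [|a u'] //=.
Qed.

Lemma shword_rcons u a v b :
  shword (rcons u a) (rcons v b) =
  shword u (rcons v b) * word [:: a] + shword (rcons u a) v * word [:: b].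
Proof. by rewrite /shword !rev_rcons. Qed.

Definition sh (w1 w2 : HH) : HH :=
  \sum_(u <- msupp w1) \sum_(v <- msupp w2)
     (mcoeff u w1 * mcoeff v w2) *: shword u v.

Section Regularization.
Variable R : realType.

(* The maps H -> R[T] whose restriction to H1 is a Q-algebra homomorphism for
   the shuffle product that extends Z on H0 and maps y to T.  This determines
   the restriction; the values outside H1 are irrelevant. *)
Definition is_shuffle_reg (phi : HH -> {poly R}) : Prop :=
  [/\ forall (a : rat) w1 w2, H1 w1 -> H1 w2 ->
        phi (a *: w1 + w2) = ratr a *: phi w1 + phi w2,
      phi 1 = 1,
      forall w1 w2, H1 w1 -> H1 w2 -> phi (sh w1 w2) = phi w1 * phi w2,
      forall w, H0 w -> phi w = (Zmap R w)%:P
    & phi (word [:: ly]) = 'X].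

Definition Zsh : HH -> {poly R} :=
  xget (fun=> 0) [set phi | is_shuffle_reg phi]%classic.

End Regularization.

(* A tuple s listing X without repetition encodes the bijection f with
   f^-1(m) the m-th entry of s, that is, f(p) = index p s + 1. *)
Definition Wposet (d : Order.disp_t) (X : finPOrderType d)
    (delta : X -> letter) : HH :=
  \sum_(s : #|X|.-tuple X |
          uniq s && [forall p, forall q,
                       (p < q)%O ==> (index p s < index q s)%N])
     word [seq delta p | p <- s].

Definition Xstar (k : seq nat) : Type :=
  {i : 'I_(size k) & 'I_(nth 0%N k i)}.
HB.instance Definition _ k := Finite.on (Xstar k).

Section Xstar.
Variable k : seq nat.
Implicit Types p q : Xstar k.

(* p with chain p = i and height p = m is the element p_{i+1,m+1}. *)
Definition chain p : nat := tag p.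
Definition height p : nat := tagged p.

Definition Xstar_gen : rel (Xstar k) := fun p q =>
  ((chain q == chain p) && (height q == (height p).+1)) ||
  [&& chain q == (chain p).+1, height p == 0%N
    & (height q).+1 == nth 0%N k (chain q)].

Definition Xstar_le : rel (Xstar k) := connect Xstar_gen.

Lemma Xstar_le_refl : reflexive Xstar_le.
Proof. exact: connect0. Qed.

Lemma Xstar_le_trans : transitive Xstar_le.
Proof. exact: connect_trans. Qed.

Lemma Xstar_le_lex p q : Xstar_le p q ->
  (p == q) || (chain p < chain q)%N ||
    ((chain p == chain q) && (height p < height q)%N).
Proof.
move=> /connectP[s]; elim: s p => [|r s IH] p /=; first by move=> _ ->; rewrite eqxx.
case/andP=> pr rs eq; have := IH r rs eq; move: pr.
rewrite /Xstar_gen; case/orP=> [/andP[/eqP <- /eqP e2]|/and3P[/eqP e1 _ _]].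
  case/orP=> [/orP[/eqP <-|->]|/andP[-> lt]]; rewrite ?orbT //.
  - by rewrite e2 eqxx ltnSn orbT.
  - by rewrite (ltn_trans _ lt) ?orbT // e2.
case/orP=> [/orP[/eqP <-|lt]|/andP[/eqP <- _]].
- by rewrite e1 ltnSn orbT.
- by rewrite (ltn_trans _ lt) ?orbT // e1.
- by rewrite e1 ltnSn orbT.
Qed.

Lemma Xstar_le_anti : antisymmetric Xstar_le.
Proof.
move=> p q /andP[/Xstar_le_lex + /Xstar_le_lex].
rewrite (eq_sym q p); have [//|_ /=] := eqVneq p q.
case/orP=> [lt|/andP[/eqP e lt]] /orP[lt'|/andP[/eqP e' lt']].
- by have := ltn_trans lt lt'; rewrite ltnn.
- by rewrite e' ltnn in lt.
- by rewrite e ltnn in lt'.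
- by have := ltn_trans lt lt'; rewrite ltnn.
Qed.

End Xstar.

Definition Xstar_display : Order.disp_t.
Proof. exact: Order.Disp tt tt. Qed.

HB.instance Definition _ k := Order.Le_isPOrder.Build Xstar_display (Xstar k)
  (@Xstar_le_refl k) (@Xstar_le_anti k) (@Xstar_le_trans k).

Definition Xstar_label (k : seq nat) (p : Xstar k) : letter :=
  if height p == 0%N then ly else lx.

Definition wstar (k : seq nat) : HH := Wposet (@Xstar_label k).

(* Formal power series in t, as sequences of coefficients.  Only the additive
   structure is inherited from the functions. *)
Definition fps (R : Type) : Type := nat -> R.
HB.instance Definition _ (R : zmodType) :=
  GRing.Zmodule.copy (fps R) (nat -> R).

Definition fps_const (R : zmodType) (c : R) : fps R :=
  fun n => if n == 0%N then c else 0.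

(* The t-adically convergent sum of F_j t^j over all j >= 0. *)
Definition fps_series (R : zmodType) (F : nat -> fps R) : fps R :=
  fun n => \sum_(j < n.+1) F j (n - j)%N.

Section ZetaStarKY.
Variable R : realType.

Definition zeta_star_KY (k : seq nat) : R := (Zsh R (wstar k)).[0].

(* The coefficient of t^n: the tuple l = (l_{i+1}, ..., l_r) has entries at
   most n because they sum to n. *)
Definition zeta_Shat_star_KY (k : seq nat) : fps R := fun n =>
  \sum_(i < (size k).+1)
    (-1) ^+ sumn (drop i k) * zeta_star_KY (take i k) *
    \sum_(l : (size k - i).-tuple 'I_n.+1 | sumn [seq val m | m <- l] == n)
      (\prod_(j < size k - i)
         'C(nth 0 k (i + j) + tnth l j - 1, tnth l j))%N%:R *
      zeta_star_KY
        (rev [seq (a.1 + val a.2)%N | a <- zip (drop i k) l]).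

End ZetaStarKY.

(* Main.v *)
Require Import Defs.
From HB Require Import structures.
From mathcomp Require Import all_boot all_order all_algebra.
From mathcomp Require Import finmap.
From mathcomp Require Import -(notations) monalg.
From mathcomp Require Import boolp classical_sets functions reals topology normedtype.
From mathcomp Require Import sequences.
From mathcomp Require Import zify ring lra.

Set Implicit Arguments.
Unset Strict Implicit.
Unset Printing Implicit Defensive.

Import Order.TTheory GRing.Theory Num.Theory.
Import numFieldNormedType.Exports.

Local Open Scope ring_scope.

(** For words in H1 the regularization is computed from multiple polylogarithms:
    the partial sums of their coefficients are multiplicative up to O(log^p N / N),
    so their limits give the shuffle homomorphism Z on H0, and zeta^{star,KY}(k) is
    the limit of the truncated star sums when the last entry is at least 2.

    Replacing the weights 1/n of a nested sum by 1/(n - t) turns a value at k into the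
    series of the values at k + l with the binomial coefficients of the definition.
    Expand each summand of the theorem over the cuts of its index.  At the interior
    cuts the products are evaluated by an identity for the alternating sum over j of
    the shuffles of A y x^j and B y x^(l-j+n), and the result telescopes along the
    cuts of the cyclic rotations of the index.  The two extreme cuts give, after
    cancellation of the terms needing regularization, one cyclic sum formula with
    weights 1/(n - t), resp. its value at t = 0.  It is proved for truncated star
    sums from the partial fractions of 1/((p - t)(q - t)); its error term tends to 0
    unless the index is (1, ..., 1), which produces the exceptional term. *)

(** * Words and shuffles *)

(** [Zsh] is picked by [xget], so nothing is known about it until some map satisfying
    [is_shuffle_reg] is exhibited; this forces the analytic construction. All values then enter
    through [shmul]: the same poset combinatorics is applied to [polylog], with values in [fps R],
    and to [zreg], with values in [R], and comparing the two outcomes of [zigzags] links star values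
    with truncated star sums. The obstacle is divergence. A star value whose last entry is 1 comes
    from putting T = 0 and is not a limit of truncated sums, yet such values occur at the interior
    cuts and at the extreme ones. They are handled by algebra alone: the telescoping over interior
    cuts leaves two boundary terms, [head_series] of the rotations and the values at
    [1 :: rev (rot i ks)], and these are what is needed to eliminate the divergent values at the
    extreme cuts. Only indices whose last entry is at least 2 reach the limit argument. *)

Lemma word0 : word [::] = 1.
Proof. by rewrite -mpolyC1E /word -fmoneE. Qed.

Lemma word_cat u v : word (u ++ v) = word u * word v.
Proof.
rewrite /word malgM_def fgmulUU mul1r; congr mkmalgU.
by rewrite /mmul /= /fmmul fmE.
Qed.

Lemma HH_word (w : HH) : w = \sum_(u <- msupp w) mcoeff u w *: word u.
Proof.
rewrite {1}[w]monalgE; apply: eq_bigr => u _.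
by rewrite -[RHS]mul_malgC malgM_def fgmulUU mulr1 mul1m /= fmK.
Qed.

Lemma mcoeff_word u v : mcoeff u (word v) = (v == u :> seq letter)%:R.
Proof. by rewrite /word mcoeffU fmP. Qed.

Lemma mcoeff_wordM a u h :
  mcoeff (FMonom u) (word [:: a] * h) =
  if u is b :: u' then (b == a)%:R * mcoeff (FMonom u') h else 0.
Proof.
rewrite [X in _ * X]HH_word mulr_sumr raddf_sum /=.
have E v : mcoeff (FMonom u) (word [:: a] * (mcoeff v h *: word v)) =
    mcoeff v h * ((a :: v) == u)%:R.
  have -> : mcoeff v h *: word v = mkmalgU v (mcoeff v h).
    by rewrite -mul_malgC malgM_def fgmulUU mulr1 mul1m /= fmK.
  rewrite /word malgM_def fgmulUU mul1r mcoeffU mulr_natr; congr (_ *+ nat_of_bool _).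
  by rewrite /mmul /= /fmmul fmE.
under eq_bigr do rewrite E.
case: u {E} => [|b u]; first by rewrite big1 // => v _; rewrite mulr0.
rewrite [X in _ = _ * mcoeff _ X]HH_word raddf_sum mulr_sumr; apply: eq_bigr => v _.
by rewrite /= mcoeffZ mcoeff_word eqseq_cons [b == a]eq_sym -mulnb natrM mulrCA.
Qed.

Fact lin_key : unit. Proof. exact: tt. Qed.

Section Lin.
Variables (K : nzRingType) (s : {rmorphism rat -> K}) (V : lmodType K).
Variable h : seq letter -> V.

(** The regularization takes values in a module over [R] rather than over the rationals, so the
    linear extension from words is semilinear along [s], which will be [ratr]. *)
Definition lin : HH -> V := locked_with lin_key
  (fun w : HH => \sum_(u <- msupp w) s (mcoeff u w) *: h u).

Lemma linE w : lin w = \sum_(u <- msupp w) s (mcoeff u w) *: h u.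
Proof. by rewrite /lin unlock. Qed.

Lemma lin_is_linear a w1 w2 : lin (a *: w1 + w2) = s a *: lin w1 + lin w2.
Proof.
have linEw (d : {fset (fmonom letter)}) w : (msupp w `<=` d)%fset ->
    lin w = \sum_(u <- d) s (mcoeff u w) *: h u.
  move=> le; rewrite linE (big_fset_incl _ le) //= => x xd /mcoeff_outdom ->.
  by rewrite rmorph0 scale0r.
pose d := (msupp w1 `|` msupp w2 `|` msupp (a *: w1 + w2))%fset.
rewrite !(linEw d) ?fsubsetUr //; last first.
- exact: fsubset_trans (fsubsetUl _ _) (fsubsetUl _ _).
- exact: fsubset_trans (fsubsetUr _ _) (fsubsetUl _ _).
rewrite scaler_sumr -big_split /=; apply: eq_bigr => u _.
by rewrite mcoeffD mcoeffZ rmorphD rmorphM scalerDl scalerA.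
Qed.

HB.instance Definition _ := GRing.isSemilinear.Build rat HH V (s \; *:%R) lin
  (GRing.semilinear_linear (s := s \; *:%R) lin_is_linear).

Lemma lin_word u : lin (word u) = h u.
Proof. by rewrite linE /word msuppU oner_eq0 big_seq_fset1 mcoeffUU rmorph1 scale1r. Qed.

End Lin.

(** [yword] and [yxword] single out the words spanning [H1] and [H0]. The default values make the
    empty word belong to both. *)
Definition yword (u : seq letter) : bool := if u is a :: _ then a else true.
Definition yxword (u : seq letter) : bool := yword u && ~~ last lx u.

Lemma yword_cat u v : yword u -> yword v -> yword (u ++ v).
Proof. by case: u. Qed.

Lemma yword_rcons u a : yword (rcons u a) -> yword u.
Proof. by case: u. Qed.

Lemma yword_zword u : yword u -> exists2 k, is_index k & u = zword k.
Proof.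
elim/last_ind: u => [|u a IH] yu; first by exists [::].
have [k ik ek] := IH (yword_rcons yu).
case: a yu => yu.
  exists (rcons k 1%N); first by rewrite /is_index all_rcons -/(is_index k) ik.
  by rewrite /zword map_rcons flatten_rcons -/(zword k) -ek /= cats1.
case/lastP: k ik ek => [|k b] ik ek; first by rewrite ek in yu.
move: ik; rewrite /is_index all_rcons => /andP[b0 ik].
exists (rcons k b.+1); first by rewrite /is_index all_rcons.
rewrite ek /zword !map_rcons !flatten_rcons rcons_cat; congr (_ ++ _).
by case: b b0 {ek} => //= b _; congr cons; rewrite -cats1 -[RHS]/(nseq b.+1 lx) -addn1 nseqD.
Qed.

Lemma H1_word_add u w : yword u -> H1 w -> H1 (word u + w).
Proof.
case: u => [|[] u] // _ [c [h ->]]; last first.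
  exists c, (word u + h).
  exact: (etrans (addrCA _ _ _) (congr1 (+%R (c *: 1))
    (esym (etrans (mulrDr _ _ _)
      (congr1 (+%R^~ _) (esym (word_cat [:: ly] u))))))).
exists (1 + c), h.
exact: (etrans (addrA _ _ _) (congr1 (+%R^~ _)
  (esym (etrans (scalerDl _ _ _) (congr1 (+%R^~ _)
    (etrans (scale1r _) (esym word0))))))).
Qed.

Lemma H1_sum_word (r : seq (seq letter)) : all yword r -> H1 (\sum_(u <- r) word u).
Proof.
elim: r => [_|u r IH /= /andP[yu /IH h]].
  by exists 0, 0; rewrite big_nil; exact: (esym (etrans (congr1 (+%R _) (mulr0 _))
    (etrans (addr0 _) (scale0r _)))).
by rewrite big_cons; apply: H1_word_add.
Qed.

Lemma H1_word u : yword u -> H1 (word u).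
Proof. by move=> yu; have := @H1_sum_word [:: u]; rewrite big_seq1 /= yu; apply. Qed.

Lemma H1_supp w u : H1 w -> u \in msupp w -> yword u.
Proof.
move=> [c [h ->]]; rewrite -mcoeff_neq0 mcoeffD mcoeffZ; case: u => -[|[] u] //=.
by rewrite -word0 mcoeff_word mcoeff_wordM /= mulr0 mul0r addr0 eqxx.
Qed.

Lemma H0_supp w u : H0 w -> u \in msupp w -> yxword u.
Proof.
move=> [c [h ->]]; rewrite -mcoeff_neq0 mcoeffD mcoeffZ -mulrA; case: u => -[|b u] //=.
rewrite -word0 mcoeff_word mcoeff_wordM /= mulr0 add0r.
case: b => /=; last by rewrite mul0r eqxx.
rewrite mul1r [h]HH_word mulr_suml raddf_sum /=.
case: (boolP (last true u)) => [lu|/negPf nlu _]; last first.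
  by rewrite /yxword /= (_ : last true u = false).
rewrite big1 ?eqxx // => v _; rewrite -scalerAl -word_cat mcoeffZ mcoeff_word.
case: eqP => [e|_]; last by rewrite mulr0.
by move: lu; rewrite -[u]/(fmonom_val (FMonom u)) -e last_cat.
Qed.

Lemma H0_word u : yxword u -> H0 (word u).
Proof.
case/lastP: u => [|u b]; first by exists 1, 0; rewrite word0 scale1r mulr0 mul0r addr0.
rewrite /yxword last_rcons; case: u => [|[] u] //=; first by case: b.
case: b => // _; exists 0, (word u).
by rewrite scale0r add0r -!word_cat /= cats1.
Qed.

Section Shuf.
Variable T : eqType.

Fixpoint shuf (s : seq T) : seq T -> seq (seq T) :=
  if s is a :: s' then
    fix shuf_s (t : seq T) : seq (seq T) :=
      if t is b :: t' then [seq a :: w | w <- shuf s' t] ++ [seq b :: w | w <- shuf_s t']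
      else [:: s]
  else fun t => [:: t].

Lemma shuf0r s : shuf s [::] = [:: s]. Proof. by case: s. Qed.

Lemma size_shuf s t w : w \in shuf s t -> size w = (size s + size t)%N.
Proof.
elim: s t w => [|a s IHs] t w; first by rewrite inE => /eqP->.
elim: t w => [|b t IHt] w; first by rewrite inE addn0 => /eqP->.
rewrite mem_cat => /orP[] /mapP[w' mw ->] /=; first by rewrite (IHs _ _ mw).
by rewrite (IHt _ mw) addnS.
Qed.

End Shuf.

Lemma map_shuf (T T' : eqType) (f : T -> T') s t :
  shuf (map f s) (map f t) = [seq map f w | w <- shuf s t].
Proof.
elim: s t => [|a s IHs] //= t; elim: t => [|b t IHt] //=.
by rewrite map_cat -!map_comp; congr (_ ++ _);
  rewrite ?(IHs (b :: t)) ?IHt -!map_comp; apply: eq_map.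
Qed.

(** The linear extension of [f] evaluated at the shuffle product of two words. The product peels off
    last letters while [shuf] peels off first ones, hence the reversals. *)
Definition shsum (V : nmodType) (f : seq letter -> V) (u v : seq letter) : V :=
  \sum_(w <- shuf (rev u) (rev v)) f (rev w).

Section ShSum.
Variable V : nmodType.
Implicit Type f : seq letter -> V.

Lemma shsum0l f v : shsum f [::] v = f v.
Proof. by rewrite /shsum /= big_seq1 revK. Qed.

Lemma shsum0r f u : shsum f u [::] = f u.
Proof. by rewrite /shsum shuf0r big_seq1 revK. Qed.

Lemma shsum_rcons f u a v b :
  shsum f (rcons u a) (rcons v b) =
  shsum (fun w => f (rcons w a)) u (rcons v b)
  + shsum (fun w => f (rcons w b)) (rcons u a) v.
Proof.
rewrite /shsum !rev_rcons /= big_cat !big_map /=.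
by congr (_ + _); apply: eq_bigr => w _; rewrite rev_cons.
Qed.

Lemma yword_shuf u v w : yword u -> yword v -> w \in shuf (rev u) (rev v) -> yword (rev w).
Proof.
have E x : yword x = last ly (rev x).
  by case: x => [|a x] //; rewrite rev_cons last_rcons.
rewrite !E revK; move: (rev u) (rev v) => {E}u {}v; move: {v}u v w.
have rec a (s : seq letter) : last ly (a :: s) = if s is [::] then a else last ly s.
  by case: s.
elim=> [|a s IHs]; first by move=> v w; rewrite inE => _ ? /eqP->.
elim=> [|b t IHt] w hs ht; first by rewrite inE => /eqP->.
rewrite mem_cat => /orP[] /mapP[w' mw ->]; rewrite rec.
  have sw := size_shuf mw; case: w' mw sw => [|c w'] mw sw; first by rewrite /= addnS in sw.
  by apply: IHs mw => //; move: hs; rewrite rec; case: (s).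
have sw := @size_shuf _ (a :: s) t _ mw; case: w' mw sw => [|c w'] mw sw.
  by rewrite /= addSn in sw.
by apply: IHt mw => //; move: ht; rewrite rec; case: (t).
Qed.

End ShSum.

Lemma shword_sum u v : shword u v = \sum_(w <- shuf (rev u) (rev v)) word (rev w).
Proof.
rewrite /shword; move: (rev u) (rev v) => {}u {}v.
have key a (r : seq (seq letter)) : \sum_(w <- [seq a :: w | w <- r]) word (rev w) =
    (\sum_(w <- r) word (rev w)) * word [:: a].
  by rewrite big_map mulr_suml; apply: eq_bigr => w _; rewrite rev_cons -cats1 word_cat.
elim: u v => [|a u IHu] v; first by rewrite big_seq1.
elim: v => [|b v IHv]; first by rewrite big_seq1.
transitivity (shrev u (b :: v) * word [:: a] + shrev (a :: u) v * word [:: b]); first by [].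
rewrite IHu IHv -!key.
exact: (esym (big_cat _ _ _ _ _)).
Qed.

Lemma sh_word u v : sh (word u) (word v) = shword u v.
Proof.
rewrite /sh /word !msuppU !oner_eq0 !big_seq_fset1 !mcoeffUU mulr1.
exact: scale1r.
Qed.

(* Characters of the shuffle algebra H1, given by their values on words. *)
Definition shmul (C : pzRingType) (f : seq letter -> C) : Prop :=
  f [::] = 1 /\ forall u v, yword u -> yword v -> shsum f u v = f u * f v.

Section Interface.
Variable R : realType.

Section Extract.
Variable phi : HH -> {poly R}.
Hypothesis phi_reg : is_shuffle_reg phi.

Lemma reg_sum (r : seq (seq letter)) :
  all yword r -> phi (\sum_(u <- r) word u) = \sum_(u <- r) phi (word u).
Proof.
have [lin_phi _ _ _ _] := phi_reg.
elim: r => [_|u r IH /= /andP[yu yr]].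
  rewrite !big_nil; have h0 : H1 0 by have := @H1_sum_word [::] isT; rewrite big_nil.
  have := lin_phi (-1) 0 0 h0 h0.
  by rewrite scaler0 add0r rmorphN rmorph1 scaleN1r addNr.
rewrite !big_cons -IH // -[in LHS](scale1r (word u)) lin_phi ?rmorph1 ?scale1r //.
  exact: H1_word.
exact: H1_sum_word.
Qed.

Lemma shmul_reg : shmul (fun w => phi (word w)).
Proof.
have [_ phi1 phiM _ _] := phi_reg.
split=> [|u v yu yv]; first by rewrite word0.
rewrite -phiM; [|exact: H1_word|exact: H1_word].
rewrite sh_word shword_sum /shsum.
rewrite -(big_map rev xpredT (fun w => phi (word w))).
rewrite -(big_map rev xpredT word) reg_sum //.
by apply/allP => _ /mapP[w mw ->]; apply: (yword_shuf yu yv mw).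
Qed.

Lemma reg_yxword u : yxword u -> phi (word u) = (Zmap R (word u))%:P.
Proof. by have [_ _ _ h _] := phi_reg => yu; apply/h/H0_word. Qed.

End Extract.

Lemma Zmap_word u : Zmap R (word u) = zeta R (index_of_word u).
Proof.
rewrite /Zmap mmapU /= (_ : ratr 1 = 1 :> R) ?mul1r //.
exact: rmorph1.
Qed.

Lemma reg_of_shmul (P : seq letter -> {poly R}) :
  shmul P -> (forall u, yxword u -> P u = (Zmap R (word u))%:P) ->
  P [:: ly] = 'X -> is_shuffle_reg (lin (@ratr R) P).
Proof.
move=> [P1 PM] Pyx Py; split.
- by move=> a w1 w2 _ _; rewrite lin_is_linear.
- by rewrite -word0 lin_word.
- move=> w1 w2 h1 h2; rewrite /sh linear_sum /= linE mulr_suml.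
  apply: eq_big_seq => u /(H1_supp h1) yu.
  rewrite linear_sum /= [lin _ _ w2]linE mulr_sumr.
  apply: eq_big_seq => v /(H1_supp h2) yv.
  rewrite linearZ /= shword_sum linear_sum /=.
  under eq_bigr do rewrite lin_word.
  rewrite [X in _ *: X](PM u v) // [ratr (_ * _)](rmorphM (@ratr R)).
  by rewrite -[in RHS](scalerAl _ (P u)) -[in RHS](scalerAr _ (P u)) scalerA.
- move=> w h; rewrite linE /Zmap /mmap rmorph_sum /=.
  apply: eq_big_seq => u /(H0_supp h) yu.
  by rewrite Pyx // Zmap_word -mul_polyC -polyCM.
- by rewrite lin_word.
Qed.

End Interface.

Definition zw (a : nat) : seq letter := ly :: nseq a.-1 lx.

(** * Linear extensions of zigzag posets *)

Section LinExt.
Variables (U : eqType) (delta : U -> letter).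
Implicit Types (s t c d : seq U) (cs : seq (seq U)).

Definition ordered s c : bool := sorted (relpre (index^~ s) ltn) c.

Definition link s c d : bool :=
  if c is p :: _ then if d is q :: d' then (index p s < index (last q d') s)%N else true
  else true.

(* Linear extensions of a disjoint union of chains, the bottom of each chain
   lying below the top of the next one. *)
Definition linext cs : seq (seq U) :=
  [seq s <- permutations (flatten cs) | all (ordered s) cs && sorted (link s) cs].

Lemma mem_map_cons x y s (r : seq (seq U)) :
  (x :: s \in [seq y :: w | w <- r]) = (x == y) && (s \in r).
Proof.
apply/mapP/andP => [[w wr [-> ->]]|[/eqP-> sr]]; first by rewrite eqxx.
by exists s.
Qed.

(** When a predicate separates the letters of the two factors, a shuffle is determined by its two
    subsequences, so membership becomes a pair of filter equations that no longer depend on the side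
    from which the shuffle was built. *)
Lemma mem_shuf (a : pred U) c t s : all a c -> all (predC a) t ->
  (s \in shuf c t) = (seq.filter a s == c) && (seq.filter (predC a) s == t).
Proof.
elim: c t s => [|y c IHc] t s.
  move=> _ at'; rewrite inE; apply/eqP/andP => [->|[/eqP fs /eqP <-]].
    move/all_filterP: (at') => ->; rewrite eqxx; split=> //.
    by rewrite -size_eq0 size_filter -leqn0 leqNgt -has_count -all_predC.
  by apply/esym/all_filterP; rewrite all_predC has_filter fs.
elim: t s => [|z t IHt] s ac at'.
  rewrite inE; apply/eqP/andP => [->|[/eqP <- /eqP fs]].
    move/all_filterP: (ac) => ->; rewrite eqxx; split=> //.
    rewrite -size_eq0 size_filter -leqn0 leqNgt -has_count -all_predC.
    by apply/allP => x /(allP ac) /= ->.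
  apply/esym/all_filterP; have : ~~ has (predC a) s by rewrite has_filter fs.
  by rewrite -all_predC => h; apply/allP => x /(allP h) /=; rewrite negbK.
have /andP[ay ac'] := ac; have /andP[az at''] := at'.
case: s => [|x s].
  by rewrite /= mem_cat; apply/negP => /orP[] /mapP[].
rewrite /= mem_cat !mem_map_cons IHc // -/(shuf (y :: c) t).
rewrite IHt //=.
case: ifP => ax /=; rewrite !eqseq_cons.
  have -> : (x == z) = false by apply/negP => /eqP xz; rewrite -xz /= ax in az.
  by rewrite orbF andbA.
have -> : (x == y) = false by apply/negP => /eqP xy; rewrite -xy ax in ay.
by rewrite /= andbCA.
Qed.

Lemma uniq_shuf (a : pred U) c t : all a c -> all (predC a) t -> uniq (shuf c t).
Proof.
elim: c t => [|y c IHc] //; elim=> [|z t IHt] // ac at'.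
have /andP[ay ac'] := ac; have /andP[az at''] := at'.
have inj_cons (x : U) : injective (cons x) by move=> ? ? [].
rewrite /= cat_uniq !map_inj_uniq // -/(shuf (y :: c) t) IHt // andbT IHc //=; apply/hasPn => w /mapP[w1 _ ->]; rewrite mem_map_cons.
by have -> : (z == y) = false by apply/negP => /eqP zy; rewrite /= zy ay in az.
Qed.

(** Multiplicities arise only from the labels: before [delta] is applied the shuffles are pairwise
    distinct, so building them from first or from last letters gives the same duplicate-free list up
    to permutation. *)
Lemma sum_shuf (V : nmodType) (f : seq letter -> V) (a : pred U) c t :
  all a c -> all (predC a) t ->
  \sum_(s <- shuf c t) f (map delta s) = shsum f (map delta c) (map delta t).
Proof.
move=> ac at'; rewrite /shsum -!map_rev map_shuf big_map.
have ac' : all a (rev c) by rewrite all_rev.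
have at'' : all (predC a) (rev t) by rewrite all_rev.
under [in RHS]eq_bigr do rewrite -map_rev.
rewrite -[RHS](big_map rev xpredT (fun s => f (map delta s))).
apply: perm_big; apply: uniq_perm.
- exact: uniq_shuf ac at'.
- by rewrite map_inj_uniq ?(uniq_shuf ac' at'') //; apply: inv_inj revK.
move=> s; rewrite -[s in RHS]revK mem_map; last exact: inv_inj revK.
rewrite (mem_shuf _ ac at') (mem_shuf _ ac' at'') !filter_rev.
by rewrite !(inj_eq (inv_inj revK)).
Qed.

Lemma ordered_filter s (a : pred U) : uniq s -> ordered s (seq.filter a s).
Proof.
move=> us; rewrite /ordered.
apply: sorted_filter; first by move=> x y z /=; apply: ltn_trans.
case E: {2}s => [|x0 s'] //; rewrite -{}E; apply/(sortedP x0) => i lti.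
by rewrite /= (index_uniq x0 (ltnW lti) us) (index_uniq x0 lti us).
Qed.

Lemma ordered_perm s c : uniq s -> ordered s c -> {subset c <= s} ->
  seq.filter (mem c) s = c.
Proof.
move=> us oc cs; apply: (@irr_sorted_eq _ (relpre (index^~ s) ltn)).
- by move=> x y z /=; apply: ltn_trans.
- by move=> x /=; rewrite ltnn.
- exact: ordered_filter.
- exact: oc.
by move=> x; rewrite mem_filter /=; case xc: (x \in c) => //=; rewrite cs.
Qed.

Lemma index_filter (a : pred U) s x y : a x -> a y ->
  (index x (seq.filter a s) < index y (seq.filter a s))%N = (index x s < index y s)%N.
Proof.
move=> ax ay; elim: s => //= z s IHs; case: ifP => az /=.
  by case: eqP => _; case: eqP => _ //; rewrite !ltnS.
have -> : (z == x) = false by apply/negP => /eqP zx; rewrite zx ax in az.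
have -> : (z == y) = false by apply/negP => /eqP zy; rewrite zy ay in az.
by rewrite ltnS.
Qed.

Lemma ordered_filterE s c (a : pred U) : all a c ->
  ordered (seq.filter a s) c = ordered s c.
Proof.
by apply: eq_in_sorted => x y xa ya /=; apply: index_filter.
Qed.

Lemma link_filterE s c d (a : pred U) : all a c -> all a d ->
  link (seq.filter a s) c d = link s c d.
Proof.
case: c d => [|p c] [|q d] //= /andP[ap _] /andP[aq ad]; apply: index_filter => //.
by have := mem_last q d; rewrite inE => /orP[/eqP->|/(allP ad)].
Qed.

(** With no relation between [c] and the other chains, a linear extension is a free interleaving:
    deleting [c] leaves a linear extension of [cs], since the conditions on [cs] only compare
    positions of elements outside [c]. *)
Lemma linext_disjoint c cs : uniq (c ++ flatten cs) ->
  perm_eq [seq s <- permutations (c ++ flatten cs) |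
             ordered s c && (all (ordered s) cs && sorted (link s) cs)]
          (flatten [seq shuf c t | t <- linext cs]).
Proof.
move=> ucs; have := ucs; rewrite cat_uniq => /and3P[uc /hasPn dj ufl].
have ac : all (mem c) c by apply/allP.
have afl t : perm_eq t (flatten cs) -> all (predC (mem c)) t.
  by move=> /perm_mem pt; apply/allP => x; rewrite pt => /dj.
have condE s : all (ordered (seq.filter (predC (mem c)) s)) cs
    && sorted (link (seq.filter (predC (mem c)) s)) cs
    = all (ordered s) cs && sorted (link s) cs.
  have allC d : d \in cs -> all (predC (mem c)) d.
    move=> dcs; apply/allP => x xd; apply/(allP (afl _ (perm_refl _))).
    by apply/flattenP; exists d.
  congr (_ && _); first by apply: eq_in_all => d /allC; apply: ordered_filterE.
  apply: (@eq_in_sorted _ (mem cs)); last by apply/allP.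
  by move=> d e /= /allC ad /allC ae; apply: link_filterE.
apply: uniq_perm.
- exact: filter_uniq (permutations_uniq _).
- have : uniq (linext cs) by apply: filter_uniq (permutations_uniq _).
  have : {subset linext cs <= permutations (flatten cs)} by apply: mem_subseq; apply: filter_subseq.
  elim: (linext cs) => //= t r IHr sub /andP[tr ur].
  rewrite cat_uniq IHr // ?andbT; last first.
    by move=> x xr; apply: sub; rewrite inE xr orbT.
  have at' : all (predC (mem c)) t.
    by apply: afl; rewrite -mem_permutations; apply: sub; rewrite mem_head.
  rewrite (uniq_shuf ac at') /=; apply/hasPn => s /flatten_mapP[t' t'r].
  have at'' : all (predC (mem c)) t'.
    by apply: afl; rewrite -mem_permutations; apply: sub; rewrite inE t'r orbT.
  rewrite (mem_shuf _ ac at') (mem_shuf _ ac at'') => /andP[_ /eqP->].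
  by apply/negP => /andP[_ /eqP tt']; rewrite tt' (negPf tr) in t'r *.
move=> s; rewrite mem_filter mem_permutations; apply/idP/flatten_mapP.
  case/andP=> /andP[oc cond] ps; have us : uniq s by rewrite (perm_uniq ps).
  have fc : seq.filter (mem c) s = c.
    by apply: ordered_perm => // x xc; rewrite (perm_mem ps) mem_cat xc.
  have pt : perm_eq (seq.filter (predC (mem c)) s) (flatten cs).
    have := permEl (perm_filterC (mem c) s); rewrite fc => /perm_trans /(_ ps).
    by rewrite perm_cat2l.
  exists (seq.filter (predC (mem c)) s).
    by rewrite mem_filter condE cond mem_permutations.
  by rewrite (mem_shuf _ ac (afl _ pt)) fc !eqxx.
case=> t; rewrite mem_filter mem_permutations => /andP[cond pt].
rewrite (mem_shuf _ ac (afl _ pt)) => /andP[/eqP fc /eqP ft].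
have ps : perm_eq s (c ++ flatten cs).
  have := permEl (perm_filterC (mem c) s); rewrite fc ft perm_sym => /perm_trans.
  by apply; rewrite perm_cat2l.
have us : uniq s by rewrite (perm_uniq ps).
by rewrite ps andbT -condE ft cond andbT -fc ordered_filter.
Qed.

(** The first element must be the bottom of its chain: otherwise that bottom would have an index
    smaller than 0. *)
Lemma linext_yword cs t : all (fun c => (c != [::]) && yword (map delta c)) cs ->
  t \in linext cs -> yword (map delta t).
Proof.
move=> hcs; rewrite mem_filter mem_permutations => /andP[/andP[ocs _] pt].
case: t ocs pt => [|x t] // ocs pt /=.
have : x \in flatten cs by rewrite -(perm_mem pt) mem_head.
case/flattenP => c ccs xc; have := allP hcs _ ccs; have := allP ocs _ ccs.
case: c xc {ccs} => [|y c] //=; rewrite inE => /orP[/eqP->|xc] //.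
rewrite /ordered /= path_sortedE; last by move=> a b d /=; apply: ltn_trans.
by case/andP => /allP /(_ _ xc) /=; rewrite eqxx.
Qed.

Section LinextSum.
Variables (C : pzRingType) (f : seq letter -> C).
Hypothesis fM : shmul f.

Definition linext_sum cs : C := \sum_(s <- linext cs) f (map delta s).

(* Either the bottom of c lies below the top of d, or d and c merge into one chain. *)
Lemma linext_sum_rec c d cs :
  uniq (flatten (c :: d :: cs)) ->
  all (fun c => (c != [::]) && yword (map delta c)) (c :: d :: cs) ->
  linext_sum (c :: d :: cs) =
  f (map delta c) * linext_sum (d :: cs) - linext_sum ((d ++ c) :: cs).
Proof.
move=> ucs hcs; apply/eqP; rewrite eq_sym subr_eq eq_sym; apply/eqP.
have hcs' : all (fun c => (c != [::]) && yword (map delta c)) (d :: cs).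
  by case/andP: hcs.
have /andP[/andP[c0 yc] _] := hcs.
have ucs' : uniq (c ++ flatten (d :: cs)) by [].
have E : \sum_(s <- flatten [seq shuf c t | t <- linext (d :: cs)]) f (map delta s) =
    f (map delta c) * linext_sum (d :: cs).
  rewrite big_flatten big_map mulr_sumr; apply: eq_big_seq => t tl.
  have yt := linext_yword hcs' tl; rewrite -(fM.2 _ _ yc yt).
  apply: (sum_shuf _ (a := mem c)); first by apply/allP.
  move: tl ucs'; rewrite mem_filter mem_permutations cat_uniq => /andP[_ pt].
  by case/and3P=> _ /hasPn dj _; apply/allP => x; rewrite (perm_mem pt) => /dj.
(* The product counts linear extensions without relation between [c] and [d]; these are split
   according to whether the bottom of [c] precedes the top of [d]. *)
rewrite -{}E -(perm_big _ (linext_disjoint ucs')) /= big_filter.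
rewrite (bigID (fun s => link s c d)) /=; congr (_ + _).
  rewrite /linext_sum /linext big_filter; apply: eq_bigl => s /=.
  by rewrite -!andbA [link s c d && _]andbC.
have pp : perm_eq (flatten ((d ++ c) :: cs)) (c ++ d ++ flatten cs).
  by rewrite /= -catA perm_catCA.
rewrite /linext_sum /linext big_filter (perm_big _ (perm_permutations pp)).
rewrite big_seq_cond [RHS]big_seq_cond; apply: eq_bigl => s.
rewrite mem_permutations; case ps : (perm_eq _ _) => //=.
have us : uniq s by rewrite (perm_uniq ps).
case: d c {ucs hcs yc pp} c0 hcs' ucs' ps us => [|q d] [|p c] //= _ _.
move=> ucs ps us; rewrite -/(ordered s (q :: d)).
(* Elements being distinct, the failure of the link says that the top of [d] precedes the bottom of
   [c], which is the only comparison that [d ++ c] adds to those inside [d] and [c]. *)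
have oE : ordered s (q :: d ++ p :: c) =
    ordered s (q :: d) && ~~ (index p s < index (last q d) s)%N && ordered s (p :: c).
  rewrite /ordered /= cat_path /= -andbA; congr (_ && (_ && _)).
  rewrite -leqNgt [in RHS]leq_eqVlt; case: eqP => //= e.
  have pin : p \in s by rewrite (perm_mem ps) mem_head.
  have lin : last q d \in s.
    rewrite (perm_mem ps) -/(cat (p :: c) ((q :: d) ++ flatten cs)).
    by rewrite mem_cat mem_cat mem_last orbT.
  have epl : last q d = p.
    by rewrite -(nth_index p pin) -(nth_index p lin) e.
  move: ucs; rewrite -/(cat (q :: d) (flatten cs)) => /andP[/negP[]].
  by rewrite mem_cat -epl mem_cat mem_last orbT.
(* The merged chain has the same bottom as [d], so its link to the next chain is the link of [d]. *)
have -> : ordered s (q :: d ++ p :: c) && all (ordered s) cs &&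
    path (link s) (q :: d ++ p :: c) cs =
    [&& ordered s (q :: d ++ p :: c), all (ordered s) cs & path (link s) (q :: d) cs].
  by rewrite -andbA; case: (cs).
rewrite oE /ordered /=; case: (path _ q d); case: (path _ p c);
  by case: (index p s < _)%N; case: (all _ cs); case: (path _ _ cs).
Qed.

(** The recursion [linext_sum_rec] read on words: [v] is the label word of the current first chain,
    which may already be a merger of several chains, and [ks] gives the lengths of the following
    ones. *)
Fixpoint zigzag (v : seq letter) (ks : seq nat) : C :=
  if ks is a :: ks' then f v * zigzag (zw a) ks' - zigzag (zw a ++ v) ks' else f v.

Lemma linext_sum1 c : uniq c -> linext_sum [:: c] = f (map delta c).
Proof.
move=> uc; rewrite /linext_sum.
suff /(perm_big _) -> : perm_eq (linext [:: c]) [:: c] by rewrite big_seq1.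
apply: uniq_perm => // [|s]; first exact: filter_uniq (permutations_uniq _).
rewrite mem_filter mem_permutations /= cats0 !andbT inE.
apply/andP/eqP => [[os ps]|->].
  have us : uniq s by rewrite (perm_uniq ps).
  have sc : {subset c <= s} by move=> x; rewrite (perm_mem ps).
  rewrite -[RHS](ordered_perm us os sc); apply/esym/all_filterP/allP => x.
  by rewrite (perm_mem ps).
by split=> //; have := ordered_filter predT uc; rewrite filter_predT.
Qed.

Lemma linext_sum_zigzag c cs ks : uniq (flatten (c :: cs)) -> c != [::] ->
  yword (map delta c) -> map (map delta) cs = map zw ks ->
  linext_sum (c :: cs) = zigzag (map delta c) ks.
Proof.
move=> ucs c0 yc; elim: ks c cs ucs c0 yc => [|a ks IH] c [|d cs] //= ucs c0 yc.
  by move=> _; rewrite linext_sum1 //; move: ucs; rewrite cats0.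
case=> ed ecs.
have hd : (d != [::]) && yword (map delta d) by rewrite ed andbT; case: (d) ed.
have hcs : all (fun c => (c != [::]) && yword (map delta c)) cs.
  apply/allP => e /(map_f (map delta)); rewrite ecs => /mapP[b _ eb].
  by rewrite eb andbT; case: (e) eb.
case/andP: hd => d0 yd.
rewrite linext_sum_rec //; last by rewrite /= c0 yc d0 yd hcs.
rewrite (IH d) //; last by move: ucs; rewrite cat_uniq => /and3P[].
rewrite (IH (d ++ c)) ?map_cat ?ed //.
- by rewrite /= -catA uniq_catCA.
- by case: (d) d0.
Qed.

Definition zigzags (ks : seq nat) : C :=
  if ks is a :: ks' then zigzag (zw a) ks' else 1.

Lemma linext_sum_zigzags cs ks : uniq (flatten cs) ->
  map (map delta) cs = map zw ks -> linext_sum cs = zigzags ks.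
Proof.
case: cs ks => [|c cs] [|a ks] //=.
  by move=> _ _; rewrite /linext_sum /linext /= big_seq1 fM.1.
move=> uc [ec ecs]; rewrite (linext_sum_zigzag _ _ _ ecs) ?ec //.
by case: c ec {uc}.
Qed.

End LinextSum.
End LinExt.

(** * The poset of an index as a list of linked chains *)

Section XstarWords.
Variable k : seq nat.
Hypothesis k_index : is_index k.

Definition Xelt (i : 'I_(size k)) (m : 'I_(nth 0%N k i)) : Xstar k :=
  Tagged (fun i : 'I_(size k) => 'I_(nth 0%N k i)) m.

Definition Xchain (i : 'I_(size k)) : seq (Xstar k) :=
  [seq Xelt m | m <- enum 'I_(nth 0%N k i)].

Definition Xchains : seq (seq (Xstar k)) := [seq Xchain i | i <- enum 'I_(size k)].

Lemma Xelt_inj i : injective (@Xelt i).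
Proof. by move=> m n /eqP; rewrite /Xelt eq_Tagged => /eqP. Qed.

Lemma Xchains_enum : perm_eq (flatten Xchains) (enum {: Xstar k}).
Proof.
apply: uniq_perm; last first.
- move=> [i m]; rewrite mem_enum; apply/flatten_mapP; exists i; rewrite ?mem_enum //.
  by apply: map_f; rewrite mem_enum.
- exact: enum_uniq.
rewrite /Xchains; have := enum_uniq 'I_(size k).
elim: (enum _) => //= i r IH /andP[ir ur]; rewrite cat_uniq IH // andbT.
rewrite map_inj_uniq ?enum_uniq /=; last exact: Xelt_inj.
apply/hasPn => p /flatten_mapP[j jr /mapP[m _ ->]].
apply/negP => /mapP[n _] /(congr1 tag) /= ji.
by rewrite -ji jr in ir.
Qed.

Lemma Xpos (i : 'I_(size k)) : (0 < nth 0%N k i)%N.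
Proof. by have /allP := k_index; apply; apply: mem_nth. Qed.

Lemma Xchains_words : map (map (@Xstar_label k)) Xchains = map zw k.
Proof.
have -> : map zw k = [seq zw (nth 0%N k (val i)) | i <- enum 'I_(size k)].
  rewrite (map_comp (fun j => zw (nth 0%N k j)) (val : 'I_(size k) -> nat)) val_enum_ord.
  by rewrite -[X in map zw X](mkseq_nth 0%N k) /mkseq -map_comp.
rewrite /Xchains -map_comp; apply: eq_map => i /=.
rewrite /Xchain -map_comp.
rewrite (eq_map (g := (fun m => if m == 0%N then ly else lx) \o val)) //.
rewrite map_comp val_enum_ord /zw; case: (nth 0%N k i) (Xpos i) => //= n _.
suff E b : [seq if m == 0%N then ly else lx | m <- iota b.+1 n] = nseq n lx by rewrite E.
by elim: n b => //= n IH b; rewrite IH.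
Qed.

Lemma Xchains_pos : all (fun c => (c != [::]) && yword (map (@Xstar_label k) c)) Xchains.
Proof.
apply/allP => c /(map_f (map (@Xstar_label k))); rewrite Xchains_words.
by case/mapP => a _ e; rewrite e andbT; case: c e.
Qed.

Lemma Xstar_gen_lt (p q : Xstar k) : Xstar_gen p q -> (p < q)%O.
Proof.
move=> g; rewrite lt_neqAle; apply/andP; split; last exact: connect1.
apply: contraL g => /eqP ->; rewrite /Xstar_gen.
by rewrite !(ltn_eqF (ltnSn _)) andbF.
Qed.

Section Order.
Variable s : seq (Xstar k).
Hypothesis ps : perm_eq s (enum {: Xstar k}).

Let mem_s p : p \in s. Proof. by rewrite (perm_mem ps) mem_enum. Qed.

Lemma ordered_Xchain (i : 'I_(size k)) :
  ordered s (Xchain i) =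
  [forall m, forall n, (val n == (val m).+1) ==> (index (@Xelt i m) s < index (@Xelt i n) s)%N].
Proof.
have x0 : 'I_(nth 0%N k i) := Ordinal (Xpos i).
apply/(sortedP (Xelt x0))/forallP => [h m|h j].
  apply/forallP => n; apply/implyP => /eqP e.
  have := h m; rewrite size_map size_enum_ord -e => /(_ (ltn_ord n)).
  rewrite /Xchain (nth_map x0) ?size_enum_ord ?ltn_ord //.
  rewrite (nth_map x0) ?size_enum_ord ?ltn_ord //.
  by rewrite (nth_ord_enum x0 m) (nth_ord_enum x0 n).
rewrite size_map size_enum_ord => lj; have lj' := ltnW lj.
rewrite /Xchain (nth_map x0) ?size_enum_ord // (nth_map x0) ?size_enum_ord //.
have /forallP := h (nth x0 (enum 'I__) j).
by move/(_ (nth x0 (enum 'I__) j.+1)); rewrite /= !nth_enum_ord // ?eqxx.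
Qed.

Lemma link_Xchain (i j : 'I_(size k)) :
  link s (Xchain i) (Xchain j) =
  [forall m, forall n, (val m == 0%N) ==> ((val n).+1 == nth 0%N k j) ==>
     (index (@Xelt i m) s < index (@Xelt j n) s)%N].
Proof.
have x0 := Ordinal (Xpos i); have y0 := Ordinal (Xpos j).
have -> : link s (Xchain i) (Xchain j) =
    (index (Xelt (nth x0 (enum 'I_(nth 0%N k i)) 0%N)) s
     < index (Xelt (nth y0 (enum 'I_(nth 0%N k j)) (nth 0%N k j).-1)) s)%N.
  rewrite -(nth_map x0 (Xelt x0)) ?size_enum_ord ?Xpos //.
  rewrite -(nth_map y0 (Xelt y0)) ?size_enum_ord ?prednK ?Xpos //.
  rewrite -/(Xchain i) -/(Xchain j).
  have := size_map (@Xelt i) (enum 'I_(nth 0%N k i)); rewrite -/(Xchain i) size_enum_ord.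
  have := size_map (@Xelt j) (enum 'I_(nth 0%N k j)); rewrite -/(Xchain j) size_enum_ord.
  case: (Xchain j) => [e|q d' e]; first by have := Xpos j; rewrite -e.
  case: (Xchain i) => [e'|p c' e']; first by have := Xpos i; rewrite -e'.
  by rewrite -e /= (last_nth (Xelt y0)).
apply/idP/forallP => [h m|h].
  apply/forallP => n; apply/implyP => /eqP m0; apply/implyP => /eqP n1.
  have <- : nth x0 (enum 'I_(nth 0%N k i)) 0%N = m.
    by apply: ord_inj; rewrite nth_enum_ord ?Xpos.
  have <- // : nth y0 (enum 'I_(nth 0%N k j)) (nth 0%N k j).-1 = n.
  apply: ord_inj; rewrite nth_enum_ord ?prednK ?Xpos //; exact: esym (congr1 predn n1).
have /forallP := h (nth x0 (enum 'I__) 0%N).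
move/(_ (nth y0 (enum 'I__) (nth 0%N k j).-1)).
have e1 : val (nth x0 (enum 'I_(nth 0%N k i)) 0%N) = 0%N by apply: nth_enum_ord; apply: Xpos.
have e2 : val (nth y0 (enum 'I_(nth 0%N k j)) (nth 0%N k j).-1) = (nth 0%N k j).-1.
  by apply: nth_enum_ord; rewrite prednK ?Xpos.
by rewrite e1 e2 prednK ?Xpos // !eqxx.
Qed.

(** The order is generated by two kinds of pairs, neighbours in a chain and bottom to next top. The
    first kind is [ordered], the second is [link], and comparisons along generators propagate along
    paths. *)
Lemma Xstar_linext :
  uniq s && [forall p : Xstar k, forall q, (p < q)%O ==> (index p s < index q s)%N] =
  all (ordered s) Xchains && sorted (link s) Xchains.
Proof.
have us : uniq s by rewrite (perm_uniq ps) enum_uniq.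
rewrite us /=; apply/idP/idP => [/forallP h|].
  have lt_gen p q : Xstar_gen p q -> (index p s < index q s)%N.
    by move=> g; have /forallP/(_ q)/implyP := h p; apply; apply: Xstar_gen_lt.
  apply/andP; split.
    apply/allP => _ /mapP[i _ ->]; rewrite ordered_Xchain.
    apply/forallP => m; apply/forallP => n; apply/implyP => e.
    by apply: lt_gen; rewrite /Xstar_gen /chain /height /= eqxx e.
  rewrite /Xchains; case: (posnP (size k)) => [k0|k0].
    by rewrite (size0nil (etrans (size_enum_ord _) k0)).
  have x0 := Ordinal k0.
  apply/(sortedP (Xchain x0)) => i; rewrite size_map size_enum_ord => li; have li' := ltnW li.
  rewrite (nth_map x0) ?size_enum_ord // (nth_map x0) ?size_enum_ord // link_Xchain.
  apply/forallP => m; apply/forallP => n; apply/implyP => m0; apply/implyP => n1.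
  apply: lt_gen; rewrite /Xstar_gen; apply/orP; right.
  rewrite /chain /height /= (eqP m0) /= -[nat_of_ord n]/(val n) (eqP n1).
  have e1 : val (nth x0 (enum 'I_(size k)) i) = i by apply: nth_enum_ord.
  have e2 : val (nth x0 (enum 'I_(size k)) i.+1) = i.+1 by apply: nth_enum_ord.
  by rewrite -!/(val (nth x0 _ _)) e1 e2 !eqxx.
case/andP=> /allP oall lall.
have lt_gen p q : Xstar_gen p q -> (index p s < index q s)%N.
  case: p q => [i m] [j n]; rewrite /Xstar_gen /chain /height /=.
  case/orP => [/andP[/eqP /val_inj ji]|/and3P[/eqP ji m0 n1]].
    case: i / ji m => m mn.
    have := oall (Xchain j); rewrite map_f ?mem_enum // => /(_ isT).
    by rewrite ordered_Xchain => /forallP/(_ m)/forallP/(_ n); rewrite /= mn.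
  have k0 : (0 < size k)%N by apply: leq_ltn_trans (ltn_ord i).
  have x0 := Ordinal k0.
  have := elimT (sortedP (Xchain x0)) lall i.
  rewrite size_map size_enum_ord -ji ltn_ord => /(_ isT).
  rewrite /Xchains (nth_map x0) ?size_enum_ord // (nth_map x0) ?size_enum_ord //.
  rewrite !nth_ord_enum.
  by rewrite link_Xchain => /forallP/(_ m)/forallP/(_ n); rewrite /= m0 n1.
have le_conn p q : connect (@Xstar_gen k) p q -> (index p s <= index q s)%N.
  case/connectP => r; elim: r p => [|r0 r IH] p /=; first by move=> _ ->.
  by case/andP=> /lt_gen lt /IH le e; apply: leq_trans (ltnW lt) (le e).
apply/forallP => p; apply/forallP => q; apply/implyP; rewrite lt_neqAle => /andP[npq lepq].
rewrite ltn_neqAle le_conn // andbT; apply: contra npq => /eqP e.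
by rewrite -(nth_index p (mem_s p)) e nth_index.
Qed.

End Order.
End XstarWords.

Definition wstar_words (k : seq nat) : seq (seq letter) :=
  [seq map (@Xstar_label k) s | s <- linext (Xchains k)].

Section WstarWords.
Variable k : seq nat.
Hypothesis k_index : is_index k.

Lemma wstarE : wstar k = \sum_(u <- wstar_words k) word u.
Proof.
rewrite /wstar /Wposet /wstar_words big_map.
pose P (s : #|{: Xstar k}|.-tuple (Xstar k)) := uniq s &&
  [forall p : Xstar k, forall q, (p < q)%O ==> (index p s < index q s)%N].
rewrite -/P.
transitivity (\sum_(s <- [seq tval s | s <- enum P]) word (map (@Xstar_label k) s)).
  by rewrite big_map -big_enum.
apply: perm_big; apply: uniq_perm.
- by rewrite map_inj_uniq ?enum_uniq //; apply: val_inj.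
- exact: filter_uniq (permutations_uniq _).
move=> s; rewrite mem_filter mem_permutations (permPr (Xchains_enum k)).
apply/mapP/andP => [[t]|[cond ps]].
  rewrite mem_enum => Pt ->; have Pt' : P t := Pt; case/andP: (Pt') => ut _.
  have pt : perm_eq t (enum {: Xstar k}).
    apply: uniq_perm => //; first exact: enum_uniq.
    move=> p; rewrite mem_enum.
    have sub : {subset t <= enum {: Xstar k}} by move=> q _; rewrite mem_enum.
    have le : (size (enum {: Xstar k}) <= size t)%N by rewrite size_tuple cardE.
    by have [_ ->] := uniq_min_size ut sub le; rewrite mem_enum.
  by split=> //; rewrite -Xstar_linext.
have ss : size s == #|{: Xstar k}| by rewrite (perm_size ps) cardE.
exists (Tuple ss) => //; rewrite mem_enum /in_mem /= /P /=.
by rewrite Xstar_linext.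
Qed.

Lemma wstar_yword : all yword (wstar_words k).
Proof.
apply/allP => _ /mapP[s /(linext_yword (Xchains_pos k_index)) ys ->]; exact: ys.
Qed.

Lemma sum_wstar_words (C : pzRingType) (f : seq letter -> C) :
  shmul f -> \sum_(u <- wstar_words k) f u = zigzags f k.
Proof.
move=> fM; rewrite big_map; apply: (linext_sum_zigzags fM).
  by rewrite (perm_uniq (Xchains_enum k)) enum_uniq.
exact: Xchains_words.
Qed.

(** The last letter belongs to a maximal element. An element labelled [ly] is the bottom of its
    chain, so it lies below another element of that chain, or, if the chain has length 1, below the
    top of the next chain; the hypothesis says that the last chain has length at least 2. *)
Lemma wstar_yxword : (2 <= last 2 k)%N -> all yxword (wstar_words k).
Proof.
move=> k2; apply/allP => _ /mapP[s ls ->]; rewrite /yxword.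
have -> /= := linext_yword (Xchains_pos k_index) ls.
move: ls; rewrite mem_filter mem_permutations (permPr (Xchains_enum k)) => /andP[cond ps].
have us : uniq s by rewrite (perm_uniq ps) enum_uniq.
move: cond; rewrite -Xstar_linext // us /= => /forallP cond.
case/lastP: s ps us cond => // s p ps us cond.
rewrite map_rcons last_rcons /Xstar_label; case: eqP => // h0; exfalso.
have max q : ~~ (p < q)%O.
  apply/negP => pq; have /forallP/(_ q) := cond p; rewrite pq /= => lt.
  have : (index q (rcons s p) < size (rcons s p))%N.
    by rewrite index_mem (perm_mem ps) mem_enum.
  rewrite size_rcons ltnS leqNgt (leq_trans _ lt) // ltnS.
  rewrite -cats1 index_cat /= eqxx addn0.
  by move: us; rewrite rcons_uniq => /andP[/negPf->].
case: p {ps us cond} h0 max => i m; rewrite /height /= => m0 max.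
have ik := ltn_ord i; have [ki|ki] := ltnP 1 (nth 0%N k i).
  have /negP := max (Tagged (fun i : 'I_(size k) => 'I_(nth 0%N k i)) (Ordinal ki)).
  by apply; apply: Xstar_gen_lt; rewrite /Xstar_gen /chain /height /= eqxx m0.
have li : (i.+1 < size k)%N.
  rewrite ltn_neqAle ik andbT; apply: contraTneq k2 => ei.
  have e : (size k).-1 = i := esym (congr1 predn ei).
  by rewrite -nth_last e (set_nth_default 0%N) // -ltnNge.
have kpos := Xpos k_index (Ordinal li); rewrite /= in kpos.
have lt : ((nth 0%N k i.+1).-1 < nth 0%N k (Ordinal li))%N by rewrite /= prednK.
have /negP := max (Tagged (fun i : 'I_(size k) => 'I_(nth 0%N k i)) (Ordinal lt)).
apply; apply: Xstar_gen_lt; rewrite /Xstar_gen /chain /height /= m0.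
by rewrite prednK // !eqxx orbT.
Qed.

End WstarWords.

(** * The ring of formal power series *)

Section FpsRing.
Variable R : comNzRingType.
Implicit Types f g h : fps R.

Definition fps_one : fps R := fps_const 1.
Definition fps_mul f g : fps R := fun n => \sum_(i < n.+1) f i * g (n - i)%N.

Let trunc N f : {poly R} := \poly_(i < N) f i.

(** Coefficients below [N] depend only on truncations, so the ring laws for series are inherited
    from polynomials. *)
Let fps_mulE N f g n : (n < N)%N -> fps_mul f g n = (trunc N f * trunc N g)`_n.
Proof.
move=> nN; rewrite coefM; apply: eq_bigr => i _.
have iN : (i < N)%N by apply: leq_ltn_trans nN; rewrite -ltnS.
by rewrite !coef_poly iN (leq_ltn_trans (leq_subr _ _) nN).
Qed.

Let trunc_mul N f g n : (n < N)%N -> (trunc N (fps_mul f g))`_n = (trunc N f * trunc N g)`_n.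
Proof. by move=> nN; rewrite coef_poly nN (fps_mulE _ _ nN). Qed.

Fact fps_mulA : associative fps_mul.
Proof.
move=> f g h; apply/funext => n; rewrite !(fps_mulE (N := n.+1)) //.
transitivity ((trunc n.+1 f * (trunc n.+1 g * trunc n.+1 h))`_n).
  rewrite !coefM; apply: eq_bigr => i _; rewrite trunc_mul //.
  exact: leq_subr.
by rewrite mulrA !coefM; apply: eq_bigr => i _; rewrite trunc_mul.
Qed.

Fact fps_mulC : commutative fps_mul.
Proof.
by move=> f g; apply/funext => n; rewrite !(fps_mulE (N := n.+1)) // mulrC.
Qed.

Fact fps_mul1 : left_id fps_one fps_mul.
Proof.
move=> f; apply/funext => n; rewrite /fps_mul big_ord_recl /= subn0.
rewrite /fps_one /fps_const eqxx mul1r big1 ?addr0 // => i _.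
by rewrite mul0r.
Qed.

Fact fps_mulDl : left_distributive fps_mul +%R.
Proof.
move=> f g h; apply/funext => n.
transitivity (fps_mul f h n + fps_mul g h n); last by [].
rewrite /fps_mul -big_split /=.
by apply: eq_bigr => i _; rewrite -mulrDl.
Qed.

Fact fps_one_neq0 : fps_one != 0.
Proof. by apply/eqP => /(congr1 (@^~ 0%N)) /eqP; rewrite /fps_one /fps_const /= oner_eq0. Qed.

HB.instance Definition _ := GRing.Zmodule_isComNzRing.Build (fps R)
  fps_mulA fps_mulC fps_mul1 fps_mulDl fps_one_neq0.

Lemma fpsM f g n : (f * g) n = \sum_(i < n.+1) f i * g (n - i)%N.
Proof. by []. Qed.

Lemma fpsD f g n : (f + g) n = f n + g n. Proof. by []. Qed.
Lemma fpsN f n : (- f) n = - f n. Proof. by []. Qed.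
Lemma fpsB f g n : (f - g) n = f n - g n. Proof. by []. Qed.
Lemma fps0 n : (0 : fps R) n = 0. Proof. by []. Qed.
Lemma fps1 n : (1 : fps R) n = (n == 0%N)%:R.
Proof. by rewrite [LHS]/(fps_const 1 n) /fps_const; case: eqP. Qed.

Lemma fps_sum (I : Type) (r : seq I) (P : pred I) (F : I -> fps R) n :
  (\sum_(i <- r | P i) F i) n = \sum_(i <- r | P i) F i n.
Proof. by elim/big_rec2: _ => [|i x y _ <-]. Qed.

Lemma fpsP f g : (forall n, f n = g n) -> f = g.
Proof. by move=> fg; apply/funext. Qed.

Lemma fps_constM c f n : (fps_const c * f) n = c * f n.
Proof.
rewrite fpsM big_ord_recl subn0 /= big1 ?addr0 // => i _.
by rewrite /fps_const mul0r.
Qed.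

Fact fps_const_is_additive : {morph @fps_const R : x y / x - y}.
Proof. by move=> x y; apply: fpsP => n; rewrite fpsB /fps_const; case: eqP; rewrite ?subr0. Qed.
HB.instance Definition _ := GRing.isZmodMorphism.Build R (fps R) (@fps_const R)
  fps_const_is_additive.

Fact fps_const_is_multiplicative : monoid_morphism (@fps_const R).
Proof.
split=> // x y; apply: fpsP => n; rewrite fps_constM /fps_const.
by case: eqP => //; rewrite mulr0.
Qed.
HB.instance Definition _ := GRing.isMonoidMorphism.Build R (fps R) (@fps_const R)
  fps_const_is_multiplicative.

End FpsRing.

(** * Multiple polylogarithms *)

Section PolylogSeries.
Variable R : numFieldType.
Implicit Types f g : fps R.

(* z (d/dz) on power series in z. *)
Definition theta f : fps R := fun n => n%:R * f n.

Lemma thetaM f g : theta (f * g) = theta f * g + f * theta g.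
Proof.
apply: fpsP => n; rewrite fpsD /theta !fpsM mulr_sumr -big_split /=.
apply: eq_bigr => i _; have /subnKC {1}<- : (i <= n)%N by rewrite -ltnS.
by rewrite natrD; ring.
Qed.

Lemma theta_sum (I : Type) (r : seq I) (F : I -> fps R) :
  theta (\sum_(i <- r) F i) = \sum_(i <- r) theta (F i).
Proof. by apply: fpsP => n; rewrite /theta !fps_sum mulr_sumr. Qed.

Lemma theta_inj f g : theta f = theta g -> f 0%N = g 0%N -> f = g.
Proof.
move=> e e0; apply: fpsP => -[//|n].
have /(congr1 (@^~ n.+1)) := e; rewrite /theta; apply: mulfI.
by rewrite pnatr_eq0.
Qed.

Definition psum f (N : nat) : R := \sum_(i < N.+1) f i.

(* The power series of z / (1 - z) and 1: the differential forms dz/(1-z) and dz/z. *)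
Definition form (a : letter) : fps R := if a then (fun n => (n != 0%N)%:R) : fps R else (1 : fps R).

Lemma form_yE f n : (form ly * f) n = \sum_(i < n) f i.
Proof.
rewrite mulrC fpsM big_ord_recr /= subnn mulr0 addr0; apply: eq_bigr => i _.
by rewrite -lt0n subn_gt0 ltn_ord mulr1.
Qed.

Lemma form_xE : form lx = 1. Proof. by []. Qed.

(** Dividing the coefficient by [n] inverts [theta]. At [n = 0] the value [0^-1 = 0] makes the
    constant term vanish, as for an integral starting at 0; for a word beginning with [lx] this
    would hide a divergence at 0, which [yword] rules out. *)
Fixpoint polylog_rev (r : seq letter) : fps R :=
  if r is a :: r' then fun n => ((form a * polylog_rev r') n / n%:R) else (1 : fps R).

(* Coefficients of the multiple polylogarithm, the iterated integral of u over [0, z]. *)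
Definition polylog (u : seq letter) : fps R := polylog_rev (rev u).

Lemma polylog_rcons u a n :
  polylog (rcons u a) n = (form a * polylog u) n / n%:R.
Proof. by rewrite /polylog rev_rcons. Qed.

Lemma polylog_nil : polylog [::] = 1.
Proof. by []. Qed.

Lemma polylog0 u : polylog u 0%N = (u == [::])%:R.
Proof.
case/lastP: u => [|u a]; first by [].
by rewrite polylog_rcons invr0 mulr0; case: u.
Qed.

Lemma theta_polylog u a : yword (rcons u a) ->
  theta (polylog (rcons u a)) = form a * polylog u.
Proof.
move=> yu; apply: fpsP => -[|n]; last first.
  by rewrite /theta polylog_rcons mulrC divfK // pnatr_eq0.
rewrite /theta mul0r; case: a yu => yu; first by rewrite form_yE big_ord0.
by rewrite form_xE mul1r polylog0; case: u yu.
Qed.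

(** Induction on the total length. Applying [theta] turns the product into the Leibniz rule and the
    shuffle into its recursion on last letters, so both sides have the same derivative; for nonempty
    words both constant terms are 0. *)
Lemma polylog_shmul : shmul polylog.
Proof.
split=> // u v.
move: {2}(size u + size v)%N (erefl (size u + size v)%N) => n.
elim: n u v => [|n IH] u v; case/lastP: u => [|u a]; case/lastP: v => [|v b] //;
  rewrite ?shsum0l ?shsum0r ?mul1r ?mulr1 //.
  by rewrite size_rcons addSn.
rewrite !size_rcons addSn addnS => -[e] yu yv; apply: theta_inj; last first.
  rewrite fpsM big_ord_recl big_ord0 addr0 subnn !polylog0 -!size_eq0 !size_rcons mulr0.
  rewrite /shsum fps_sum big_seq big1 // => w /size_shuf.
  rewrite !size_rev !size_rcons; case: w => [|c w] //= _.
  by rewrite polylog0 rev_cons -size_eq0 size_rcons.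
have half x y c : yword x -> yword y -> (x != [::]) || (y != [::]) ->
    theta (shsum (fun w => polylog (rcons w c)) x y) = form c * shsum polylog x y.
  move=> yx yy ne; rewrite theta_sum /shsum mulr_sumr; apply: eq_big_seq => w mw.
  apply: theta_polylog; have := yword_shuf yx yy mw.
  have := size_shuf mw; rewrite !size_rev; case/lastP: w mw => [|w d] _.
    by case: x {yx} ne => //; case: y {yy}.
  by rewrite rev_rcons.
have yu' := yword_rcons yu; have yv' := yword_rcons yv.
have thetaD (F G : fps R) : theta (F + G) = theta F + theta G.
  by apply: fpsP => m; rewrite fpsD /theta fpsD mulrDr.
rewrite thetaM !theta_polylog // shsum_rcons thetaD !half //.
- by rewrite IH ?size_rcons ?addnS // IH ?size_rcons ?addSn //; ring.
- by rewrite -size_eq0 size_rcons.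
- by rewrite -[rcons v b == _]size_eq0 size_rcons orbT.
Qed.

End PolylogSeries.

(** * Growth estimates with powers of the logarithm *)

Section Harmonic.
Variable R : realType.
Implicit Types s t : nat -> R.

(** Stands in for the logarithm. The shift of the index keeps it at least 1 everywhere, so that its
    powers increase with the exponent. *)
Definition harm (N : nat) : R := \sum_(i < N.+1) i.+1%:R^-1.

Lemma harmS N : harm N.+1 = harm N + N.+2%:R^-1.
Proof. by rewrite /harm big_ord_recr. Qed.

Lemma harm_ge1 N : 1 <= harm N.
Proof.
elim: N => [|N IH]; first by rewrite /harm big_ord1 invr1.
by rewrite harmS; apply: le_trans IH _; rewrite lerDl invr_ge0.
Qed.

Lemma harm_gt0 N : 0 < harm N.
Proof. exact: lt_le_trans ltr01 (harm_ge1 N). Qed.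

Lemma harm_mono m n : (m <= n)%N -> harm m <= harm n.
Proof.
move=> /subnK <-; elim: (n - m)%N => // d IH.
by rewrite addSn harmS; apply: le_trans IH _; rewrite lerDl invr_ge0.
Qed.

Lemma expr_sub_le (a b : R) p : 0 <= a -> a <= b ->
  b ^+ p.+1 - a ^+ p.+1 <= p.+1%:R * b ^+ p * (b - a).
Proof.
move=> a0 ab; have b0 : 0 <= b by apply: le_trans ab.
elim: p => [|p IH]; first by rewrite !expr1 expr0 !mul1r.
have -> : b ^+ p.+2 - a ^+ p.+2 = b * (b ^+ p.+1 - a ^+ p.+1) + a ^+ p.+1 * (b - a).
  by rewrite !(exprS _ p.+1); ring.
have h1 := ler_wpM2l b0 IH.
have h2 : a ^+ p.+1 * (b - a) <= b ^+ p.+1 * (b - a).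
  by apply: ler_wpM2r; rewrite ?subr_ge0 // lerXn2r // nnegrE.
apply: le_trans (lerD h1 h2) _.
by rewrite -[p.+2]addn1 natrD [b ^+ p.+1]exprS; rewrite le_eqVlt; apply/orP; left; apply/eqP; ring.
Qed.

(** Abel summation, by induction on [p]. The boundary term is kept on the left both because it makes
    the induction on [N] close and because its boundedness says that every power of the logarithm is
    O(N). *)
Lemma harm_sum_bound p : exists C : R, forall N,
  \sum_(n < N.+1) harm n ^+ p / (n.+1%:R * n.+2%:R) + harm N ^+ p / N.+2%:R <= C.
Proof.
elim: p => [|p [C IH]].
  exists 1; elim=> [|N IH].
    by rewrite big_ord1 /= !expr0 !mul1r; lra.
  rewrite big_ord_recr /=; apply: le_trans IH; rewrite -addrA lerD2l !expr0 !mul1r.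
  rewrite le_eqVlt; apply/orP; left; apply/eqP.
  have x0 : 0 <= N%:R :> R by [].
  by field; rewrite ?andbT; repeat (apply/andP; split); apply: lt0r_neq0; lra.
(* The 1 is the value of the left side at [N = 0]. The 2 comes from 1/(N+2)^2 <= 2/((N+2)(N+3)), and
   the factor p + 1 from the increment of a power in [expr_sub_le]. *)
exists (1 + 2 * p.+1%:R * C) => N.
have key : \sum_(n < N.+1) harm n ^+ p.+1 / (n.+1%:R * n.+2%:R) + harm N ^+ p.+1 / N.+2%:R
    <= 1 + 2 * p.+1%:R * \sum_(n < N.+1) harm n ^+ p / (n.+1%:R * n.+2%:R).
  elim: N => [|N IHN].
    have h0 : harm 0%N = 1 by rewrite /harm big_ord1 invr1.
    rewrite !big_ord1 /= !h0 !expr1n !mul1r.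
    have : 0 <= 2 * p.+1%:R * 2%:R^-1 :> R by rewrite !mulr_ge0 ?invr_ge0.
    by lra.
  rewrite [X in X + _ <= _]big_ord_recr [X in _ <= _ + _ * X]big_ord_recr /=.
  have d := @expr_sub_le (harm N) (harm N.+1) p (ltW (harm_gt0 N)) (harm_mono (leqnSn N)).
  have e : harm N.+1 - harm N = N.+2%:R^-1 by rewrite harmS addrC addKr.
  rewrite {}e in d.
  have h0 : 0 <= harm N.+1 ^+ p by rewrite exprn_ge0 // ltW // harm_gt0.
  (* Since 1/((N+2)(N+3)) + 1/(N+3) = 1/(N+2), the new summand and the new boundary term differ from
     the old boundary term only by the increment of the power. *)
  have -> : \sum_(i < N.+1) harm i ^+ p.+1 / (i.+1%:R * i.+2%:R)
      + harm N.+1 ^+ p.+1 / (N.+2%:R * N.+3%:R) + harm N.+1 ^+ p.+1 / N.+3%:R =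
      (\sum_(i < N.+1) harm i ^+ p.+1 / (i.+1%:R * i.+2%:R) + harm N ^+ p.+1 / N.+2%:R)
      + (harm N.+1 ^+ p.+1 - harm N ^+ p.+1) / N.+2%:R.
    have x0 : 0 <= N%:R :> R by [].
    by field; rewrite ?andbT; repeat (apply/andP; split); apply: lt0r_neq0; lra.
  rewrite mulrDr addrA; apply: lerD => //.
  apply: le_trans (ler_wpM2r _ d) _; first by rewrite invr_ge0.
  rewrite [2 * _]mulrC -!mulrA ler_pM2l ?ltr0n // [2 * _]mulrCA; apply: ler_wpM2l => //.
  rewrite -invfM ler_pdivlMr ?mulr_gt0 ?ltr0n // mulrC -natrM -natrM ler_pdivrMr ?ltr0n ?muln_gt0 //.
  by rewrite -!natrM ler_nat; lia.
apply: le_trans key _; rewrite lerD2l; apply: ler_wpM2l; first by rewrite mulr_ge0.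
apply: le_trans (IH N); rewrite lerDl mulr_ge0 ?invr_ge0 //.
by rewrite exprn_ge0 // ltW // harm_gt0.
Qed.

(* f(n) = O(log(n)^p / n^e) for some p. *)
Definition dom (e : nat) s : Prop :=
  exists p, exists2 C, 0 <= C & forall n, `|s n| <= C * harm n ^+ p / n.+1%:R ^+ e.

Lemma harm_pow_gt0 n p : 0 < harm n ^+ p.
Proof. by rewrite exprn_gt0 // harm_gt0. Qed.

Lemma harm_pow_le n p q : (p <= q)%N -> harm n ^+ p <= harm n ^+ q.
Proof. by move=> pq; apply: ler_weXn2l => //; apply: harm_ge1. Qed.

Lemma eq_dom e s t : s =1 t -> dom e s -> dom e t.
Proof. by move=> st [p [C C0 h]]; exists p, C => // n; rewrite -st. Qed.

Lemma dom0 e : dom e (fun=> 0).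
Proof. by exists 0%N, 0 => // n; rewrite normr0 !mul0r. Qed.

Lemma domD e s t : dom e s -> dom e t -> dom e (fun n => s n + t n).
Proof.
move=> [p [C C0 hs]] [q [D D0 ht]]; exists (p + q)%N, (C + D); rewrite ?addr_ge0 // => n.
apply: le_trans (ler_normD _ _) _; rewrite !mulrDl; apply: lerD.
  apply: le_trans (hs n) _; rewrite ler_wpM2r ?invr_ge0 ?exprn_ge0 // ler_wpM2l //.
  by apply: harm_pow_le; apply: leq_addr.
apply: le_trans (ht n) _; rewrite ler_wpM2r ?invr_ge0 ?exprn_ge0 // ler_wpM2l //.
by apply: harm_pow_le; apply: leq_addl.
Qed.

Lemma domM e e' s t : dom e s -> dom e' t -> dom (e + e') (fun n => s n * t n).
Proof.
move=> [p [C C0 hs]] [q [D D0 ht]]; exists (p + q)%N, (C * D); rewrite ?mulr_ge0 // => n.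
rewrite normrM; apply: le_trans (ler_pM (normr_ge0 _) (normr_ge0 _) (hs n) (ht n)) _.
by rewrite !exprD invfM le_eqVlt; apply/orP; left; apply/eqP; ring.
Qed.

Lemma dom_cst c : dom 0 (fun=> c).
Proof. by exists 0%N, `|c| => // n; rewrite !expr0 mulr1 divr1. Qed.

Lemma domZ e c s : dom e s -> dom e (fun n => c * s n).
Proof. exact: domM (dom_cst c). Qed.

Lemma domB e s t : dom e s -> dom e t -> dom e (fun n => s n - t n).
Proof.
by move=> hs /(domZ (-1)) /(domD hs); apply: eq_dom => n; rewrite mulN1r.
Qed.

Lemma dom_sum (I : eqType) (r : seq I) e (F : I -> nat -> R) :
  {in r, forall i, dom e (F i)} -> dom e (fun n => \sum_(i <- r) F i n).
Proof.
elim: r => [|i r IH] h; first by apply: eq_dom (dom0 e) => n; rewrite big_nil.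
have hi : dom e (F i) by apply: h; rewrite mem_head.
have hr : dom e (fun n => \sum_(j <- r) F j n).
  by apply: IH => j jr; apply: h; rewrite inE jr orbT.
by apply: eq_dom (domD hi hr) => n; rewrite big_cons.
Qed.

Lemma dom_le e s t : (forall n, `|t n| <= s n) -> dom e s -> dom e t.
Proof.
move=> h [p [C C0 hs]]; exists p, C => // n; apply: le_trans (h n) _.
exact: le_trans (ler_norm _) (hs n).
Qed.

Lemma dom_leq e e' s : (e <= e')%N -> dom e' s -> dom e s.
Proof.
move=> ee [p [C C0 hs]]; exists p, C => // n; apply: le_trans (hs n) _.
rewrite ler_wpM2l ?mulr_ge0 ?exprn_ge0 ?(ltW (harm_gt0 _)) //.
by rewrite lef_pV2 ?posrE ?exprn_gt0 // ler_weXn2l // ler1n.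
Qed.

Lemma dom_divn e s : dom e s -> dom e.+1 (fun n => s n / n%:R).
Proof.
move=> [p [C C0 hs]]; exists p, (2 * C) => [|[|n]]; first by rewrite mulr_ge0.
  rewrite invr0 mulr0 normr0 !mulr_ge0 ?invr_ge0 ?exprn_ge0 ?(ltW (harm_gt0 _)) //.
rewrite normrM; have h := hs n.+1.
have -> : 2 * C * harm n.+1 ^+ p / n.+2%:R ^+ e.+1 =
    (C * harm n.+1 ^+ p / n.+2%:R ^+ e) * (2 / n.+2%:R).
  by rewrite exprSr invfM; ring.
apply: ler_pM => //; rewrite ger0_norm ?invr_ge0 // ler_pdivlMr ?ltr0n //.
by rewrite mulrC ler_pdivrMr ?ltr0n // -natrM ler_nat; lia.
Qed.

Lemma dom_psum s : dom 1 s -> dom 0 (psum s).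
Proof.
move=> [p [C C0 hs]]; exists p.+1, C => // N; rewrite expr0 divr1 /psum.
apply: le_trans (ler_norm_sum _ _ _) _.
rewrite exprSr mulrA /harm mulr_sumr; apply: ler_sum => i _.
apply: le_trans (hs i) _; rewrite expr1 ler_wpM2r ?invr_ge0 // ler_wpM2l //.
apply: lerXn2r; rewrite ?nnegrE ?(ltW (harm_gt0 _)) //.
by apply: harm_mono; rewrite -ltnS.
Qed.

Lemma dom_pred s : dom 0 s -> dom 0 (fun n => if n is m.+1 then s m else 0).
Proof.
move=> [p [C C0 hs]]; exists p, C => // -[|n].
  by rewrite normr0 expr0 divr1 mulr_ge0 // ltW // harm_pow_gt0.
apply: le_trans (hs n) _; rewrite !expr0 !divr1 ler_wpM2l //.
by apply: lerXn2r; rewrite ?nnegrE ?(ltW (harm_gt0 _)) // harm_mono.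
Qed.

Lemma dom_polylog u : yword u ->
  dom 0 (psum (polylog R u)) /\ (u != [::] -> dom 1 (polylog R u)).
Proof.
elim/last_ind: u => [|u a IH] yu.
  split=> //; apply: eq_dom (dom_cst 1) => n.
  rewrite /psum big_ord_recl big1 ?addr0; last first.
    by move=> i _; rewrite polylog_nil fps1.
  by rewrite polylog_nil fps1.
have [IH0 IH1] := IH (yword_rcons yu).
suff h : dom 1 (polylog R (rcons u a)) by split=> [|_ //]; apply: dom_psum.
case: a yu => yu.
  apply: eq_dom (dom_divn (dom_pred IH0)) => -[|n].
    by rewrite invr0 mulr0 polylog_rcons invr0 mulr0.
  by rewrite polylog_rcons form_yE.
have u0 : u != [::] by apply: contraTneq yu => ->.
apply: (dom_leq (leqnSn 1)).
apply: eq_dom (dom_divn (IH1 u0)) => n.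
by rewrite polylog_rcons form_xE mul1r.
Qed.

Lemma dom2_polylog u : yxword u -> u != [::] -> dom 2 (polylog R u).
Proof.
case/lastP: u => // u a /andP[yu]; rewrite last_rcons; case: a yu => // yu _ _.
have u0 : u != [::] by apply: contraTneq yu => ->.
apply: eq_dom (dom_divn ((dom_polylog (yword_rcons yu)).2 u0)) => n.
by rewrite polylog_rcons form_xE mul1r.
Qed.

(** The boundary term of [harm_sum_bound] for the exponent 2p bounds the square of the logarithmic
    factor by a multiple of n, so the square of [s n] is O(1/n). *)
Lemma dom_cvg0 s : dom 1 s -> (s @ \oo --> (0 : R))%classic.
Proof.
move=> [p [C C0 hs]]; have [K hK] := harm_sum_bound (p + p).
have K0 : 0 <= K.
  apply: le_trans (hK 0%N); rewrite addr_ge0 // ?sumr_ge0 // => *;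
  by rewrite mulr_ge0 ?invr_ge0 ?mulr_ge0 // ltW // harm_pow_gt0.
have sq n : `|s n| ^+ 2 <= 2 * C ^+ 2 * K / n.+1%:R.
  have h1 : harm n ^+ (p + p) <= K * n.+2%:R.
    rewrite -ler_pdivrMr ?ltr0n //; apply: le_trans (hK n); rewrite lerDr.
    rewrite sumr_ge0 // => *; by rewrite mulr_ge0 ?invr_ge0 ?mulr_ge0 // ltW // harm_pow_gt0.
  have h2 : `|s n| ^+ 2 <= (C * harm n ^+ p / n.+1%:R) ^+ 2.
    by apply: lerXn2r; rewrite ?nnegrE ?(le_trans _ (hs n)) // -[n.+1%:R]expr1.
  apply: le_trans h2 _.
  have -> : (C * harm n ^+ p / n.+1%:R) ^+ 2 = C ^+ 2 / n.+1%:R ^+ 2 * harm n ^+ (p + p).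
    by rewrite exprD !expr2 invfM; ring.
  apply: le_trans (ler_wpM2l _ h1) _.
    by rewrite mulr_ge0 ?invr_ge0 ?exprn_ge0.
  have -> : 2 * C ^+ 2 * K / n.+1%:R = C ^+ 2 / n.+1%:R ^+ 2 * (K * (2 * n.+1%:R)).
    by field; rewrite addrC natr1 pnatr_eq0.
  apply: ler_wpM2l; first by rewrite mulr_ge0 ?invr_ge0 ?exprn_ge0.
  by apply: ler_wpM2l => //; rewrite -natrM ler_nat; lia.
apply/cvgr0Pnorm_le => e e0.
have /cvgr0Pnorm_le/(_ (e ^+ 2 / (2 * C ^+ 2 * K + 1))) := @cvg_harmonic R.
have M0 : 0 < 2 * C ^+ 2 * K + 1 by rewrite ltr_wpDl // !mulr_ge0 // exprn_ge0.
rewrite divr_gt0 ?exprn_gt0 // => /(_ isT); apply: filterS => n /=.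
rewrite ger0_norm ?invr_ge0 // ler_pdivlMr // => h.
rewrite -ler_sqr ?nnegrE ?normr_ge0 ?(ltW e0) //; apply: le_trans (sq n) _.
apply: le_trans h; rewrite mulrC ler_wpM2l ?invr_ge0 //; by rewrite lerDl.
Qed.

Lemma dom_is_cvg s : dom 2 s -> cvgn (psum s).
Proof.
move=> [p [C C0 hs]]; have [K hK] := harm_sum_bound p.
have -> : psum s = [sequence (series s) n.+1]_n.
  by apply/funext => n; rewrite /psum seriesEord.
suff /cvg_ex[l sl] : cvgn (series s) by apply/cvg_ex; exists l; rewrite cvg_shiftS.
apply: normed_cvg; apply: nondecreasing_is_cvgn.
  by apply: nondecreasing_series => n _ _; rewrite normr_ge0.
have K0 : 0 <= K.
  apply: le_trans (hK 0%N); rewrite addr_ge0 // ?sumr_ge0 // => *;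
  by rewrite mulr_ge0 ?invr_ge0 ?mulr_ge0 // ltW // harm_pow_gt0.
exists (C * (2 * K)) => _ [n _ <-].
rewrite /normed_series_of /= seriesEord /=.
case: n => [|n]; first by rewrite big_ord0 !mulr_ge0.
have h2 : \sum_(k < n.+1) harm k ^+ p / (k.+1%:R * k.+2%:R) <= K.
  apply: le_trans (hK n); rewrite lerDl mulr_ge0 ?invr_ge0 //.
  by rewrite ltW // harm_pow_gt0.
apply: (@le_trans _ _ (C * (2 * \sum_(k < n.+1) harm k ^+ p / (k.+1%:R * k.+2%:R)))); last first.
  by rewrite !ler_wpM2l.
rewrite !mulr_sumr; apply: ler_sum => i _; apply: le_trans (hs i) _.
rewrite -mulrA ler_wpM2l // [2 * _]mulrCA ler_wpM2l ?(ltW (harm_pow_gt0 _ _)) //.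
rewrite ler_pdivlMr ?mulr_gt0 ?ltr0n // mulrC ler_pdivrMr ?exprn_gt0 ?ltr0n //.
by rewrite -natrX -!natrM ler_nat; lia.
Qed.

(** Termwise, (N+1)/(i+1) = 1 + (N-i)/(i+1) <= 1 + (N-m)/(i+1). Thus a tail of the harmonic sum is
    O((N-m) log N / N) uniformly in [m], even when [m] is small. *)
Lemma harm_sub m N : (m <= N)%N ->
  (harm N - harm m) * N.+1%:R <= (N - m)%:R * (1 + harm N).
Proof.
move=> mN; have E : harm N - harm m = \sum_(m.+1 <= i < N.+1) i.+1%:R^-1.
  by rewrite /harm -!(big_mkord xpredT (fun i => i.+1%:R^-1)) (big_cat_nat (n := m.+1)) //= [LHS]addrC addKr.
have h0 : harm N - harm m <= harm N by rewrite gerBl ltW // harm_gt0.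
apply: (@le_trans _ _ ((N - m)%:R * (1 + (harm N - harm m)))); last first.
  by rewrite ler_wpM2l // lerD2l.
rewrite mulrDr mulr1 {1}E mulr_suml.
rewrite [X in _ <= X + _](_ : _ = \sum_(m.+1 <= i < N.+1) (1 : R)); last first.
  by rewrite sumr_const_nat subSS.
rewrite E [X in _ <= _ + X]mulrC mulr_suml -big_split /=.
rewrite big_nat_cond [X in _ <= X]big_nat_cond; apply: ler_sum => i /andP[/andP[mi iN] _].
have -> : 1 + i.+1%:R^-1 * (N - m)%:R = i.+1%:R^-1 * (i.+1 + (N - m))%:R :> R.
  by rewrite natrD mulrDr mulVf ?pnatr_eq0.
by rewrite ler_wpM2l ?invr_ge0 // ler_nat; lia.
Qed.

Lemma psumM (f g : fps R) N : psum (f * g) N = \sum_(a < N.+1) f a * psum g (N - a).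
Proof.
have tri (c : nat -> nat -> R) M :
    \sum_(n < M) \sum_(i < n.+1) c i (n - i)%N = \sum_(a < M) \sum_(b < M - a) c a b.
  elim: M => [|M IH]; first by rewrite !big_ord0.
  rewrite big_ord_recr /= IH [RHS]big_ord_recr /= subSn // subnn big_ord1.
  rewrite [X in _ + X]big_ord_recr /= subnn addrA; congr (_ + _).
  rewrite -big_split /=; apply: eq_bigr => a _.
  by rewrite subSn 1?ltnW // big_ord_recr.
rewrite /psum; under eq_bigr do rewrite fpsM.
rewrite (tri (fun i j => f i * g j)); apply: eq_bigr => a _.
by rewrite mulr_sumr subSn // -ltnS.
Qed.

(* Cauchy products: the terms a, b <= N < a + b are negligible. *)
Lemma dom_psumM (f g : fps R) : dom 2 f -> dom 1 g ->
  dom 1 (fun N => psum f N * psum g N - psum (f * g) N).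
Proof.
move=> [p [C C0 hf]] [q [D D0 hg]].
exists (p + q + 2)%N, (C * D * 2); rewrite ?mulr_ge0 // => N.
have hg' a : (a <= N)%N -> `|psum g N - psum g (N - a)| <= D * harm N ^+ q * (harm N - harm (N - a)).
  move=> aN; have -> : psum g N - psum g (N - a) = \sum_((N - a).+1 <= i < N.+1) g i.
    rewrite /psum -!(big_mkord xpredT g) (big_cat_nat (n := (N - a).+1)) //=.
      by rewrite [LHS]addrC addKr.
    by rewrite ltnS leq_subr.
  have -> : harm N - harm (N - a) = \sum_((N - a).+1 <= i < N.+1) i.+1%:R^-1.
    rewrite /harm -!(big_mkord xpredT (fun i => i.+1%:R^-1)).
    rewrite (big_cat_nat (n := (N - a).+1)) //=; first by rewrite [LHS]addrC addKr.
    by rewrite ltnS leq_subr.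
  apply: le_trans (ler_norm_sum _ _ _) _; rewrite mulr_sumr.
  rewrite big_nat_cond [X in _ <= X]big_nat_cond; apply: ler_sum => i /andP[/andP[_ iN] _].
  apply: le_trans (hg i) _; rewrite expr1 ler_wpM2r ?invr_ge0 // ler_wpM2l //.
  by apply: lerXn2r; rewrite ?nnegrE ?(ltW (harm_gt0 _)) // harm_mono.
rewrite psumM /psum mulr_suml -sumrB; apply: le_trans (ler_norm_sum _ _ _) _.
(* The missing tail of [g] costs a factor of order a log N / N by [harm_sub]; against the decay
   1/a^2 of [f] this leaves a harmonic sum over [a], one more logarithm. *)
apply: (@le_trans _ _ (\sum_(a < N.+1)
   C * harm N ^+ p / a.+1%:R * (D * harm N ^+ q * (2 * harm N / N.+1%:R)))).
  apply: ler_sum => a _; have aN : (a <= N)%N by rewrite -ltnS.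
  rewrite -mulrBr normrM -!/(psum g _).
  have h1 : harm N - harm (N - a) <= a.+1%:R * (2 * harm N / N.+1%:R).
    rewrite !mulrA ler_pdivlMr ?ltr0n //; apply: le_trans (harm_sub (leq_subr a N)) _.
    rewrite subKn // -mulrA; apply: ler_pM => //; first by rewrite addr_ge0 // ltW // harm_gt0.
      by rewrite ler_nat.
    by have := harm_ge1 N; lra.
  have h2 : `|psum g N - psum g (N - a)| <=
      D * harm N ^+ q * (a.+1%:R * (2 * harm N / N.+1%:R)).
    apply: le_trans (hg' a aN) _; apply: ler_wpM2l => //.
    by rewrite mulr_ge0 // ltW // harm_pow_gt0.
  apply: le_trans (ler_pM (normr_ge0 _) (normr_ge0 _) (hf a) h2) _.
  have -> : C * harm a ^+ p / a.+1%:R ^+ 2 * (D * harm N ^+ q * (a.+1%:R * (2 * harm N / N.+1%:R)))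
     = C * harm a ^+ p / a.+1%:R * (D * harm N ^+ q * (2 * harm N / N.+1%:R)).
    have : a.+1%:R != 0 :> R by rewrite pnatr_eq0.
    move: (a.+1%:R : R) (harm a ^+ p) (D * _) (_ / N.+1%:R) => u x y z u0.
    by rewrite expr2 invfM; field.
  apply: ler_wpM2r.
    by rewrite !mulr_ge0 ?invr_ge0 ?exprn_ge0 // ltW // harm_gt0.
  apply: ler_wpM2r; first by rewrite invr_ge0.
  apply: ler_wpM2l => //.
  by apply: lerXn2r; rewrite ?nnegrE ?(ltW (harm_gt0 _)) // harm_mono.
rewrite -mulr_suml -mulr_sumr -/(harm N) expr1.
rewrite le_eqVlt; apply/orP; left; apply/eqP.
by rewrite !exprD expr2; ring.
Qed.

End Harmonic.

(** * Truncated sums *)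

Section NestedSums.
Variables (C : comNzRingType) (e : nat -> C) (N : nat).

Fixpoint strict_sum (lo hi : nat) (k : seq nat) : C :=
  if k is a :: k' then
    \sum_(n < N.+1 | (lo < n < hi)%N) e n ^+ a * strict_sum n hi k'
  else 1.

Fixpoint star_sum (lo : nat) (k : seq nat) : C :=
  if k is a :: k' then \sum_(n < N.+1 | (lo <= n)%N) e n ^+ a * star_sum n k' else 1.

Lemma strict_sum_rcons lo hi k a :
  strict_sum lo hi (rcons k a) =
  \sum_(n < N.+1 | (lo < n < hi)%N) e n ^+ a * strict_sum lo n k.
Proof.
elim: k lo => [|b k IH] lo //=.
under eq_bigr do rewrite IH mulr_sumr.
under [RHS]eq_bigr do rewrite mulr_sumr.
rewrite (exchange_big_dep (fun n : 'I_N.+1 => (lo < n < hi)%N)) /=; last first.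
  by move=> m n /andP[lm mh] /andP[mn nh]; rewrite nh (ltn_trans lm mn).
apply: eq_bigr => n /andP[ln nh]; apply: congr_big => // m.
  by apply/idP/idP; lia.
by move=> _; rewrite mulrCA.
Qed.

Lemma star_sum_split lo b k n : (lo <= n)%N ->
  star_sum lo (b :: k) =
  star_sum n (b :: k) + \sum_(m < N.+1 | (lo <= m < n)%N) e m ^+ b * star_sum m k.
Proof.
move=> ln /=; rewrite (bigID (fun m : 'I_N.+1 => (n <= m)%N)) /=; congr (_ + _).
  by apply: eq_bigl => m; case: (leqP n m) => // nm; rewrite ?andbT ?andbF // (leq_trans ln nm).
by apply: eq_bigl => m; rewrite -ltnNge.
Qed.

(* Inclusion-exclusion on the relation between the first indices of a strict
   and of a weak chain. *)
Lemma strict_star_rec a u b k :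
  \sum_(n < N.+1 | (0 < n)%N) e n ^+ a * strict_sum n N.+1 u * star_sum n (b :: k) =
  strict_sum 0 N.+1 (a :: u) * star_sum 1%N (b :: k)
  - \sum_(m < N.+1 | (0 < m)%N) e m ^+ b * strict_sum m N.+1 (a :: u) * star_sum m k.
Proof.
have pos (n : 'I_N.+1) : (0 < n < N.+1)%N = (0 < n)%N by rewrite ltn_ord andbT.
apply/eqP; rewrite eq_sym subr_eq; apply/eqP.
have -> : strict_sum 0 N.+1 (a :: u) * star_sum 1%N (b :: k) =
    \sum_(n < N.+1 | (0 < n)%N) e n ^+ a * strict_sum n N.+1 u * star_sum n (b :: k)
    + \sum_(n < N.+1 | (0 < n)%N) \sum_(m < N.+1 | (0 < m < n)%N)
        e n ^+ a * strict_sum n N.+1 u * (e m ^+ b * star_sum m k).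
  rewrite [strict_sum _ _ _]/= (eq_bigl _ _ pos) mulr_suml -big_split /=.
  apply: eq_bigr => n n0; rewrite -mulr_sumr -mulrDr; congr (_ * _).
  exact: (star_sum_split b k n0).
congr (_ + _).
rewrite (exchange_big_dep (fun m : 'I_N.+1 => (0 < m)%N)) /=; last first.
  by move=> n m _ /andP[].
apply: eq_bigr => m m0; rewrite mulr_sumr mulr_suml; apply: congr_big => // n.
  by have nN := ltn_ord n; apply/idP/idP; lia.
by move=> _; ring.
Qed.

End NestedSums.

Section ZetaSums.
Variable R : realType.

Lemma zeta_trunc_strict_sum k N :
  zeta_trunc R k N = strict_sum (fun n => n%:R^-1) N 0 N.+1 k.
Proof.
rewrite /zeta_trunc.
suff : forall lo, \sum_(n : (size k).-tuple 'I_N.+1 | path ltn lo [seq val m | m <- n])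
     \prod_(i < size k) (tnth n i)%:R ^- nth 0%N k i =
   strict_sum (fun n => n%:R^-1 : R) N lo N.+1 k by apply.
elim: k => [|a k IH] lo.
  rewrite (big_pred1 [tuple]) ?big_ord0 // => t.
  by rewrite [t]tuple0; apply/esym/eqP.
rewrite (reindex (fun p : 'I_N.+1 * (size k).-tuple 'I_N.+1 => [tuple of p.1 :: p.2])) /=; last first.
  exists (fun t => (thead t, [tuple of behead t])) => [[n t] _|t _] /=.
    by rewrite theadE; congr pair; apply: val_inj.
  by rewrite -tuple_eta.
rewrite -(pair_big_dep (fun n : 'I_N.+1 => (lo < n)%N)
  (fun (n : 'I_N.+1) (t : (size k).-tuple 'I_N.+1) => path ltn n [seq val m | m <- t])
  (fun n t => \prod_(i < (size k).+1) (tnth [tuple of n :: t] i)%:R ^- nth 0%N (a :: k) i)) /=.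
apply: congr_big => // n; first by rewrite ltn_ord andbT.
move=> _; rewrite -IH mulr_sumr; apply: eq_bigr => t _.
rewrite big_ord_recl tnth0 exprVn; congr (_ * _).
by apply: eq_bigr => i _; rewrite tnthS.
Qed.

Lemma zword_rcons k a : zword (rcons k a) = zword k ++ zw a.
Proof. by rewrite /zword map_rcons flatten_rcons. Qed.

Lemma polylog_catz u a n :
  polylog R (u ++ zw a) n = (\sum_(m < n) polylog R u m) * n%:R^-1 ^+ a.-1.+1.
Proof.
rewrite /zw; elim: (a.-1) => [|c IH] /=.
  by rewrite cats1 polylog_rcons form_yE expr1.
have -> : lx :: nseq c lx = rcons (nseq c lx) lx by elim: (c) => //= d ->.
rewrite -rcons_cons -rcons_cat polylog_rcons form_xE mul1r IH.
by rewrite [in RHS]exprSr mulrA.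
Qed.

Lemma psum_polylog k M N : is_index k -> (M <= N)%N ->
  psum (polylog R (zword k)) M = strict_sum (fun n => n%:R^-1) N 0 M.+1 k.
Proof.
elim/last_ind: k M => [|k a IH] M.
  move=> _ _; rewrite /psum big_ord_recl big1 ?addr0; last first.
    by move=> i _; rewrite polylog_nil fps1.
  by rewrite polylog_nil fps1.
rewrite /is_index all_rcons => /andP[a0 ik] MN.
rewrite zword_rcons strict_sum_rcons /psum.
rewrite (big_ord_widen N.+1 (fun i => polylog R (zword k ++ zw a) i)) ?ltnS //.
rewrite (bigID (fun n : 'I_N.+1 => (0 < n)%N)) /= addrC big1 ?add0r; last first.
  move=> i /andP[_]; rewrite -eqn0Ngt => /eqP ->.
  by rewrite polylog_catz big_ord0 mul0r.
apply: eq_big => n; first by rewrite andbC.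
case/andP=> nM n0; rewrite polylog_catz prednK // mulrC; congr (_ * _).
case: n n0 nM => -[|n] //= nN _ nM.
by rewrite -[LHS]/(psum (polylog R (zword k)) n) IH // ltnW // ltnW.
Qed.

Lemma Zmap_polylog u : yword u -> Zmap R (word u) = limn (psum (polylog R u)).
Proof.
case/yword_zword => k ik ->; rewrite Zmap_word index_of_zword // /zeta.
congr (limn _); apply/funext => N.
by rewrite zeta_trunc_strict_sum (psum_polylog _ (leqnn N)).
Qed.

End ZetaSums.

(** * Existence of the shuffle regularization *)

Section Existence.
Variable R : realType.
Notation A := (fps R).

Lemma fps_mulrn_eq0 (f : A) n : f *+ n.+1 = 0 -> f = 0.
Proof.
move=> f0; apply: fpsP => m; have /(congr1 (@^~ m)) := f0.
rewrite -[f *+ _]mulr_natl -(rmorph_nat (@fps_const R)) fps_constM fps0.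
by move=> /eqP; rewrite mulf_eq0 pnatr_eq0 /= => /eqP.
Qed.

Lemma poly_deriv0 (p : {poly A}) : p^`() = 0 -> p.[0] = 0 -> p = 0.
Proof.
move=> d0 p0; apply/polyP => -[|i]; first by rewrite -horner_coef0 p0 coef0.
have /(congr1 (fun q : {poly A} => q`_i)) := d0; rewrite coef_deriv !coef0.
exact: fps_mulrn_eq0.
Qed.

Definition antideriv (p : {poly A}) : {poly A} :=
  \poly_(i < (size p).+1) (if i is j.+1 then fps_const j.+1%:R^-1 * p`_j else 0).

Lemma coef_antideriv p i :
  (antideriv p)`_i = if i is j.+1 then fps_const j.+1%:R^-1 * p`_j else 0.
Proof.
rewrite coef_poly; case: i => [|i] //; rewrite ltnS; case: ltnP => // sp.
by rewrite nth_default // mulr0.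
Qed.

Lemma deriv_antideriv p : (antideriv p)^`() = p.
Proof.
apply/polyP => i; rewrite coef_deriv coef_antideriv -mulrnAl.
have e : i.+1%:R^-1 *+ i.+1 = 1 :> R by rewrite -[LHS]mulr_natr mulVf ?pnatr_eq0.
rewrite -[X in X * _](raddfMn (@fps_const R)) e.
exact: mul1r.
Qed.

Lemma antideriv_0 p : (antideriv p).[0] = 0.
Proof. by rewrite horner_coef0 coef_antideriv. Qed.

Fixpoint expdel_rev (r : seq letter) : {poly A} :=
  if r is a :: r' then
    (polylog R (rev r))%:P + (if a then antideriv (expdel_rev r') else 0)
  else 1.

(* The sum of T^i/i! times the polylogarithm of u with i trailing letters y
   removed; the removal of a trailing y is a derivation for the shuffle product. *)
Definition expdel (u : seq letter) : {poly A} := expdel_rev (rev u).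

Lemma expdel_rcons u a :
  expdel (rcons u a) = (polylog R (rcons u a))%:P + (if a then antideriv (expdel u) else 0).
Proof. by rewrite /expdel rev_rcons /= rev_cons revK. Qed.

Lemma expdel_nil : expdel [::] = 1.
Proof. by []. Qed.

Lemma deriv_expdel u a : (expdel (rcons u a))^`() = if a then expdel u else 0.
Proof.
rewrite expdel_rcons derivD derivC add0r; case: a; last by rewrite deriv0.
exact: deriv_antideriv.
Qed.

Lemma expdel_0 u : (expdel u).[0] = polylog R u.
Proof.
case/lastP: u => [|u a]; first by rewrite expdel_nil hornerC.
by rewrite expdel_rcons hornerD hornerC; case: a; rewrite ?antideriv_0 ?horner0 addr0.
Qed.

(** Differentiation in T removes a trailing [ly], a derivation for the shuffle, so by induction both
    sides have the same derivative. At T = 0 the claim is [polylog_shmul], and a polynomial over a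
    torsion-free ring with zero derivative and zero constant term is 0. *)
Lemma expdel_shmul : shmul expdel.
Proof.
split=> // u v.
move: {2}(size u + size v)%N (erefl (size u + size v)%N) => n.
elim: n u v => [|n IH] u v; case/lastP: u => [|u a]; case/lastP: v => [|v b] //;
  rewrite ?shsum0l ?shsum0r ?expdel_nil ?mul1r ?mulr1 //.
  by rewrite size_rcons addSn.
rewrite !size_rcons addSn addnS => -[e] yu yv.
have yu' := yword_rcons yu; have yv' := yword_rcons yv.
apply/eqP; rewrite -subr_eq0; apply/eqP; apply: poly_deriv0; last first.
  rewrite hornerD hornerN hornerM !expdel_0 /shsum horner_sum.
  under eq_bigr do rewrite expdel_0.
  by rewrite -[\sum_(_ <- _) _]/(shsum _ _ _) (polylog_shmul R).2 // subrr.
rewrite derivB derivM !deriv_expdel shsum_rcons /shsum derivD.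
rewrite !(raddf_sum (@deriv A)) /=.
under eq_bigr do rewrite deriv_expdel.
under [X in _ + X - _]eq_bigr do rewrite deriv_expdel.
have -> : \sum_(i <- shuf (rev u) (rev (rcons v b))) (if a then expdel (rev i) else 0) =
   (if a then expdel u else 0) * expdel (rcons v b).
  case: a yu {IH} (IH u (rcons v b)) => yu IH; last by rewrite big1 ?mul0r.
  by rewrite -[LHS]/(shsum _ _ _) IH // size_rcons addnS.
have -> : \sum_(i <- shuf (rev (rcons u a)) (rev v)) (if b then expdel (rev i) else 0) =
   expdel (rcons u a) * (if b then expdel v else 0).
  case: b yv {IH} (IH (rcons u a) v) => yv IH; last by rewrite big1 ?mulr0.
  by rewrite -[LHS]/(shsum _ _ _) IH // size_rcons addSn.
by rewrite subrr.
Qed.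

(* Re-expansion at T - polylog(y), which sends y to T. *)
Definition regpoly (u : seq letter) : {poly A} :=
  expdel u \Po ('X - (polylog R [:: ly])%:P).

Lemma regpoly_shmul : shmul regpoly.
Proof.
split=> [|u v yu yv]; first by rewrite /regpoly expdel_nil comp_polyC.
rewrite /regpoly -comp_polyM -(expdel_shmul.2 _ _ yu yv) /shsum.
by rewrite (raddf_sum (comp_poly _)).
Qed.

Lemma regpoly_yxword u : yxword u -> regpoly u = (polylog R u)%:P.
Proof.
case/lastP: u => [|u a]; first by rewrite /regpoly expdel_nil comp_polyC.
case/andP=> _; rewrite last_rcons; case: a => // _.
by rewrite /regpoly expdel_rcons addr0 comp_polyC.
Qed.

Lemma regpoly_y : regpoly [:: ly] = 'X.
Proof.
rewrite /regpoly (expdel_rcons [::]) expdel_nil.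
have -> : antideriv 1 = 'X.
  apply/polyP => i; rewrite coef_antideriv coefX; case: i => [|i] //.
  rewrite coef1; case: i => [|i] /=; last by rewrite mulr0.
  by rewrite mulr1 invr1.
by rewrite comp_polyD comp_polyC comp_polyX addrC subrK.
Qed.

(** Inserting [ly] after the last [lx] gives the same word in m + 1 ways; in every other shuffle it
    stands before that [lx]. This expresses a word with m + 1 trailing [ly] through words with only
    m of them. *)
Lemma shsum_y_ny (V : nmodType) (f : seq letter -> V) v m :
  shsum f [:: ly] (rcons v lx ++ nseq m ly) =
  f (rcons v lx ++ nseq m.+1 ly) *+ m.+1
  + shsum (fun w => f (rcons w lx ++ nseq m ly)) [:: ly] v.
Proof.
have nseqS k : nseq k.+1 ly = rcons (nseq k ly) ly by elim: k => //= k ->.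
elim: m f => [|m IH] f.
  rewrite !cats0 (shsum_rcons f [::]) shsum0l cats1.
  by congr (_ + _); apply: eq_bigr => w _; rewrite cats0.
rewrite [nseq m.+1 ly]nseqS -rcons_cat (shsum_rcons f [::]) shsum0l IH addrA.
have e : rcons (rcons (rcons v lx ++ nseq m ly) ly) ly = rcons v lx ++ nseq m.+2 ly.
  by rewrite nseqS nseqS !rcons_cat.
rewrite e rcons_cat -nseqS -mulrS; congr (_ + _).
by apply: eq_bigr => w _; rewrite rcons_cat.
Qed.

Lemma shsum_y_y (V : nmodType) (f : seq letter -> V) m :
  shsum f [:: ly] (nseq m ly) = f (nseq m.+1 ly) *+ m.+1.
Proof.
have nseqS k : nseq k.+1 ly = rcons (nseq k ly) ly by elim: k => //= k ->.
elim: m f => [|m IH] f; first by rewrite shsum0r.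
by rewrite [nseq m.+1 ly]nseqS (shsum_rcons f [::]) shsum0l IH -!nseqS -mulrS.
Qed.

Lemma dom_fps1 : dom 2 (1 : A).
Proof.
exists 0%N, 1 => // -[|n]; rewrite fps1 expr0 !mul1r.
  by rewrite eqxx normr1 expr1n invr1.
by rewrite normr0 invr_ge0 exprn_ge0.
Qed.

Lemma dom_yxword u : yxword u -> dom 2 (polylog R u).
Proof.
by case: (eqVneq u [::]) => [-> _|u0 yu]; [apply: dom_fps1 | apply: dom2_polylog].
Qed.

Lemma yword_split u : yword u ->
  exists v m, [/\ yxword v, u = v ++ nseq m ly & v = [::] \/ exists v', v = rcons v' lx].
Proof.
elim/last_ind: u => [|u a IH] yu; first by exists [::], 0%N; split=> //; left.
case: a yu => yu; last first.
  exists (rcons u lx), 0%N; split; rewrite ?cats0 //; last by right; exists u.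
  by rewrite /yxword yu last_rcons.
have [v [m [yv -> h]]] := IH (yword_rcons yu); exists v, m.+1; split=> //.
by rewrite rcons_cat; congr (_ ++ _); elim: m {IH h} => //= m ->.
Qed.

Lemma dom_mulrn (s : A) m : dom 2 (s *+ m.+1) -> dom 2 s.
Proof.
move=> h; apply: eq_dom (domZ m.+1%:R^-1 h) => n.
rewrite -[s *+ _]mulr_natl -(rmorph_nat (@fps_const R)) fps_constM mulrA.
by rewrite mulVf ?mul1r // pnatr_eq0.
Qed.

Lemma dom_regpoly u i : yword u -> dom 2 (regpoly u)`_i.
Proof.
case/yword_split => v [m [yv -> hv]].
elim: m v yv hv i => [|m IH] v yv hv i.
  rewrite cats0 regpoly_yxword // coefC; case: eqP => _; first exact: dom_yxword.
  exact: dom0.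
apply: (@dom_mulrn _ m); rewrite -coefMn.
have yvm : yword (v ++ nseq m ly).
  by case/andP: yv => yv _; apply: yword_cat => //; case: (m).
have XE : 'X * regpoly (v ++ nseq m ly) = shsum regpoly [:: ly] (v ++ nseq m ly).
  by rewrite regpoly_shmul.2 // regpoly_y.
have domX : dom 2 ('X * regpoly (v ++ nseq m ly))`_i.
  by rewrite coefXM; case: (i) => [|j]; [apply: dom0|apply: IH].
case: hv => [v0|[v' ev]].
  by move: XE domX; rewrite v0 /= shsum_y_y => ->.
move: XE domX; rewrite ev shsum_y_ny => XE.
rewrite XE coefD => h.
have -> : regpoly (rcons v' lx ++ nseq m.+1 ly) *+ m.+1 =
  'X * regpoly (rcons v' lx ++ nseq m ly) -
  shsum (fun w => regpoly (rcons w lx ++ nseq m ly)) [:: ly] v' by rewrite XE addrK.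
rewrite coefB; apply: domB; first by rewrite XE coefD.
rewrite /shsum coef_sum; apply: (@eq_dom _ _ (fun n => \sum_(w <- shuf (rev [:: ly]) (rev v'))
  ((regpoly (rcons (rev w) lx ++ nseq m ly))`_i : A) n)); first by move=> n; rewrite fps_sum.
apply: dom_sum => w mw; apply: IH; last by right; exists (rev w).
have yv' : yword v' by move: yv; rewrite ev => /andP[/yword_rcons].
have := yword_shuf (isT : yword [:: ly]) yv' mw.
have := size_shuf mw; case/lastP: w {mw} => [|w b] //= _.
by rewrite rev_rcons /yxword last_rcons /= => ->.
Qed.

Definition has_sum (f : A) (l : R) : Prop := (psum f @ \oo --> l)%classic.

Lemma has_sum_lim f l : has_sum f l -> limn (psum f) = l.
Proof. by move=> h; apply: cvg_lim. Qed.

Lemma dom_has_sum f : dom 2 f -> has_sum f (limn (psum f)).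
Proof. exact: dom_is_cvg. Qed.

Lemma has_sumD (f g : A) l m : has_sum f l -> has_sum g m -> has_sum (f + g) (l + m).
Proof.
move=> hf hg; rewrite /has_sum (_ : psum (f + g) = psum f \+ psum g); first exact: cvgD.
by apply/funext => N; exact: big_split.
Qed.

Lemma has_sum0 : has_sum 0 0.
Proof.
rewrite /has_sum (_ : psum 0 = cst 0); first exact: cvg_cst.
by apply/funext => N; rewrite /psum big1.
Qed.

Lemma has_sum1 : has_sum 1 1.
Proof.
rewrite /has_sum (_ : psum 1 = cst 1); first exact: cvg_cst.
apply/funext => N; rewrite /psum big_ord_recl big1 ?addr0; last first.
  by move=> i _; rewrite fps1.
by rewrite fps1.
Qed.

Lemma has_sum_sum (I : eqType) (r : seq I) (F : I -> A) (l : I -> R) :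
  {in r, forall i, has_sum (F i) (l i)} ->
  has_sum (\sum_(i <- r) F i) (\sum_(i <- r) l i).
Proof.
elim: r => [|i r IH] h; first by rewrite !big_nil; apply: has_sum0.
rewrite !big_cons; apply: has_sumD; first by apply: h; rewrite mem_head.
by apply: IH => j jr; apply: h; rewrite inE jr orbT.
Qed.

Lemma has_sumM (f g : A) : dom 2 f -> dom 2 g ->
  has_sum (f * g) (limn (psum f) * limn (psum g)).
Proof.
move=> hf hg; have hE := dom_cvg0 (dom_psumM hf (dom_leq (leqnSn 1) hg)).
have hfg : ((psum f \* psum g) @ \oo --> limn (psum f) * limn (psum g))%classic.
  by apply: cvgM; apply: dom_has_sum.
have e : psum (f * g) =
    ((psum f \* psum g) - (fun N => (psum f N * psum g N - psum (f * g) N)%R))%R.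
  by apply/funext => N; rewrite !fctE subKr.
by rewrite /has_sum e -(subr0 (limn (psum f) * limn (psum g))); apply: cvgB.
Qed.

(** Evaluation of the series at z = 1, coefficient by coefficient in T. *)
Definition regval (u : seq letter) : {poly R} :=
  \poly_(i < size (regpoly u)) limn (psum (regpoly u)`_i).

Lemma regval_coef u i : (regval u)`_i = limn (psum (regpoly u)`_i).
Proof.
rewrite coef_poly; case: ltnP => // si.
by rewrite nth_default //; apply/esym/has_sum_lim/has_sum0.
Qed.

Lemma regval_has_sum u i : yword u -> has_sum (regpoly u)`_i (regval u)`_i.
Proof. by move=> yu; rewrite regval_coef; apply/dom_has_sum/dom_regpoly. Qed.

Lemma regval_shmul : shmul regval.
Proof.
split=> [|u v yu yv]; apply/polyP => i.
  rewrite regval_coef regpoly_shmul.1 !coef1; apply: has_sum_lim.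
  by case: i => [|i]; [apply: has_sum1|apply: has_sum0].
have h1 : has_sum (shsum regpoly u v)`_i (shsum regval u v)`_i.
  rewrite /shsum !coef_sum; apply: has_sum_sum => w mw.
  exact: regval_has_sum (yword_shuf yu yv mw).
have h2 : has_sum (regpoly u * regpoly v)`_i (regval u * regval v)`_i.
  rewrite !coefM; apply: has_sum_sum => j _; rewrite !regval_coef.
  by apply: has_sumM; apply: dom_regpoly.
rewrite regpoly_shmul.2 // in h1.
by rewrite -(has_sum_lim h1) (has_sum_lim h2).
Qed.

Lemma exists_shuffle_reg : is_shuffle_reg (lin (@ratr R) regval).
Proof.
apply: reg_of_shmul; first exact: regval_shmul.
  move=> u yu; apply/polyP => i.
  rewrite regval_coef regpoly_yxword // !coefC; case: eqP => _.
    by rewrite Zmap_polylog //; case/andP: yu.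
  exact: has_sum_lim has_sum0.
apply/polyP => i; rewrite regval_coef regpoly_y !coefX; apply: has_sum_lim.
by case: (i == 1)%N; [apply: has_sum1|apply: has_sum0].
Qed.

Lemma Zsh_reg : is_shuffle_reg (Zsh R).
Proof.
exact: (@xgetI _ (fun=> 0) [set phi | is_shuffle_reg phi]%classic _ exists_shuffle_reg).
Qed.

End Existence.

(** * Star values as limits of truncated star sums *)

Section KYValues.
Variable R : realType.
Notation ev := (fun n => n%:R^-1 : R).

Definition zreg (u : seq letter) : R := (Zsh R (word u)).[0].

Lemma zreg_shmul : shmul zreg.
Proof.
have [s1 sM] := shmul_reg (Zsh_reg R); split=> [|u v yu yv].
  by rewrite /zreg s1 hornerC.
by rewrite /zreg -hornerM -sM // /shsum horner_sum.
Qed.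

Lemma zreg_yxword u : yxword u -> zreg u = limn (psum (polylog R u)).
Proof.
move=> yu; rewrite /zreg (reg_yxword (Zsh_reg R)) // hornerC Zmap_polylog //.
by case/andP: yu.
Qed.

Lemma zeta_star_KYE k : is_index k -> zeta_star_KY R k = zigzags zreg k.
Proof.
move=> ik; rewrite /zeta_star_KY wstarE // (reg_sum (Zsh_reg R)) ?wstar_yword //.
by rewrite horner_sum (sum_wstar_words ik zreg_shmul).
Qed.

(** The generalization needed for the induction: the merged first chain is a strict chain [a :: u]
    sharing its first variable with the weak chain that starts [k]. The recursion of [zigzag] and
    the inclusion-exclusion [strict_star_rec] have the same shape, and the Cauchy product in the
    former matches the product of truncated sums in the latter up to a [dom 1] error. *)
Lemma zigzag_cvg_aux k a u : is_index k -> (2 <= last 2 k)%N -> is_index (a :: u) ->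
  dom 1 (fun N => psum (zigzag (polylog R) (zword (a :: u)) k) N -
    \sum_(n < N.+1 | (0 < n)%N) ev n ^+ a * strict_sum ev N n N.+1 u * star_sum ev N n k).
Proof.
elim: k a u => [|b k IH] a u ik k2 iu.
  apply: eq_dom (dom0 R 1) => N; rewrite [zigzag _ _ _]/= (psum_polylog _ iu (leqnn N)).
  apply/esym/eqP; rewrite subr_eq0; apply/eqP; apply: eq_big => n.
    by rewrite ltn_ord andbT.
  by rewrite mulr1.
have [b0 ik'] : (0 < b)%N /\ is_index k by apply/andP.
have k2' : (2 <= last 2 k)%N by case: (k) k2.
have ibu : is_index [:: b, a & u] by rewrite /is_index /= b0.
set L := polylog R (zword (a :: u)); pose g := zigzag (polylog R) (zw b) k.
have dg : dom 2 g.
  have -> : g = \sum_(w <- wstar_words (b :: k)) polylog R w.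
    by rewrite (sum_wstar_words ik (polylog_shmul R)).
  apply: (@eq_dom _ _ (fun n => \sum_(w <- wstar_words (b :: k)) polylog R w n)).
    by move=> n; rewrite fps_sum.
  apply: dom_sum => w ww; apply: dom_yxword.
  by apply: (allP (wstar_yxword ik k2)).
have yL : yword (zword (a :: u)) by [].
have dL : dom 1 L by apply: (dom_polylog R yL).2.
have dpL : dom 0 (psum L) by apply: dom_psum.
have h1 := dom_psumM dg dL.
have h2 : dom 1 (fun N => psum g N - star_sum ev N 1%N (b :: k)).
  have := IH b [::] ik' k2'; rewrite /is_index /= b0 => /(_ isT).
  rewrite /zword /= cats0; apply: eq_dom => N; congr (_ - _); apply: eq_bigr => n _.
  by rewrite mulr1.
(* Replacing the partial sum of [g] by the truncated star sum costs a [dom 1] error times [psum L],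
   which grows at most like a power of the logarithm. *)
have h3 := domM h2 dpL.
have h4 := IH b (a :: u) ik' k2' ibu.
have := domB (domB h3 h1) h4; apply: eq_dom => N.
rewrite strict_star_rec -(psum_polylog _ iu (leqnn N)) -/L.
have -> : zigzag (polylog R) (zword (a :: u)) (b :: k) =
  L * g - zigzag (polylog R) (zword [:: b, a & u]) k by [].
have -> : psum (L * g - zigzag (polylog R) (zword [:: b, a & u]) k) N =
  psum (g * L) N - psum (zigzag (polylog R) (zword [:: b, a & u]) k) N.
  by rewrite mulrC /psum -sumrB.
by ring.
Qed.

Lemma zeta_star_KY_cvg k : is_index k -> (2 <= last 2 k)%N ->
  ((fun N => star_sum ev N 1%N k) @ \oo --> zeta_star_KY R k)%classic.
Proof.
case: k => [|b k] ik k2.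
  by rewrite zeta_star_KYE //=; apply: cvg_cst.
have [b0 ik'] : (0 < b)%N /\ is_index k by apply/andP.
have k2' : (2 <= last 2 k)%N by case: (k) k2.
have h := @zigzag_cvg_aux k b [::] ik' k2'; rewrite /is_index /= b0 in h.
have {h}hd := dom_cvg0 (h isT).
have hs : has_sum (zigzags (polylog R) (b :: k)) (zeta_star_KY R (b :: k)).
  rewrite zeta_star_KYE // -(sum_wstar_words ik zreg_shmul).
  rewrite -(sum_wstar_words ik (polylog_shmul R)); apply: has_sum_sum => w ww.
  have yx := allP (wstar_yxword ik k2) _ ww.
  by rewrite zreg_yxword //; apply/dom_has_sum/dom_yxword.
have e : (fun N => star_sum ev N 1%N (b :: k)) = (psum (zigzags (polylog R) (b :: k)) -
    (fun N => (psum (zigzag (polylog R) (zword [:: b]) k) N -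
      \sum_(n < N.+1 | (0 < n)%N) ev n ^+ b * strict_sum ev N n N.+1 [::] * star_sum ev N n k)%R))%R.
  apply/funext => N; rewrite !fctE /zword /= cats0 opprB addrC subrK.
  by apply: eq_bigr => n _; rewrite mulr1.
by rewrite e -(subr0 (zeta_star_KY R (b :: k))); apply: cvgB.
Qed.

End KYValues.

Lemma zwS j : zw j.+2 = rcons (zw j.+1) lx.
Proof. by rewrite /zw /= -rcons_cons; congr (_ :: _); elim: j => //= j ->. Qed.

(** * Alternating sums of shuffles *)

Section Telescope.
Variable C : comNzRingType.
Implicit Types (f : seq letter -> C) (A B : seq letter).

Lemma shsum_zw f A B i j :
  shsum f (A ++ zw i.+1) (B ++ zw j.+1) =
  (if i is i'.+1 then shsum (fun w => f (rcons w lx)) (A ++ zw i'.+1) (B ++ zw j.+1)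
   else shsum (fun w => f (rcons w ly)) A (B ++ zw j.+1)) +
  (if j is j'.+1 then shsum (fun w => f (rcons w lx)) (A ++ zw i.+1) (B ++ zw j'.+1)
   else shsum (fun w => f (rcons w ly)) (A ++ zw i.+1) B).
Proof.
by case: i => [|i]; case: j => [|j];
  rewrite ?zwS ?[zw 1]/[:: ly] -?rcons_cat ?cats1 shsum_rcons.
Qed.

(* Removing a trailing x sends the alternating sum of order n to the one of
   order n - 1, so that only shuffles ending in y survive. *)
Lemma shuffle_telescope f A B l n :
  \sum_(j < l.+1) (-1) ^+ j * 'C(l - j + n, n)%:R *
     shsum f (A ++ zw j.+1) (B ++ zw (l - j + n).+1) =
  \sum_(m < n.+1) 'C(l + m, m)%:R *
     shsum (fun w => f (w ++ zw (n - m).+1)) A (B ++ zw (l + m).+1)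
  + (-1) ^+ l * shsum (fun w => f (w ++ zw n.+1)) (A ++ zw l.+1) B.
Proof.
elim: n f => [|n IH] f.
  rewrite big_ord1 /= subnn addn0 bin0 mul1r.
  have E1 : shsum (fun w => f (w ++ zw 1)) A (B ++ zw l.+1) =
     shsum (fun w => f (rcons w ly)) A (B ++ zw l.+1).
    by apply: eq_bigr => w _; rewrite cats1.
  have E2 : shsum (fun w => f (w ++ zw 1)) (A ++ zw l.+1) B =
     shsum (fun w => f (rcons w ly)) (A ++ zw l.+1) B.
    by apply: eq_bigr => w _; rewrite cats1.
  rewrite E1 E2; under eq_bigr do rewrite addn0 bin0 mulr1 shsum_zw mulrDr.
  rewrite big_split /= big_ord_recl subn0 expr0 mul1r -addrA; congr (_ + _).
  rewrite [X in _ + X]big_ord_recr /= subnn addrA -[RHS]add0r; congr (_ + _).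
  (* Removing the last [lx] of the second factor in summand j leaves the same shuffle as removing
     that of the first factor in summand j + 1, with opposite sign. *)
  rewrite -big_split big1 //= => j _; rewrite /bump /= add1n.
  have -> : (l - j)%N = (l - j.+1).+1 by rewrite subnSK.
  by rewrite exprS mulN1r mulNr addNr.
have zwx w k : f (w ++ zw k.+2) = f (rcons (w ++ zw k.+1) lx).
  by rewrite zwS rcons_cat.
pose X i j := shsum (fun w => f (rcons w lx)) (A ++ zw i.+1) (B ++ zw j.+1).
have -> : \sum_(j < l.+1) (-1) ^+ j * 'C(l - j + n.+1, n.+1)%:R *
     shsum f (A ++ zw j.+1) (B ++ zw (l - j + n.+1).+1) =
   'C(l + n.+1, n.+1)%:R * shsum (fun w => f (rcons w ly)) A (B ++ zw (l + n.+1).+1)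
   + \sum_(j < l.+1) (-1) ^+ j * 'C(l - j + n, n)%:R * X j (l - j + n)%N.
  under eq_bigr do rewrite shsum_zw addnS mulrDr.
  rewrite big_split /= big_ord_recl subn0 expr0 mul1r addnS -addrA; congr (_ + _).
  (* Pascal's rule. The part with lower index n + 1 cancels against the removals from the first
     factor in the next summand and vanishes for i = l; the other part is the alternating sum of
     order n. *)
  have -> : \sum_(i < l.+1) (-1) ^+ i * 'C((l - i + n).+1, n.+1)%:R * X i (l - i + n)%N =
      \sum_(i < l.+1) (-1) ^+ i * 'C(l - i + n, n.+1)%:R * X i (l - i + n)%N +
      \sum_(j < l.+1) (-1) ^+ j * 'C(l - j + n, n)%:R * X j (l - j + n)%N.
    by rewrite -big_split /=; apply: eq_bigr => i _; rewrite binS natrD mulrDr mulrDl.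
  rewrite addrA -[RHS]add0r; congr (_ + _).
  rewrite [X in _ + X]big_ord_recr /= subnn bin_small // mulr0 mul0r addr0.
  rewrite -big_split big1 //= => j _; rewrite /bump /= add1n.
  have -> : (l - j = (l - j.+1).+1)%N by rewrite subnSK.
  by rewrite exprS mulN1r mulNr mulNr addSn addNr.
rewrite [X in _ = X + _]big_ord_recr /= subnn [RHS]addrAC.
rewrite (IH (fun w => f (rcons w lx))) [LHS]addrC. congr (_ + _ + _).
- apply: eq_bigr => m _; congr (_ * _); apply: eq_bigr => w _.
  by rewrite subSn ?zwx // -ltnS.
- by congr (_ * _); apply: eq_bigr => w _; rewrite zwx.
- by congr (_ * _); apply: eq_bigr => w _; rewrite cats1.
Qed.

End Telescope.

Section StarShuffle.
Variables (C : comNzRingType) (f : seq letter -> C).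
Hypothesis fM : shmul f.
Implicit Types (F G : seq letter -> C) (k P N : seq nat).

Local Notation K := (zigzags f).

(** The recursion of [zigzag] with an arbitrary functional [F] in place of the character on the
    first chain. It is linear in [F], which lifts identities between shuffles of single words to
    identities between star values. *)
Fixpoint star_ext F (v : seq letter) k : C :=
  if k is a :: k' then K k * F v - star_ext F (zw a ++ v) k' else F v.

Lemma star_ext_zigzag v k : star_ext f v k = zigzag f v k.
Proof. by elim: k v => [|a k IH] v //=; rewrite IH mulrC. Qed.

Lemma eq_star_ext F G v k : {in yword, F =1 G} -> yword v ->
  star_ext F v k = star_ext G v k.
Proof.
move=> FG; elim: k v => [|a k IH] v yv /=; first exact: FG.
by rewrite FG // IH.
Qed.

Lemma star_ext_sum (I : Type) (r : seq I) (c : I -> C) (F : I -> seq letter -> C) v k :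
  star_ext (fun u => \sum_(i <- r) c i * F i u) v k = \sum_(i <- r) c i * star_ext (F i) v k.
Proof.
elim: k v => [|a k IH] v //=; rewrite IH mulr_sumr -sumrB.
by apply: eq_bigr => i _; rewrite mulrBr mulrCA.
Qed.

Lemma star_extD F G v k :
  star_ext (fun u => F u + G u) v k = star_ext F v k + star_ext G v k.
Proof. by elim: k v => [|a k IH] v //=; rewrite IH; ring. Qed.

Lemma star_extZ c F v k : star_ext (fun u => c * F u) v k = c * star_ext F v k.
Proof. by elim: k v => [|a k IH] v //=; rewrite IH; ring. Qed.

Lemma star_extB c F G v k :
  star_ext (fun u => c * F u - G u) v k = c * star_ext F v k - star_ext G v k.
Proof. by elim: k v => [|a k IH] v //=; rewrite IH; ring. Qed.

Lemma star_ext_catr F u v k :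
  star_ext (fun w => F (w ++ u)) v k = star_ext F (v ++ u) k.
Proof. by elim: k v => [|a k IH] v //=; rewrite IH catA. Qed.

Lemma star_ext_zw F a k :
  star_ext (fun w => F (w ++ zw a)) [::] k = K (a :: k) * F [::] - star_ext F [::] (a :: k).
Proof. by rewrite star_ext_catr /= cats0 subKr. Qed.

Lemma star_ext_char a k : star_ext (fun w => f (w ++ zw a)) [::] k = K (a :: k).
Proof. by rewrite star_ext_catr star_ext_zigzag. Qed.

(** By inclusion-exclusion this is the value of a branched poset: a common chain of [h.+1] elements
    whose bottom lies below the first top of the zigzag [P] and also below the first top of the
    zigzag [N]. *)
Definition star_shuffle h P N : C :=
  star_ext (fun u =>
    star_ext (fun v => shsum (fun w => f (w ++ zw h.+1)) u v) [::] N) [::] P.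

Lemma star_shuffle0l h N : star_shuffle h [::] N = K (h.+1 :: N).
Proof.
rewrite -star_ext_char.
have -> : star_shuffle h [::] N =
    star_ext (fun v => shsum (fun w => f (w ++ zw h.+1)) [::] v) [::] N by [].
by apply: eq_star_ext => // w _; apply: shsum0l.
Qed.

Lemma star_shuffle_inner0 h u :
  star_ext (fun v => shsum (fun w => f (w ++ zw h.+1)) u v) [::] [::] = f (u ++ zw h.+1).
Proof. exact: shsum0r. Qed.

Lemma star_shuffle0r h P : star_shuffle h P [::] = K (h.+1 :: P).
Proof.
rewrite /star_shuffle -star_ext_char; apply: eq_star_ext => // u _.
exact: star_shuffle_inner0.
Qed.

(** Apply [star_ext] along [P] and along [N] to [shuffle_telescope]. On the left the shuffles split
    into products because [f] is a character; on the right each shuffle has one chain already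
    attached, and [star_ext_zw] expresses it by a product minus the branched value in which that
    chain is linked instead. *)
Lemma star_telescope P N l n :
  \sum_(j < l.+1) (-1) ^+ j * 'C(l - j + n, n)%:R *
     (K (j.+1 :: P) * K ((l - j + n).+1 :: N)) =
  \sum_(m < n.+1) 'C(l + m, m)%:R *
     (K ((n - m).+1 :: P) * K ((l + m).+1 :: N) - star_shuffle (n - m) P ((l + m).+1 :: N))
  + (-1) ^+ l * (K (l.+1 :: P) * K (n.+1 :: N) - star_shuffle n (l.+1 :: P) N).
Proof.
pose Psi X := star_ext (fun u => star_ext (fun v => X u v) [::] N) [::] P.
pose g b w := f (w ++ zw b).
have prod i j : Psi (fun u v => shsum f (u ++ zw i.+1) (v ++ zw j.+1)) =
    K (i.+1 :: P) * K (j.+1 :: N).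
  rewrite /Psi -(star_ext_char i.+1) mulrC -star_extZ.
  apply: eq_star_ext => // u yu; rewrite -star_ext_char mulrC -star_extZ.
  by apply: eq_star_ext => // v yv; rewrite fM.2 // yword_cat.
have cutN m b : Psi (fun u v => shsum (g m.+1) u (v ++ zw b)) =
    K (m.+1 :: P) * K (b :: N) - star_shuffle m P (b :: N).
  rewrite [K (m.+1 :: P) * _]mulrC -(star_ext_char m.+1) -star_extB; congr star_ext.
  by apply/funext => u; rewrite (star_ext_zw (shsum (g m.+1) u)) shsum0r.
have cutP m b : Psi (fun u v => shsum (g m.+1) (u ++ zw b) v) =
    K (b :: P) * K (m.+1 :: N) - star_shuffle m (b :: P) N.
  rewrite -(star_shuffle0l m N).
  exact: (star_ext_zw (fun u => star_ext (fun v => shsum (g m.+1) u v) [::] N)).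
transitivity (Psi (fun u v => \sum_(j < l.+1) (-1) ^+ j * 'C(l - j + n, n)%:R *
    shsum f (u ++ zw j.+1) (v ++ zw (l - j + n).+1))).
  rewrite /Psi; under [X in star_ext X]eq_fun do rewrite star_ext_sum.
  by rewrite star_ext_sum; apply: eq_bigr => j _; rewrite -prod.
under [X in Psi X]eq_fun do under eq_fun do rewrite shuffle_telescope.
rewrite /Psi; under [X in star_ext X]eq_fun do rewrite star_extD star_ext_sum star_extZ.
rewrite star_extD star_ext_sum star_extZ; congr (_ + _ * _); last exact: cutP.
by apply: eq_bigr => m _; rewrite -cutN.
Qed.

End StarShuffle.

(** * Series in t and shifted indices *)

Section Triangle.
Variable V : nmodType.
Implicit Type Y : nat -> nat -> V.

Lemma sum_triangle Y N :
  \sum_(m < N.+1) \sum_(h < (N - m).+1) Y m h =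
  \sum_(n < N.+1) \sum_(m < n.+1) Y m (n - m)%N.
Proof.
elim: N => [|N IH]; first by rewrite !big_ord1.
rewrite [RHS]big_ord_recr /= -IH big_ord_recr /= subnn big_ord1.
rewrite [X in _ = _ + X]big_ord_recr /= subnn addrA; congr (_ + _).
rewrite -big_split /=; apply: eq_bigr => m _.
by rewrite subSn ?big_ord_recr // -ltnS.
Qed.

Lemma exchange_triangle Y N :
  \sum_(m < N.+1) \sum_(h < (N - m).+1) Y m h =
  \sum_(h < N.+1) \sum_(m < (N - h).+1) Y m h.
Proof.
rewrite sum_triangle (sum_triangle (fun h m => Y m h)); apply: eq_bigr => n _.
rewrite (reindex_inj rev_ord_inj); apply: eq_bigr => m _ /=.
by rewrite subSS subKn // -ltnS.
Qed.

End Triangle.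

Section FpsSeries.
Variable R : comNzRingType.
Implicit Types (F G : nat -> fps R) (g : fps R) (X : nat -> nat -> fps R).

Lemma eq_fps_series F G : F =1 G -> fps_series F = fps_series G.
Proof. by move=> /funext ->. Qed.

Lemma fps_seriesD F G :
  fps_series (fun m => F m + G m) = fps_series F + fps_series G.
Proof. by apply: fpsP => n; rewrite fpsD -big_split. Qed.

Lemma fps_seriesN F : fps_series (fun m => - F m) = - fps_series F.
Proof. by apply: fpsP => n; rewrite fpsN -sumrN. Qed.

Lemma fps_seriesB F G :
  fps_series (fun m => F m - G m) = fps_series F - fps_series G.
Proof. by rewrite -fps_seriesN -fps_seriesD. Qed.

Lemma fps_series_sum (I : Type) (r : seq I) (P : pred I) (F : I -> nat -> fps R) :
  fps_series (fun m => \sum_(i <- r | P i) F i m) = \sum_(i <- r | P i) fps_series (F i).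
Proof.
apply: fpsP => n; rewrite fps_sum /fps_series exchange_big /=.
by apply: eq_bigr => j _; rewrite fps_sum.
Qed.

Lemma mul_fps_series g F : g * fps_series F = fps_series (fun m => g * F m).
Proof.
apply: fpsP => n; rewrite fpsM /fps_series.
under eq_bigr do rewrite mulr_sumr.
rewrite (exchange_triangle (fun i j => g i * F j (n - i - j)%N)).
by apply: eq_bigr => j _; rewrite fpsM; apply: eq_bigr => i _; rewrite subnAC.
Qed.

Lemma fps_seriesMn F d : fps_series F *+ d = fps_series (fun m => F m *+ d).
Proof.
rewrite -mulr_natl mul_fps_series; apply: eq_fps_series => m.
by rewrite mulr_natl.
Qed.

Lemma fps_series_series X :
  fps_series (fun m => fps_series (X m)) =
  fps_series (fun n => \sum_(m < n.+1) X m (n - m)%N).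
Proof.
apply: fpsP => n; rewrite /fps_series.
rewrite (sum_triangle (fun m h => X m h (n - m - h)%N)); apply: eq_bigr => s _.
by rewrite fps_sum; apply: eq_bigr => m _; rewrite -subnDA subnKC // -ltnS.
Qed.

Lemma exchange_fps_series X :
  fps_series (fun m => fps_series (X m)) = fps_series (fun h => fps_series (X^~ h)).
Proof.
apply: fpsP => n; rewrite /fps_series.
rewrite (exchange_triangle (fun m h => X m h (n - m - h)%N)).
by apply: eq_bigr => h _; apply: eq_bigr => m _; rewrite subnAC.
Qed.

Lemma fps_series_const g : fps_series (fun m => fps_const (g m)) = g.
Proof.
apply: fpsP => n; rewrite /fps_series big_ord_recr /= subnn big1 ?add0r // => i _.
by rewrite /fps_const subn_eq0 leqNgt ltn_ord.
Qed.

Lemma fps_series_mul g F :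
  fps_series (fun n => \sum_(m < n.+1) fps_const (g (n - m)%N) * F m) = g * fps_series F.
Proof.
rewrite -(fps_series_series (fun m h => fps_const (g h) * F m)) mul_fps_series.
apply: eq_fps_series => m; rewrite -[in RHS](fps_series_const g) mulrC mul_fps_series.
by apply: eq_fps_series => h; rewrite mulrC.
Qed.

End FpsSeries.

Section BinomShift.
Variable R : comNzRingType.
Implicit Types (G : seq nat -> R) (h : seq nat).

(* The formal counterpart of replacing 1/n by 1/(n - t) in nested sums:
   1/(n - t)^a = sum_m C(a + m - 1, m) t^m / n^(a + m). *)
Fixpoint binom_shift (G : seq nat -> R) (h : seq nat) : fps R :=
  if h is a :: h' then
    fps_series (fun m => binom_shift (fun s => G ((a + m)%N :: s)) h' *+ 'C(a + m - 1, m))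
  else fps_const (G [::]).

Lemma binom_shift_cons G a h :
  binom_shift G (a :: h) =
  fps_series (fun m => binom_shift (fun s => G ((a + m)%N :: s)) h *+ 'C(a + m - 1, m)).
Proof. by []. Qed.

Lemma eq_binom_shift G1 G2 h : G1 =1 G2 -> binom_shift G1 h = binom_shift G2 h.
Proof. by move=> /funext ->. Qed.

Lemma binom_shiftD G1 G2 h :
  binom_shift (fun s => G1 s + G2 s) h = binom_shift G1 h + binom_shift G2 h.
Proof.
elim: h G1 G2 => [|a h IH] G1 G2 /=; first exact: rmorphD.
by rewrite -fps_seriesD; apply: eq_fps_series => m; rewrite IH mulrnDl.
Qed.

Lemma binom_shiftZ c G h :
  binom_shift (fun s => c * G s) h = fps_const c * binom_shift G h.
Proof.
elim: h G => [|a h IH] G /=; first exact: rmorphM.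
by rewrite mul_fps_series; apply: eq_fps_series => m; rewrite IH mulrnAr.
Qed.

Lemma binom_shiftB G1 G2 h :
  binom_shift (fun s => G1 s - G2 s) h = binom_shift G1 h - binom_shift G2 h.
Proof.
rewrite -[- _ in RHS]mulN1r -(rmorphN1 (@fps_const R)) -binom_shiftZ -binom_shiftD.
by apply: eq_binom_shift => s; rewrite mulN1r.
Qed.

Lemma binom_shift0 h : binom_shift (fun=> 0) h = 0.
Proof.
rewrite -[RHS](mul0r (binom_shift (fun=> 0) h)) -(rmorph0 (@fps_const R)) -binom_shiftZ.
by apply: eq_binom_shift => s; rewrite mul0r.
Qed.

Lemma binom_shift_sum (I : Type) (r : seq I) (P : pred I) (G : I -> seq nat -> R) h :
  binom_shift (fun s => \sum_(i <- r | P i) G i s) h = \sum_(i <- r | P i) binom_shift (G i) h.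
Proof.
elim: r => [|i r IH].
  by rewrite big_nil -(binom_shift0 h); apply: eq_binom_shift => s; rewrite big_nil.
rewrite big_cons -IH; case: ifP => Pi.
  by rewrite -binom_shiftD; apply: eq_binom_shift => s; rewrite big_cons Pi.
by apply: eq_binom_shift => s; rewrite big_cons Pi.
Qed.

Lemma binom_shift_rcons G h a :
  binom_shift G (rcons h a) =
  fps_series (fun m => binom_shift (fun s => G (rcons s (a + m)%N)) h *+ 'C(a + m - 1, m)).
Proof.
elim: h G => [|b h IH] G //=.
under [LHS]eq_fps_series do rewrite IH fps_seriesMn.
rewrite exchange_fps_series; apply: eq_fps_series => m /=.
by rewrite fps_seriesMn; apply: eq_fps_series => n; rewrite -!mulrnA mulnC.
Qed.

Lemma binom_shift_rev G h : binom_shift (fun s => G (rev s)) h = binom_shift G (rev h).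
Proof.
elim: h G => [|a h IH] G //=; rewrite rev_cons binom_shift_rcons.
apply: eq_fps_series => m; congr (_ *+ _); rewrite -IH.
by apply: eq_binom_shift => s; rewrite rev_cons.
Qed.

End BinomShift.

Section StarShift.
Variables (C : comNzRingType) (f : seq letter -> C).
Hypothesis fM : shmul f.
Implicit Types (P N : seq nat).

Local Notation K := (zigzags f).
Local Notation Kt := (binom_shift K).

Definition head_series P : fps C := fun h => K (h.+1 :: P).

(** The branched value in which the common chain and [N] carry the weights 1/(n - t), while [P]
    keeps 1/n. *)
Definition star_shuffle_series P N : fps C :=
  fps_series (fun h => binom_shift (star_shuffle f h P) N).

Lemma star_shuffle_series0l N : star_shuffle_series [::] N = Kt (1%N :: N).
Proof.
apply: eq_fps_series => m; rewrite add1n subn1 /= binn mulr1n.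
by apply: eq_binom_shift => s; rewrite star_shuffle0l.
Qed.

Lemma star_shuffle_series0r P : star_shuffle_series P [::] = head_series P.
Proof.
rewrite -[RHS]fps_series_const; apply: eq_fps_series => h /=.
by rewrite star_shuffle0r.
Qed.

Lemma binom_shift_cons_lt G (l j : nat) N : (j < l)%N ->
  binom_shift G ((l - j)%N :: N) = fps_series (fun m =>
    binom_shift (fun s => G ((l.-1 - j + m).+1 :: s)) N *+ 'C(l.-1 - j + m, m)) :> fps C.
Proof.
case: l => // l jl; rewrite subSn //=.
by apply: eq_fps_series => m; rewrite addSn subn1.
Qed.

Lemma star_telescope_series P N l :
  \sum_(j < l) (-1) ^+ j * fps_const (K (j.+1 :: P)) * Kt ((l.+1 - j)%N :: N) =
  head_series P * Kt (l.+1 :: N) - star_shuffle_series P (l.+1 :: N)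
  + (-1) ^+ l.+1 * star_shuffle_series (l.+1 :: P) N.
Proof.
pose S m := binom_shift (fun s => K (m.+1 :: s)) N.
(* The telescoping identity concerns the full range j <= l. Its last summand, with [Kt (1%N :: N)],
   also occurs on the right and cancels, which leaves the range j <= k_i - 2 of the theorem for k_i
   = l + 1. *)
have E : \sum_(j < l.+1) (-1) ^+ j * fps_const (K (j.+1 :: P)) * Kt ((l.+1 - j)%N :: N) =
   head_series P * Kt (l.+1 :: N) - star_shuffle_series P (l.+1 :: N)
  + (-1) ^+ l * (fps_const (K (l.+1 :: P)) * Kt (1%N :: N) - star_shuffle_series (l.+1 :: P) N).
  have -> : \sum_(j < l.+1) (-1) ^+ j * fps_const (K (j.+1 :: P)) * Kt ((l.+1 - j)%N :: N) =
    fps_series (fun n => binom_shift (fun s => \sum_(j < l.+1) (-1) ^+ j * 'C(l - j + n, n)%:R *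
     (K (j.+1 :: P) * K ((l - j + n).+1 :: s))) N).
    under [RHS]eq_fps_series do rewrite binom_shift_sum.
    rewrite fps_series_sum; apply: eq_bigr => j _.
    rewrite (binom_shift_cons_lt _ _ (ltn_ord j)) mul_fps_series.
    apply: eq_fps_series => n /=; rewrite 2!binom_shiftZ -/(S _).
    rewrite !rmorphM !rmorphXn rmorphN1 rmorph_nat -mulr_natl; ring.
  under [LHS]eq_fps_series do under eq_binom_shift do rewrite (star_telescope fM).
  under [LHS]eq_fps_series do rewrite binom_shiftD binom_shiftZ.
  rewrite fps_seriesD -mul_fps_series rmorphXn rmorphN1; congr (_ + _ * _); last first.
    under [LHS]eq_fps_series do rewrite binom_shiftB binom_shiftZ.
    rewrite fps_seriesB -mul_fps_series; congr (_ * _ - _).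
    by apply: eq_fps_series => m; rewrite add1n subn1 /= binn mulr1n.
  pose Y m h := binom_shift (fun s => star_shuffle f h P ((l + m).+1 :: s)) N *+ 'C(l + m, m).
  have -> : star_shuffle_series P (l.+1 :: N) = fps_series (fun m => fps_series (Y m)).
    rewrite exchange_fps_series; apply: eq_fps_series => h /=.
    by apply: eq_fps_series => m; rewrite addSn subn1.
  have -> : Kt (l.+1 :: N) = fps_series (fun m => S (l + m)%N *+ 'C(l + m, m)).
    by apply: eq_fps_series => m; rewrite addSn subn1.
  rewrite -fps_series_mul fps_series_series -fps_seriesB; apply: eq_fps_series => n.
  rewrite binom_shift_sum -sumrB; apply: eq_bigr => m _.
  rewrite binom_shiftZ binom_shiftB binom_shiftZ rmorph_nat mulrBr !mulr_natl.
  by rewrite mulrnAr.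
rewrite big_ord_recr /= subSnn in E.
apply: (addIr ((-1) ^+ l * fps_const (K (l.+1 :: P)) * Kt (1%N :: N))); rewrite E exprS.
by rewrite mulN1r mulNr mulrBr mulrA [RHS]addrAC -!addrA.
Qed.

(** The potential of the telescoping: [p] is viewed cyclically, the common chain of the branched
    value sits between its last and first entries, and the zigzags leaving it in both directions end
    at the cut [q]. *)
Definition cut_series p q : fps C :=
  (-1) ^+ sumn (drop q p) * star_shuffle_series (take q p) (rev (drop q p)).

(** In [star_telescope_series] the entry [a] joins either the left or the right zigzag of a branched
    value. The two outcomes are the cuts of two consecutive rotations, one with [a] in front and one
    with [a] at the end. *)
Lemma cut_series_diff a c q : (0 < a)%N -> (q <= size c)%N ->
  (-1) ^+ (sumn (drop q c) + a) *
  (\sum_(j < a.-1) (-1) ^+ j * fps_const (K (j.+1 :: take q c)) * Kt ((a - j)%N :: rev (drop q c))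
   - head_series (take q c) * Kt (a :: rev (drop q c))) =
  cut_series (a :: c) q.+1 - cut_series (rcons c a) q.
Proof.
case: a => // l _ qc; rewrite star_telescope_series /cut_series /=.
have -> : take q (rcons c l.+1) = take q c by rewrite -cats1 takel_cat.
rewrite drop_rcons // rev_rcons sumn_rcons.
set s := sumn _; rewrite exprD; set e := (-1) ^+ l.+1.
have ee : e * e = 1 by rewrite -expr2 sqrr_sign.
set x := star_shuffle_series (l.+1 :: _) _.
rewrite -[(-1) ^+ s * x]mulr1 -ee; ring.
Qed.

End StarShift.

Lemma sum_rotS (V : nmodType) (T : Type) (F : seq T -> V) (s : seq T) :
  \sum_(i < size s) F (rot i.+1 s) = \sum_(i < size s) F (rot i s).
Proof.
case E : (size s) => [|n]; first by rewrite !big_ord0.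
by rewrite big_ord_recr big_ord_recl /= -E rot_size rot0 addrC.
Qed.

Definition others (ks : seq nat) i : seq nat := drop i.+1 ks ++ take i ks.

Lemma size_others ks i : (i < size ks)%N -> (size (others ks i)).+1 = size ks.
Proof. by move=> ir; rewrite size_cat size_drop size_take ir; lia. Qed.

Lemma rot_others ks i : (i < size ks)%N -> rot i ks = nth 0%N ks i :: others ks i.
Proof. by move=> ir; rewrite /rot (drop_nth 0%N ir). Qed.

Lemma rotS_others ks i : (i < size ks)%N -> rot i.+1 ks = rcons (others ks i) (nth 0%N ks i).
Proof. by move=> ir; rewrite /rot (take_nth 0%N ir) rcons_cat. Qed.

Lemma sumn_rot i ks : sumn (rot i ks) = sumn ks.
Proof. by rewrite !sumnE (perm_big _ (permEl (perm_rot i ks))). Qed.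

Section CutSum.
Variables (C : comNzRingType) (f : seq letter -> C).
Hypothesis fM : shmul f.

Local Notation K := (zigzags f).
Local Notation Kt := (binom_shift K).

(** Summed over all rotations, [rot i.+1] may be replaced by [rot i], after which the differences
    telescope in the cut position [q]; the branched value degenerates at q = r to [head_series] and
    at q = 0 to a value with first entry 1. *)
Lemma cut_sum ks : is_index ks ->
  \sum_(i < size ks) \sum_(q < size ks)
    (-1) ^+ (sumn (drop q (others ks i)) + nth 0%N ks i) *
    (\sum_(j < (nth 0%N ks i).-1) (-1) ^+ j * fps_const (K (j.+1 :: take q (others ks i)))
        * Kt ((nth 0 ks i - j)%N :: rev (drop q (others ks i)))
     - head_series f (take q (others ks i)) * Kt (nth 0%N ks i :: rev (drop q (others ks i)))) =
  \sum_(i < size ks) head_series f (rot i ks)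
  - (-1) ^+ sumn ks * \sum_(i < size ks) Kt (1%N :: rev (rot i ks)).
Proof.
move=> ik.
transitivity (\sum_(i < size ks) \sum_(q < size ks)
    (cut_series f (rot i ks) q.+1 - cut_series f (rot i.+1 ks) q)).
  apply: eq_bigr => i _; apply: eq_bigr => q _.
  rewrite cut_series_diff //.
  - by rewrite rot_others // rotS_others.
  - exact: (all_nthP 0%N ik).
  - by rewrite -ltnS size_others.
rewrite exchange_big /=.
under eq_bigr do rewrite sumrB (sum_rotS (fun p => cut_series f p _)) -sumrB.
rewrite exchange_big mulr_sumr -sumrB /=; apply: eq_bigr => i _.
rewrite -(big_mkord xpredT (fun q => cut_series f (rot i ks) q.+1 - cut_series f (rot i ks) q)).
rewrite telescope_sumr // /cut_series take0 drop0 sumn_rot star_shuffle_series0l.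
rewrite drop_oversize ?size_rot // take_oversize ?size_rot //.
by rewrite star_shuffle_series0r mul1r.
Qed.

End CutSum.

(** * Cyclic sum formula *)

Section CyclicSum.
Variables (R : numFieldType) (A : comNzRingType) (phi : {rmorphism R -> A}).
Variables (e : nat -> A) (N : nat).
Implicit Types (F G : nat -> A) (k : seq nat).

Fixpoint star_fun F lo k : A :=
  if k is a :: k' then \sum_(n < N.+1 | (lo <= n)%N) e n ^+ a * star_fun F n k' else F lo.

Lemma star_fun1 lo k : star_fun (fun=> 1) lo k = star_sum e N lo k.
Proof. by elim: k lo => //= a k IH lo; apply: eq_bigr => n _; rewrite IH. Qed.

Lemma star_fun_rcons F lo k a :
  star_fun F lo (rcons k a) =
  star_fun (fun n => \sum_(q < N.+1 | (n <= q)%N) e q ^+ a * F q) lo k.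
Proof. by elim: k lo => //= b k IH lo; apply: eq_bigr => n _; rewrite IH. Qed.

Lemma star_sum_rcons lo k a :
  star_sum e N lo (rcons k a) =
  star_fun (fun n => \sum_(q < N.+1 | (n <= q)%N) e q ^+ a) lo k.
Proof.
rewrite -star_fun1 star_fun_rcons; congr star_fun; apply/funext => n.
by apply: eq_bigr => q _; rewrite mulr1.
Qed.

Lemma eq_star_fun F G lo k : (lo <= N)%N ->
  (forall n, (lo <= n <= N)%N -> F n = G n) -> star_fun F lo k = star_fun G lo k.
Proof.
elim: k lo => [|a k IH] lo loN FG /=; first by apply: FG; rewrite leqnn.
apply: eq_bigr => n lon; rewrite (IH n (leq_ord n)) // => m /andP[nm mN].
by apply: FG; rewrite mN (leq_trans lon nm).
Qed.

Lemma star_funD F G lo k :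
  star_fun (fun n => F n + G n) lo k = star_fun F lo k + star_fun G lo k.
Proof.
elim: k lo => //= a k IH lo; rewrite -big_split.
by apply: eq_bigr => n _; rewrite IH mulrDr.
Qed.

Lemma star_funZ c F lo k : star_fun (fun n => c * F n) lo k = c * star_fun F lo k.
Proof.
elim: k lo => //= a k IH lo; rewrite mulr_sumr.
by apply: eq_bigr => n _; rewrite IH mulrCA.
Qed.

Lemma star_funN F lo k : star_fun (fun n => - F n) lo k = - star_fun F lo k.
Proof.
rewrite -[RHS]mulN1r -star_funZ; congr star_fun; apply/funext => n.
by rewrite mulN1r.
Qed.

Lemma star_funB F G lo k :
  star_fun (fun n => F n - G n) lo k = star_fun F lo k - star_fun G lo k.
Proof. by rewrite star_funD star_funN. Qed.

Lemma star_fun_sum (I : finType) (P : pred I) (F : I -> nat -> A) lo k :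
  star_fun (fun n => \sum_(i | P i) F i n) lo k = \sum_(i | P i) star_fun (F i) lo k.
Proof.
elim: k lo => //= a k IH lo; rewrite exchange_big /=.
by apply: eq_bigr => n _; rewrite IH mulr_sumr.
Qed.

(** With p <= lo, a last variable at most [p] forces the whole weak chain to be constant equal to
    [p]. *)
Lemma star_fun_leq p lo k : (lo <= N)%N -> (p <= lo)%N ->
  star_fun (fun n => (n <= p)%N%:R) lo k = (lo <= p)%N%:R * e p ^+ sumn k.
Proof.
elim: k lo => [|a k IH] lo loN plo /=; first by rewrite expr0 mulr1.
have [lop|plo'] := leqP lo p; last first.
  rewrite mul0r big1 // => n lon; rewrite IH; last 2 first.
  - by rewrite -ltnS.
  - exact: leq_trans plo lon.
  by rewrite leqNgt (leq_trans plo' lon) mul0r mulr0.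
have {lop} <- : p = lo by apply/eqP; rewrite eqn_leq plo.
have pN : (p < N.+1)%N by rewrite ltnS (leq_trans plo).
rewrite (bigD1 (Ordinal pN)) //= IH //= leqnn mul1r -exprD mul1r big1 ?addr0 //.
move=> n /andP[pn nep]; rewrite (IH n (leq_ord n) pn) leqNgt ltn_neqAle pn andbT.
by rewrite eq_sym -[p]/(val (Ordinal pN)) (inj_eq val_inj) nep mul0r mulr0.
Qed.

(* Sum over 0 < n_1 <= ... <= n_r <= N weighted by Phi n_1 n_r. *)
Definition ends_sum (Phi : nat -> nat -> A) k : A :=
  if k is a :: k' then \sum_(p < N.+1 | (0 < p)%N) e p ^+ a * star_fun (Phi p) p k' else 0.

Lemma ends_sumB Phi Psi k :
  ends_sum (fun p n => Phi p n - Psi p n) k = ends_sum Phi k - ends_sum Psi k.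
Proof.
case: k => [|a k] /=; first by rewrite subr0.
by rewrite -sumrB; apply: eq_bigr => p _; rewrite star_funB mulrBr.
Qed.

Lemma eq_ends_sum Phi Psi k :
  (forall p n, (0 < p)%N -> (p <= n <= N)%N -> Phi p n = Psi p n) ->
  ends_sum Phi k = ends_sum Psi k.
Proof.
case: k => //= a k E; apply: eq_bigr => p p0; congr (_ * _).
apply: eq_star_fun => [|n pn]; [exact: leq_ord|exact: E].
Qed.

(** The partial fraction of 1/((p - t)(q - t)): its coefficient involves only q - p, hence is a
    scalar even when the weights depend on t. *)
Hypothesis e_pfrac : forall p q, (0 < p)%N -> (0 < q)%N -> p != q ->
  e p * e q = phi (q%:R - p%:R)^-1 * (e p - e q).

Let d p q : A := phi (q%:R - p%:R)^-1.

(* For p = q the junk value 0^-1 = 0 makes [d p q] vanish. *)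
Lemma sum_pfrac a p q : (0 < a)%N -> (0 < p)%N -> (0 < q)%N ->
  \sum_(j < a.-1) e p ^+ j.+1 * e q ^+ (a - j) =
  e p ^+ a * d p q - d p q * e q ^+ a - e p ^+ a * e q
  + a%:R * e p ^+ a.+1 * (q <= p)%N%:R * (p <= q)%N%:R.
Proof.
case: a => // a _ p0 q0 /=; have [<-|pq] := eqVneq p q.
  rewrite leqnn /d subrr invr0 rmorph0 mulr0 mul0r subrr add0r !mulr1.
  rewrite -exprSr (eq_bigr (fun=> e p ^+ a.+2)); last first.
    by move=> j _; rewrite -exprD; congr (_ ^+ _); have := ltn_ord j; lia.
  by rewrite sumr_const card_ord mulr_natl mulrSr [RHS]addrC addrK.
have -> : a.+1%:R * e p ^+ a.+2 * (q <= p)%N%:R * (p <= q)%N%:R = 0.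
  rewrite -mulrA -natrM mulnb -eqn_leq eq_sym (negPf pq) mulr0 //.
rewrite addr0; have E := e_pfrac p0 q0 pq; rewrite -/(d p q) in E.
have step i j : e p ^+ i.+1 * e q ^+ j.+1 =
    d p q * (e p ^+ i.+1 * e q ^+ j - e p ^+ i * e q ^+ j.+1).
  by rewrite !exprS mulrACA E; ring.
transitivity (\sum_(0 <= j < a) (d p q * (e p ^+ j.+1 * e q ^+ (a.+1 - j.+1)) -
    d p q * (e p ^+ j * e q ^+ (a.+1 - j)))).
  rewrite big_mkord; apply: eq_bigr => j _; rewrite -mulrBr subSS.
  by rewrite (subSn (ltnW (ltn_ord j))) step.
rewrite telescope_sumr // subSnn subn0 expr0 expr1 mul1r.
rewrite addrAC; congr (_ - _); rewrite !exprSr -[X in _ = _ - X]mulrA E; ring.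
Qed.

(** The variable [p] has lost its power and enters only through [d p q]. It can be summed last, over
    0 < p <= n with n the new first variable, so that the remaining chain is that of the next
    rotation. *)
Lemma sum_shift_first c a :
  \sum_(p < N.+1 | (0 < p)%N)
     star_fun (fun n => \sum_(q < N.+1 | (n <= q)%N) d p q * e q ^+ a) p c =
  ends_sum (fun n q => \sum_(p < N.+1 | (0 < p <= n)%N) d p q) (rcons c a).
Proof.
case: c => [|b c] /=.
  rewrite (exchange_big_dep (fun q : 'I_N.+1 => (0 < q)%N)) /=; last first.
    by move=> p q p0; apply: leq_trans.
  by apply: eq_bigr => q q0; rewrite mulr_sumr; apply: eq_bigr => p _; rewrite mulrC.
rewrite (exchange_big_dep (fun n : 'I_N.+1 => (0 < n)%N)) /=; last first.
  by move=> p q p0; apply: leq_trans.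
apply: eq_bigr => n n0; rewrite -mulr_sumr star_fun_rcons -star_fun_sum; congr (_ * _).
congr star_fun; apply/funext => l; rewrite exchange_big /=; apply: eq_bigr => q _.
by rewrite mulr_sumr; apply: eq_bigr => p _; rewrite mulrC.
Qed.

(** For each pair of first and last variables the sum over j telescopes by [sum_pfrac]. Its two
    terms with [d] give one rotation and the next; the diagonal correction survives only when all
    variables coincide, whence the single power sum. *)
Lemma star_sum_step a c : (0 < a)%N ->
  \sum_(j < a.-1) star_sum e N 1%N (j.+1 :: rcons c (a - j)%N) =
  ends_sum (fun p n => \sum_(q < N.+1 | (n <= q)%N) d p q) (a :: c)
  - ends_sum (fun n q => \sum_(p < N.+1 | (0 < p <= n)%N) d p q) (rcons c a)
  - ends_sum (fun _ n => \sum_(q < N.+1 | (n <= q)%N) e q) (a :: c)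
  + a%:R * \sum_(p < N.+1 | (0 < p)%N) e p ^+ (a + sumn c).+1.
Proof.
move=> a0; rewrite -sum_shift_first /= exchange_big /= mulr_sumr -!sumrB -big_split /=.
apply: eq_bigr => p p0.
have -> : \sum_(j < a.-1) e p ^+ j.+1 * star_sum e N p (rcons c (a - j)%N) =
    star_fun (fun n => \sum_(q < N.+1 | (n <= q)%N)
                \sum_(j < a.-1) e p ^+ j.+1 * e q ^+ (a - j)) p c.
  under eq_bigr do rewrite star_sum_rcons -star_funZ.
  rewrite -star_fun_sum; congr star_fun; apply/funext => n.
  by rewrite exchange_big; apply: eq_bigr => j _; rewrite mulr_sumr.
rewrite (@eq_star_fun _ (fun n => e p ^+ a * (\sum_(q < N.+1 | (n <= q)%N) d p q)
  - \sum_(q < N.+1 | (n <= q)%N) d p q * e q ^+ a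
  - e p ^+ a * (\sum_(q < N.+1 | (n <= q)%N) e q)
  + a%:R * e p ^+ a.+1 * (n <= p)%N%:R)); first last.
- move=> n /andP[pn nN]; rewrite !mulr_sumr -!sumrB.
  under eq_bigr => q nq.
    rewrite sum_pfrac //; last exact: leq_trans p0 (leq_trans pn nq).
    over.
  rewrite big_split /=; congr (_ + _).
  have [np|np] := leqP n p; last first.
    rewrite mulr0 big1 // => q nq; rewrite leqNgt (leq_trans np nq) mulr0 mul0r //.
  rewrite mulr1 (bigD1 p) //= leqnn !mulr1 big1 ?addr0 // => q /andP[nq qp].
  by rewrite -mulrA -natrM mulnb -eqn_leq (inj_eq val_inj) (negPf qp) mulr0.
- exact: leq_ord.
rewrite star_funD !star_funB !star_funZ star_fun_leq ?leq_ord // leqnn mul1r.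
by rewrite -mulrA -exprD.
Qed.

End CyclicSum.

Section HarmonicEnds.
Variable R : numFieldType.

Lemma sum_ord_shift (V : zmodType) (F : nat -> V) n m :
  \sum_(i < m) F (n + i)%N = \sum_(q < n + m) F q - \sum_(q < n) F q.
Proof. by rewrite big_split_ord /= [RHS]addrC addKr. Qed.

Lemma sum_ord_geq (V : zmodType) (F : nat -> V) n M : (n <= M)%N ->
  \sum_(q < M | (n <= q)%N) F q = \sum_(i < M - n) F (n + i)%N.
Proof.
move=> nM; rewrite sum_ord_shift subnKC // [X in _ = X - _](bigID (fun q : 'I_M => (n <= q)%N)) /=.
rewrite -[LHS]addr0 -addrA; congr (_ + _); apply/esym/eqP; rewrite subr_eq0; apply/eqP.
rewrite (big_ord_widen_cond M predT F nM).
by apply: eq_bigl => q; rewrite ltnNge.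
Qed.

(** With H the harmonic numbers, the two sums on the left are H_(N-p) - H_(n-p-1) and H_(n-1) -
    H_(n-p-1) for n > p, so the mixed terms cancel and H_(N-p) - H_(n-1) remains. For n = p the two
    inverses of zero are 0 and the difference is unchanged. *)
Lemma harmonic_ends N p n : (0 < p)%N -> (p <= n <= N)%N ->
  \sum_(q < N.+1 | (n <= q)%N) (q%:R - p%:R)^-1
  - \sum_(i < N.+1 | (0 < i <= p)%N) (n%:R - i%:R)^-1 =
  \sum_(q < N.+1 | (n <= q)%N) q%:R^-1 - \sum_(q < N.+1 | (N - p < q)%N) q%:R^-1 :> R.
Proof.
move=> p0 /andP[pn nN]; pose F i : R := i%:R^-1.
rewrite (sum_ord_geq (fun q => (q%:R - p%:R)^-1 : R)) ?leqW //.
under eq_bigr => i _.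
  rewrite -natrB ?(leq_trans pn) ?leq_addr // -addnBAC //.
  over.
rewrite (sum_ord_shift F) (sum_ord_geq F) ?leqW // (sum_ord_shift F).
rewrite (sum_ord_geq F); last by rewrite ltnS leq_subr.
rewrite (sum_ord_shift F).
have -> : \sum_(i < N.+1 | (0 < i <= p)%N) (n%:R - i%:R)^-1 = \sum_(i < p) F (n - p + i)%N.
  rewrite [LHS]big_mkcond big_ord_recl /= add0r -big_mkcond /=.
  rewrite [RHS](reindex_inj rev_ord_inj) (big_ord_widen N (fun i => F (n - p + (p - i.+1))%N)).
    apply: eq_bigr => i; rewrite /bump /= add1n => ip.
    by rewrite -natrB ?(leq_trans ip) // /F; congr (_%:R^-1); lia.
  exact: leq_trans nN.
rewrite (sum_ord_shift F).
have -> : (n - p + (N.+1 - n) = (N - p).+1)%N by lia.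
have -> : (n - p + p = n)%N by lia.
have -> : (n + (N.+1 - n) = N.+1)%N by lia.
have -> : ((N - p).+1 + (N.+1 - (N - p).+1) = N.+1)%N by lia.
ring.
Qed.

End HarmonicEnds.

Section CyclicIdentity.
Variables (R : numFieldType) (A : comNzRingType) (phi : {rmorphism R -> A}).
Variables (e : nat -> A) (N : nat).
Hypothesis e_pfrac : forall p q, (0 < p)%N -> (0 < q)%N -> p != q ->
  e p * e q = phi (q%:R - p%:R)^-1 * (e p - e q).

(** The truncation error of the cyclic sum: the weight H_N - H_(N-p), with p the first variable, is
    of order p/N for small p but not for p near N. *)
Definition defect k : A :=
  ends_sum e N (fun p _ => phi (\sum_(q < N.+1 | (N - p < q)%N) q%:R^-1)) k.

Lemma cyclic_sum_trunc ks : is_index ks ->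
  \sum_(i < size ks) \sum_(j < (nth 0%N ks i).-1)
     star_sum e N 1%N (j.+1 :: rcons (others ks i) (nth 0 ks i - j)%N) =
  \sum_(i < size ks) ends_sum e N
     (fun _ n => \sum_(q < N.+1 | (n <= q)%N) (phi q%:R^-1 - e q)) (rot i ks)
  + (\sum_(p < N.+1 | (0 < p)%N) e p ^+ (sumn ks).+1) *+ sumn ks
  - \sum_(i < size ks) defect (rot i ks).
Proof.
move=> ik; pose T p n := \sum_(q < N.+1 | (n <= q)%N) phi (q%:R - p%:R)^-1.
pose T' n q := \sum_(p < N.+1 | (0 < p <= n)%N) phi (q%:R - p%:R)^-1.
pose E (p n : nat) := \sum_(q < N.+1 | (n <= q)%N) e q.
pose S := \sum_(p < N.+1 | (0 < p)%N) e p ^+ (sumn ks).+1.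
transitivity (\sum_(i < size ks) (ends_sum e N T (rot i ks) - ends_sum e N T' (rot i.+1 ks)
    - ends_sum e N E (rot i ks) + (nth 0%N ks i)%:R * S)).
  apply: eq_bigr => i _.
  rewrite (star_sum_step _ e_pfrac); last exact: (all_nthP 0%N ik).
  rewrite rot_others // rotS_others // /S.
  by have -> : sumn ks = (nth 0 ks i + sumn (others ks i))%N by rewrite -(sumn_rot i) rot_others.
(* Only the sum over all rotations brings [T] and [T'] to the same chain, where [harmonic_ends]
   evaluates their difference. *)
rewrite big_split !sumrB (sum_rotS (ends_sum e N T')) -mulr_suml -natr_sum.
have -> : (\sum_(i < size ks) nth 0 ks i = sumn ks)%N.
  by rewrite sumnE (big_nth 0%N) big_mkord.
rewrite mulr_natl -!sumrB [RHS]addrAC -sumrB; congr (_ + _); apply: eq_bigr => i _.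
rewrite -!ends_sumB; apply: eq_ends_sum => p n p0 pn.
rewrite /T /T' /E sumrB [RHS]addrAC; congr (_ - _).
by rewrite -!rmorph_sum -!rmorphB harmonic_ends.
Qed.

End CyclicIdentity.

(** * Weights 1/(n - t) and the passage to the limit *)

Section GeometricWeights.
Variable R : realType.
Implicit Types (x y : R) (k h : seq nat).

(* The expansion of 1/(n - t) for x = 1/n. *)
Definition geom x : fps R := fun m => x ^+ m.+1.

Lemma sum_binom_col a m : (\sum_(i < m.+1) 'C(a + i - 1, i) = 'C(a + m, m))%N.
Proof.
elim: m => [|m IH]; first by rewrite big_ord1 !bin0.
by rewrite big_ord_recr /= IH addnS subn1 binS addnC.
Qed.

Lemma geomX x a m : (geom x ^+ a) m = x ^+ (a + m) *+ 'C(a + m - 1, m).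
Proof.
elim: a m => [|a IH] m.
  rewrite expr0 fps1 add0n; case: m => [|m]; first by rewrite bin0 expr0.
  by rewrite subn1 bin_small.
rewrite exprS fpsM addSn subn1 -sum_binom_col -sumrMnr (reindex_inj rev_ord_inj) /=.
apply: eq_bigr => i _; have im : (i <= m)%N by rewrite -ltnS.
rewrite IH subSS subKn // /geom mulrnAr -exprD; congr (_ ^+ _ *+ _); lia.
Qed.

Lemma geomX_series x a :
  geom x ^+ a = fps_series (fun m => fps_const (x ^+ (a + m)) *+ 'C(a + m - 1, m)).
Proof.
rewrite -[LHS]fps_series_const; apply: eq_fps_series => m.
by rewrite geomX raddfMn.
Qed.

Lemma geom_pfrac x y : x != 0 -> y != 0 -> x != y ->
  geom x * geom y = fps_const (y^-1 - x^-1)^-1 * (geom x - geom y).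
Proof.
move=> x0 y0 xy; have xy0 : x - y != 0 by rewrite subr_eq0.
apply: fpsP => n; rewrite fps_constM fpsB /geom subrXX fpsM.
have -> : (y^-1 - x^-1)^-1 = x * y / (x - y).
  have -> : y^-1 - x^-1 = (x - y) / (x * y) by field; rewrite y0 x0.
  by rewrite invf_div.
rewrite mulrA divfK // (reindex_inj rev_ord_inj) mulr_sumr; apply: eq_bigr => i _ /=.
have im : (i <= n)%N by rewrite -ltnS.
by rewrite subSS subKn // !exprS; ring.
Qed.

(** For g = 1/(n - t) one has 1/n = g/(1 + t g), expanded as a geometric series in t g. On
    coefficients this is the binomial expansion of (1 - 1)^n. *)
Lemma geom_inv x :
  fps_const x = fps_series (fun m => (-1) ^+ m * geom x ^+ m.+1).
Proof.
apply: fpsP => n; rewrite /fps_series.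
have -> : \sum_(j < n.+1) ((-1) ^+ j * geom x ^+ j.+1 : fps R) (n - j)%N =
   x ^+ n.+1 * (1 - 1) ^+ n.
  rewrite exprBn mulr_sumr; apply: eq_bigr => j _.
  have jn : (j <= n)%N by rewrite -ltnS.
  rewrite -(rmorphN1 (@fps_const R)) -rmorphXn fps_constM geomX addSn subnKC // subn1 /=.
  by rewrite bin_sub // !expr1n !mulr1 mulrnAr mulrnAr mulrC.
by rewrite subrr expr0n /fps_const; case: n => [|n] /=; rewrite ?mulr1 ?mulr0.
Qed.

Lemma geom_binom_shift (I : finType) (P : pred I) (x : I -> R) (G : I -> seq nat -> R) a h :
  \sum_(i | P i) geom (x i) ^+ a * binom_shift (G i) h =
  binom_shift (fun s => if s is b :: s' then \sum_(i | P i) x i ^+ b * G i s' else 0) (a :: h).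
Proof.
under eq_bigr do rewrite geomX_series mulrC mul_fps_series.
rewrite binom_shift_cons -fps_series_sum; apply: eq_fps_series => m.
rewrite (binom_shift_sum _ P (fun i s => x i ^+ (a + m) * G i s)) -sumrMnl; apply: eq_bigr => i _.
by rewrite binom_shiftZ mulrnAr mulrC.
Qed.

Local Notation ev := (fun n : nat => n%:R^-1 : R).
Local Notation gw := (fun n : nat => geom n%:R^-1).

Lemma star_sum_geom N lo h : star_sum gw N lo h = binom_shift (star_sum ev N lo) h.
Proof.
elim: h lo => [|a h IH] lo; first by rewrite /= rmorph1.
rewrite [LHS]/=; under eq_bigr do rewrite IH.
rewrite (geom_binom_shift (fun n : 'I_N.+1 => (lo <= n)%N) (fun n => n%:R^-1)
  (fun n : 'I_N.+1 => star_sum ev N n)).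
by apply: eq_fps_series => m; congr (_ *+ _); apply: eq_binom_shift.
Qed.

Lemma star_fun_cst (A : comNzRingType) (e : nat -> A) N c lo k :
  star_fun e N (fun=> c) lo k = c * star_sum e N lo k.
Proof.
rewrite -star_fun1 -star_funZ; congr star_fun; apply/funext => n.
by rewrite mulr1.
Qed.

Lemma defect_geom N h :
  defect (@fps_const R) gw N h = binom_shift (defect idfun ev N) h.
Proof.
case: h => [|a h]; first by rewrite /= rmorph0.
rewrite [LHS]/=.
pose D (p : nat) : R := \sum_(q < N.+1 | (N - p < q)%N) q%:R^-1.
have -> : \sum_(p < N.+1 | (0 < p)%N) gw p ^+ a *
     star_fun gw N (fun=> fps_const (D p)) p h =
   \sum_(p < N.+1 | (0 < p)%N) geom p%:R^-1 ^+ a *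
     binom_shift (fun s => D p * star_sum ev N p s) h.
  by apply: eq_bigr => p _; rewrite star_fun_cst binom_shiftZ star_sum_geom.
rewrite (geom_binom_shift (fun n : 'I_N.+1 => (0 < n)%N) (fun n => n%:R^-1)
  (fun (p : 'I_N.+1) s => D p * star_sum ev N p s)).
apply: eq_fps_series => m; congr (_ *+ _); apply: eq_binom_shift => s.
by apply: eq_bigr => p _; rewrite star_fun_cst.
Qed.

Lemma star_fun_series (e : nat -> fps R) N (F : nat -> nat -> fps R) lo k :
  star_fun e N (fun n => fps_series (F n)) lo k =
  fps_series (fun m => star_fun e N (F^~ m) lo k).
Proof.
elim: k lo => //= a k IH lo; under eq_bigr do rewrite IH mul_fps_series.
by rewrite -fps_series_sum.
Qed.

(** By [geom_inv] without its term m = 0, the difference 1/q - 1/(q - t) is a series in powers of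
    1/(q - t) with exponents m + 1 >= 2; the variable [q] then becomes a new last entry, and the
    resulting sums converge. *)
Lemma ends_sum_geom N k : k != [::] ->
  ends_sum gw N (fun _ n => \sum_(q < N.+1 | (n <= q)%N)
     (fps_const q%:R^-1 - geom q%:R^-1)) k =
  fps_series (fun m => (-1) ^+ m * star_sum gw N 1%N (rcons k m.+1) *+ (m != 0)).
Proof.
case: k => // a k _; rewrite [LHS]/=.
have E q : fps_const q%:R^-1 - geom q%:R^-1 =
    fps_series (fun m => (-1) ^+ m * geom q%:R^-1 ^+ m.+1 *+ (m != 0)) :> fps R.
  apply: fpsP => n; rewrite fpsB {1}geom_inv /fps_series !big_ord_recl /=.
  rewrite expr0 mul1r expr1 subn0 mulr0n fps0 addrC addKr add0r.
  by apply: eq_bigr => i _; rewrite mulr1n.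
have E' (p n : nat) : \sum_(q < N.+1 | (n <= q)%N) (fps_const q%:R^-1 - geom q%:R^-1) =
   fps_series (fun m => ((-1) ^+ m *+ (m != 0)) * \sum_(q < N.+1 | (n <= q)%N) gw q ^+ m.+1).
  under eq_bigr do rewrite E.
  rewrite -fps_series_sum; apply: eq_fps_series => m.
  by rewrite mulr_sumr; apply: eq_bigr => q _; rewrite mulrnAl.
rewrite (eq_bigr (fun p : 'I_N.+1 => fps_series (fun m =>
  (-1) ^+ m *+ (m != 0) * (gw p ^+ a * star_sum gw N p (rcons k m.+1))))); last first.
  move=> p _; rewrite (_ : star_fun _ _ _ _ _ = fps_series (fun m =>
    (-1) ^+ m *+ (m != 0) * star_sum gw N p (rcons k m.+1))).
    by rewrite mul_fps_series; apply: eq_fps_series => m; rewrite mulrCA.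
  under [X in star_fun _ _ X]eq_fun do rewrite E' //.
  rewrite star_fun_series; apply: eq_fps_series => m.
  by rewrite star_funZ star_sum_rcons.
rewrite -fps_series_sum; apply: eq_fps_series => m.
by rewrite -mulr_sumr mulrnAl.
Qed.

End GeometricWeights.

Section CyclicLimit.
Variable R : realType.
Implicit Types (k h s : seq nat).

Local Notation ev := (fun n : nat => n%:R^-1 : R).
Local Notation gw := (fun n : nat => geom (n%:R^-1 : R)).

Lemma cvgn_sum (I : Type) (r : seq I) (u : I -> nat -> R) (l : I -> R) :
  (forall i, (u i N @[N --> \oo] --> l i)%classic) ->
  (\sum_(i <- r) u i N @[N --> \oo] --> \sum_(i <- r) l i)%classic.
Proof.
move=> h; elim: r => [|i r IH].
  under eq_fun do rewrite big_nil.
  by rewrite big_nil; apply: cvg_cst.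
under eq_fun do rewrite big_cons.
by rewrite big_cons; apply: cvgD.
Qed.

Lemma fpsMn (f : fps R) m n : (f *+ m) n = f n *+ m.
Proof. by elim: m => // m IH; rewrite !mulrS fpsD IH. Qed.

(** A coefficient involves finitely many shifted indices. Their weight is recorded because
    convergence of [defect] depends on weight against length, not only on the entries being
    positive. *)
Lemma binom_shift_cvg (G : nat -> seq nat -> R) (L : seq nat -> R) h n :
  (forall s, all2 leq h s -> sumn s = (sumn h + n)%N -> (G N s @[N --> \oo] --> L s)%classic) ->
  (binom_shift (G N) h n @[N --> \oo] --> binom_shift L h n)%classic.
Proof.
elim: h G L n => [|a h IH] G L n hG.
  rewrite /= /fps_const; case: eqP => [n0|_]; last exact: cvg_cst.
  by apply: hG => //=; rewrite n0.
apply: cvgn_sum => m.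
under eq_fun do rewrite fpsMn.
rewrite fpsMn; apply: cvgMn; apply: IH => s hs es; apply: hG.
  by rewrite /= leq_addr.
by rewrite /= es; have := ltn_ord m; lia.
Qed.

Lemma all2_leq_index h s : all2 leq h s -> is_index h -> is_index s.
Proof.
elim: h s => [|a h IH] [|b s] //= /andP[ab hs] /andP[a0 ih].
by apply/andP; split; [exact: leq_trans a0 ab|exact: IH].
Qed.

Lemma all2_leq_last h s : all2 leq h s -> (last 2 h <= last 2 s)%N.
Proof.
case: h s => [|a h] [|b s] //= /andP[ab]; elim: h a b s ab => [|c h IH] a b [|d s] //= ab.
by case/andP => cd; apply: IH.
Qed.

Lemma binom_shift_star_cvg h n : is_index h -> (2 <= last 2 h)%N ->
  (binom_shift (star_sum ev N 1%N) h n @[N --> \oo]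
     --> binom_shift (zeta_star_KY R) h n)%classic.
Proof.
move=> ih h2; apply: binom_shift_cvg => s hs _; apply: zeta_star_KY_cvg.
  exact: all2_leq_index hs ih.
exact: leq_trans h2 (all2_leq_last hs).
Qed.

Lemma ev_ge0 n : 0 <= ev n. Proof. by rewrite invr_ge0. Qed.

Lemma sum_ev_le (P : pred nat) N : \sum_(n < N.+1 | P n) ev n <= harm R N.
Proof.
apply: (@le_trans _ _ (\sum_(n < N.+1) ev n)).
  by rewrite big_mkcond ler_sum // => n _; case: ifP => // _; apply: ev_ge0.
rewrite big_ord_recl invr0 add0r /harm big_ord_recr /= lerDl.
exact: ev_ge0.
Qed.

Lemma star_sum_ge0 N lo k : 0 <= star_sum ev N lo k.
Proof.
elim: k lo => //= a k IH lo; apply: sumr_ge0 => n _.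
by rewrite mulr_ge0 ?exprn_ge0 ?ev_ge0.
Qed.

Lemma ev_pow_le n a : (0 < n)%N -> (0 < a)%N -> ev n ^+ a <= ev n.
Proof.
case: a => // a n0 _; rewrite exprS ler_piMr ?ev_ge0 // exprn_ile1 ?ev_ge0 //.
by rewrite invf_le1 ?ltr0n // ler1n.
Qed.

Lemma star_sum_le N lo k : (0 < lo)%N -> is_index k ->
  star_sum ev N lo k <= harm R N ^+ size k.
Proof.
elim: k lo => [|a k IH] lo lo0 //= /andP[a0 ik]; rewrite exprS.
apply: (@le_trans _ _ ((\sum_(n < N.+1 | (lo <= n)%N) ev n) * harm R N ^+ size k)).
  rewrite mulr_suml; apply: ler_sum => n lon; have n0 := leq_trans lo0 lon.
  by rewrite ler_pM ?exprn_ge0 ?ev_ge0 ?star_sum_ge0 ?ev_pow_le ?IH.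
rewrite ler_wpM2r ?exprn_ge0 ?ev_ge0 ?(ltW (harm_gt0 _ _)) //.
exact: (sum_ev_le (fun n => (lo <= n)%N)).
Qed.

(* The first variable loses one power; if its exponent was 1, summing over it
   removes a power of the second variable instead. *)
Lemma dom_lowered b s : is_index (b :: s) -> (sumn (b :: s) > size (b :: s))%N ->
  dom 0 (fun N => \sum_(p < N.+1 | (0 < p)%N) ev p ^+ b.-1 * star_sum ev N p s).
Proof.
elim: s b => [|c s IH] b /andP[b0 is_] hb.
  exists 1%N, 1 => // N; rewrite divr1 mul1r expr1 ger0_norm; last first.
    by apply: sumr_ge0 => p _; rewrite mulr1 exprn_ge0 ?ev_ge0.
  apply: le_trans (sum_ev_le (leq 1) N); apply: ler_sum => p p0.
  by rewrite mulr1 ev_pow_le //; move: hb => /=; lia.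
have [b1|b2] := leqP b 1; last first.
  exists (size (c :: s)).+1, 1 => // N; rewrite divr1 mul1r ger0_norm; last first.
    by apply: sumr_ge0 => p _; rewrite mulr_ge0 ?exprn_ge0 ?ev_ge0 ?star_sum_ge0.
  rewrite exprS; apply: (@le_trans _ _ ((\sum_(p < N.+1 | (0 < p)%N) ev p) *
      harm R N ^+ size (c :: s))).
    rewrite mulr_suml; apply: ler_sum => p p0; apply: ler_pM.
    - by rewrite exprn_ge0 ?ev_ge0.
    - exact: star_sum_ge0.
    - by apply: ev_pow_le; lia.
    - exact: star_sum_le.
  rewrite ler_wpM2r ?exprn_ge0 ?ev_ge0 ?(ltW (harm_gt0 _ _)) //.
  exact: (sum_ev_le (leq 1)).
have b1' : b = 1%N by lia.
have cs : (size (c :: s) < sumn (c :: s))%N by move: hb; rewrite b1' /=; lia.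
apply: eq_dom (IH c is_ cs) => N; rewrite b1' /=.
under [RHS]eq_bigr do rewrite mul1r.
rewrite (exchange_big_dep (fun n : 'I_N.+1 => (0 < n)%N)) /=; last first.
  by move=> p n p0; apply: leq_trans.
apply: eq_bigr => n n0; rewrite -mulr_suml; congr (_ * _).
have c0 : (0 < c)%N by case/andP: is_.
have cnt (x : R) : \sum_(p < N.+1 | (0 < p <= n)%N) x = x *+ n.
  rewrite big_mkcond big_ord_recl /= add0r -big_mkcond -[in RHS](card_ord n) -sumr_const.
  by rewrite (big_ord_widen N (fun=> x) (leq_ord n)).
rewrite cnt -[in RHS](prednK c0) exprS -mulrnAl -[_^-1 *+ n]mulr_natr mulVf ?mul1r //.
by rewrite pnatr_eq0 -lt0n.
Qed.

(** Termwise, q > N - p gives N + 1 - q <= p, hence (N+1)/q <= 1 + p/q, and there are [p] terms. *)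
Lemma defect_bound p N : (p <= N)%N ->
  (\sum_(q < N.+1 | (N - p < q)%N) ev q) * N.+1%:R <= p%:R * (1 + harm R N).
Proof.
move=> pN; rewrite mulr_suml.
apply: (@le_trans _ _ (\sum_(q < N.+1 | (N - p < q)%N) (1 + p%:R * ev q))).
  apply: ler_sum => q pq; have q0 : (0 < q)%N by apply: leq_trans pq.
  have q0' : (0 : R) < q%:R by rewrite ltr0n.
  rewrite mulrC ler_pdivrMr // mulrDl mul1r mulfVK ?gt_eqF // -natrD ler_nat.
  by move: pq; lia.
rewrite big_split mulrDr mulr1 -mulr_sumr; apply: lerD; last first.
  by rewrite ler_wpM2l // (sum_ev_le (fun q => (N - p < q)%N)).
rewrite (sum_ord_geq (fun=> 1)) ?ltnS ?leq_subr // sumr_const card_ord.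
by rewrite subSS subKn.
Qed.

(** By [defect_bound] the weight is at most p (1 + log N)/N, and the factor p lowers the first
    exponent by one. When some entry exceeds 1, [dom_lowered] bounds the lowered sum by a power of
    the logarithm; for (1,...,1) the lowered sum grows at least like N. *)
Lemma defect_cvg0 k : is_index k -> (sumn k > size k)%N ->
  (defect idfun ev N k @[N --> \oo] --> (0 : R))%classic.
Proof.
case: k => // a k ik hk; apply: dom_cvg0.
have d1 : dom 1 (fun N => (1 + harm R N) / N.+1%:R).
  exists 1%N, 2 => // N; rewrite expr1 expr1 ger0_norm; last first.
    by rewrite mulr_ge0 ?invr_ge0 ?addr_ge0 // ltW // harm_gt0.
  by rewrite ler_wpM2r ?invr_ge0 // mulrDl mul1r lerD2r harm_ge1.
apply: dom_le (domM d1 (dom_lowered ik hk)) => N.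
have a0 : (0 < a)%N by case/andP: ik.
rewrite /defect /= ger0_norm; last first.
  apply: sumr_ge0 => p _; rewrite star_fun_cst !mulr_ge0 ?exprn_ge0 ?ev_ge0 ?star_sum_ge0 //.
  by apply: sumr_ge0 => q _; apply: ev_ge0.
rewrite mulr_sumr; apply: ler_sum => p p0; rewrite star_fun_cst.
rewrite !mulrA ler_wpM2r ?star_sum_ge0 // -[in leLHS](prednK a0) exprSr -mulrA mulrC.
rewrite ler_wpM2r ?exprn_ge0 ?ev_ge0 //.
have p0' : (0 : R) < p%:R by rewrite ltr0n.
rewrite mulrC ler_pdivrMr // mulrAC ler_pdivlMr // [leRHS]mulrC.
exact: defect_bound (leq_ord p).
Qed.

End CyclicLimit.

Section CyclicSumFormula.
Variable R : realType.
Implicit Types (k h s ks : seq nat).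

Local Notation ev := (fun n : nat => n%:R^-1 : R).
Local Notation gw := (fun n : nat => geom (n%:R^-1 : R)).
Local Notation Kt := (binom_shift (zeta_star_KY R)).

Lemma zeta_star_KY1 a : (1 < a)%N -> zeta_star_KY R [:: a] = zeta R [:: a].
Proof.
move=> a1; apply/esym; rewrite /zeta; apply: cvg_lim => //.
have -> : zeta_trunc R [:: a] = (fun N => star_sum ev N 1%N [:: a]).
  apply/funext => N; rewrite zeta_trunc_strict_sum /=; apply: eq_bigl => n.
  by rewrite ltn_ord andbT.
by apply: zeta_star_KY_cvg => //; rewrite /is_index /= andbT ltnW.
Qed.

Lemma size_leq_sumn s : is_index s -> (size s <= sumn s)%N.
Proof. by elim: s => //= a s IH /andP[a0 /IH]; lia. Qed.

Lemma sumn_leq_size s : is_index s -> (sumn s <= size s)%N -> s = nseq (size s) 1%N.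
Proof.
elim: s => //= a s IH /andP[a0 is_] h; have := size_leq_sumn is_.
by move=> h'; rewrite -IH //; [congr (_ :: _); lia | lia].
Qed.

Lemma cyclic_sum_geom ks N : is_index ks -> ks != [::] ->
  \sum_(i < size ks) \sum_(j < (nth 0%N ks i).-1)
     binom_shift (star_sum ev N 1%N) (j.+1 :: rcons (others ks i) (nth 0 ks i - j)%N) =
  \sum_(i < size ks) fps_series (fun m =>
     (-1) ^+ m * binom_shift (star_sum ev N 1%N) (rcons (rot i ks) m.+1) *+ (m != 0))
  + binom_shift (star_sum ev N 1%N) [:: (sumn ks).+1] *+ sumn ks
  - \sum_(i < size ks) binom_shift (defect idfun ev N) (rot i ks).
Proof.
move=> ik k0; under eq_bigr do under eq_bigr do rewrite -star_sum_geom.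
rewrite (@cyclic_sum_trunc _ _ (@fps_const R) gw) //; last first.
  move=> p q p0 q0 pq; rewrite geom_pfrac ?invr_eq0 ?pnatr_eq0 -?lt0n // ?invrK //.
  by apply: contra_neq pq => /invr_inj /eqP; rewrite eqr_nat => /eqP.
congr (_ + _ *+ _ - _).
- apply: eq_bigr => i _; rewrite ends_sum_geom; last first.
    by rewrite -size_eq0 size_rot size_eq0.
  by apply: eq_fps_series => m; rewrite star_sum_geom.
- by rewrite -star_sum_geom /=; apply: eq_bigr => p _; rewrite mulr1.
- by apply: eq_bigr => i _; rewrite defect_geom.
Qed.

Lemma is_index_rot i ks : is_index (rot i ks) = is_index ks.
Proof. by rewrite /is_index /rot all_cat andbC -all_cat cat_take_drop. Qed.

Lemma is_index_others i ks : is_index ks -> is_index (others ks i).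
Proof.
by move=> /allP ik; apply/allP => x; rewrite mem_cat => /orP[/mem_drop|/mem_take] /ik.
Qed.

Lemma fps_signM m (f : fps R) n : ((-1) ^+ m * f) n = (-1) ^+ m * f n.
Proof. by rewrite -(rmorphN1 (@fps_const R)) -rmorphXn fps_constM. Qed.

(** The indices occurring in the coefficient of t^n of the defect have weight [sumn ks + n] and
    length [size ks]; the hypothesis excludes only the constant coefficient for (1,...,1), where the
    defect does not tend to 0 by [defect_cvg0]. *)
Lemma cyclic_sum_coef ks n : is_index ks -> ks != [::] -> (size ks < sumn ks + n)%N ->
  (\sum_(i < size ks) \sum_(j < (nth 0%N ks i).-1)
     Kt (j.+1 :: rcons (others ks i) (nth 0 ks i - j)%N)) n =
  (\sum_(i < size ks) fps_series (fun m =>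
     (-1) ^+ m * Kt (rcons (rot i ks) m.+1) *+ (m != 0))
  + Kt [:: (sumn ks).+1] *+ sumn ks) n.
Proof.
move=> ik k0 hn.
set U := LHS; set V := RHS.
pose u N := (\sum_(i < size ks) \sum_(j < (nth 0%N ks i).-1)
  binom_shift (star_sum ev N 1%N) (j.+1 :: rcons (others ks i) (nth 0 ks i - j)%N)) n.
pose v N := (\sum_(i < size ks) fps_series (fun m =>
     (-1) ^+ m * binom_shift (star_sum ev N 1%N) (rcons (rot i ks) m.+1) *+ (m != 0))
  + binom_shift (star_sum ev N 1%N) [:: (sumn ks).+1] *+ sumn ks) n.
pose w N := (\sum_(i < size ks) binom_shift (defect idfun ev N) (rot i ks)) n.
have s0 : (0 < size ks)%N by rewrite lt0n size_eq0.
have k1 : (0 < sumn ks)%N by apply: leq_trans (size_leq_sumn ik).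
have hu : (u N @[N --> \oo] --> U)%classic.
  rewrite /u /U fps_sum; under eq_fun do rewrite fps_sum.
  apply: cvgn_sum => i; rewrite fps_sum; under eq_fun do rewrite fps_sum.
  apply: cvgn_sum => j; have hj := ltn_ord j; apply: binom_shift_star_cvg.
    by rewrite /is_index /= all_rcons -/(is_index _) is_index_others // andbT; lia.
  by rewrite /= last_rcons; lia.
have hv : (v N @[N --> \oo] --> V)%classic.
  rewrite /v /V fpsD fpsMn fps_sum; under eq_fun do rewrite fpsD fpsMn fps_sum.
  apply: cvgD; last first.
    by apply: cvgMn; apply: binom_shift_star_cvg.
  apply: cvgn_sum => i; apply: cvgn_sum => m.
  rewrite fpsMn fps_signM; under eq_fun do rewrite fpsMn fps_signM.
  case: (nat_of_ord m) => [|m']; first exact: cvg_cst.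
  rewrite mulr1n; under eq_fun do rewrite mulr1n.
  apply: cvgM; first exact: cvg_cst.
  apply: binom_shift_star_cvg; last by rewrite last_rcons.
  by rewrite /is_index all_rcons /= -/(is_index _) is_index_rot.
have hw : (w N @[N --> \oo] --> (0 : R))%classic.
  have -> : 0 = \sum_(i < size ks) binom_shift (fun=> 0) (rot i ks) n :> R.
    by rewrite big1 // => i _; rewrite binom_shift0.
  rewrite /w; under eq_fun do rewrite fps_sum.
  apply: cvgn_sum => i; apply: binom_shift_cvg => s hs es; apply: defect_cvg0.
    by apply: all2_leq_index hs _; rewrite is_index_rot.
  have <- : size (rot i ks) = size s by move: hs; rewrite all2E => /andP[/eqP].
  by rewrite es size_rot sumn_rot.
have e : u = (v - w)%R.
  by apply/funext => N; rewrite /u cyclic_sum_geom.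
apply: (cvg_unique _ hu) => //; rewrite e -(subr0 V).
exact: cvgB.
Qed.

Lemma binom_shift_seq1 (G : seq nat -> R) a : binom_shift G [:: a] 0%N = G [:: a].
Proof. by rewrite /= /fps_series big_ord1 fpsMn bin0 mulr1n addn0. Qed.

(** In the remaining case, (1,...,1) and n = 0, no limit of the defect is computed: the left side is
    empty, the condition on m kills the series, and what is left fixes the exceptional term as k
    zeta(k+1). *)
Lemma cyclic_sum_formula ks : is_index ks -> ks != [::] ->
  \sum_(i < size ks) \sum_(j < (nth 0%N ks i).-1)
     Kt (j.+1 :: rcons (others ks i) (nth 0 ks i - j)%N) =
  \sum_(i < size ks) fps_series (fun m =>
     (-1) ^+ m * Kt (rcons (rot i ks) m.+1) *+ (m != 0))
  + Kt [:: (sumn ks).+1] *+ sumn ks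
  - fps_const ((ks == nseq (size ks) 1%N)%:R * (sumn ks)%:R * zeta R [:: (sumn ks).+1]).
Proof.
move=> ik k0; apply: fpsP => n.
have [hn|hn] := leqP (sumn ks + n) (size ks); last first.
  rewrite cyclic_sum_coef // [RHS]fpsB -[LHS]subr0; congr (_ - _).
  rewrite /fps_const; case: eqP => // n0; case: eqP => [e1|_]; last by rewrite !mul0r.
  by move: hn; rewrite n0 [in X in (_ < X)%N]e1 sumn_nseq; lia.
have sk := size_leq_sumn ik; have n0 : n = 0%N by lia.
have e1 : ks = nseq (size ks) 1%N by apply: sumn_leq_size => //; lia.
rewrite {}n0 fps_sum big1; last first.
  move=> i _; have -> : nth 0%N ks i = 1%N.
    by have := ltn_ord i; move: (nat_of_ord i) => m mk; rewrite e1 nth_nseq mk.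
  by rewrite big_ord0.
rewrite fpsB fpsD fpsMn fps_sum big1 ?add0r; last first.
  by move=> i _; rewrite /fps_series big_ord1 mulr0n.
rewrite binom_shift_seq1 -e1 eqxx mul1r zeta_star_KY1; last first.
  by rewrite ltnS (leq_trans _ sk) // lt0n size_eq0.
by rewrite /fps_const /= mulr_natl subrr.
Qed.

End CyclicSumFormula.

(** * Expansion over the cuts *)

Section TupleSum.
Variable R : realType.

Lemma eq_binom_shift_index (G1 G2 : seq nat -> R) h :
  (forall s, is_index s -> G1 s = G2 s) -> is_index h -> binom_shift G1 h = binom_shift G2 h.
Proof.
elim: h G1 G2 => [|a h IH] G1 G2 eG ih; first by rewrite /= eG.
have /andP[a0 ih'] := ih; rewrite !binom_shift_cons; apply: eq_fps_series => m.
congr (_ *+ _); apply: IH => // s is_; apply: eG.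
by apply/andP; split=> //; apply: leq_trans a0 (leq_addr _ _).
Qed.

Lemma binom_shift_coef0 (G : seq nat -> R) h : binom_shift G h 0%N = G h.
Proof.
elim: h G => [|a h IH] G //.
by rewrite binom_shift_cons /fps_series big_ord1 fpsMn bin0 mulr1n IH addn0.
Qed.

(** The bound [M] on the entries is kept apart from [n], which decreases when the first entry of the
    tuple is split off. *)
Lemma binom_shift_tuples (G : seq nat -> R) h r M n : size h = r -> (n <= M)%N ->
  \sum_(l : r.-tuple 'I_M.+1 | sumn [seq val m | m <- l] == n)
      (\prod_(j < r) 'C(nth 0 h j + tnth l j - 1, tnth l j))%N%:R *
      G [seq (a.1 + val a.2)%N | a <- zip h l] =
  binom_shift G h n.
Proof.
move=> <- {r}; elim: h G n => [|a h IH] G n nM.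
  have [n0|n0] := eqVneq n 0%N.
    rewrite n0 (big_pred1 [tuple]) ?big_ord0 ?mul1r // => t.
    by rewrite [t]tuple0; apply/esym/eqP.
  rewrite big_pred0 => [|t]; first by rewrite /= /fps_const (negPf n0).
  by rewrite [t]tuple0 eq_sym (negPf n0).
rewrite binom_shift_cons /fps_series.
rewrite (reindex (fun p : 'I_M.+1 * (size h).-tuple 'I_M.+1 => [tuple of p.1 :: p.2])) /=; last first.
  exists (fun t => (thead t, [tuple of behead t])) => [[m t] _|t _] /=.
    by rewrite theadE; congr pair; apply: val_inj.
  by rewrite -tuple_eta.
rewrite -(pair_big_dep xpredT
  (fun (m : 'I_M.+1) (t : (size h).-tuple 'I_M.+1) => (m + sumn [seq val i | i <- t] == n)%N)
  (fun m t => (\prod_(j < (size h).+1) 'C(nth 0 (a :: h) j + tnth [tuple of m :: t] j - 1,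
                 tnth [tuple of m :: t] j))%N%:R *
      G ((a + m)%N :: [seq (a.1 + val a.2)%N | a <- zip h t]))) /=.
rewrite [RHS](big_ord_widen M.+1 (fun m => (binom_shift (fun s => G ((a + m)%N :: s)) h *+
  'C(a + m - 1, m)) (n - m)%N)) // [RHS]big_mkcond; apply: eq_bigr => m _.
rewrite ltnS; have [mn|mn] := leqP m n; last first.
  by rewrite big_pred0 // => t; apply/eqP; lia.
rewrite fpsMn -IH; last by rewrite (leq_trans (leq_subr _ _)).
rewrite -sumrMnl; apply: eq_big => [t|t _].
  by rewrite -[RHS](eqn_add2l m) subnKC.
rewrite big_ord_recl /= tnth0 natrM -mulrA mulr_natl; congr (_ * _ *+ _).
by congr _%:R; apply: eq_bigr => j _; rewrite tnthS.
Qed.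

Local Notation K := (zigzags (zreg R)).
Local Notation Kt := (binom_shift K).

Lemma zeta_Shat_star_KYE k : is_index k ->
  zeta_Shat_star_KY R k =
  \sum_(i < (size k).+1) (-1) ^+ sumn (drop i k) * fps_const (K (take i k)) * Kt (rev (drop i k)).
Proof.
move=> ik; apply: fpsP => n; rewrite fps_sum /zeta_Shat_star_KY; apply: eq_bigr => i _.
have id : is_index (drop i k) by apply/allP => x /mem_drop /(allP ik).
have it : is_index (take i k) by apply/allP => x /mem_take /(allP ik).
rewrite -[in RHS]mulrA fps_signM fps_constM [RHS]mulrA zeta_star_KYE //; congr (_ * _).
rewrite -binom_shift_rev (@eq_binom_shift_index _ (fun s => zeta_star_KY R (rev s))) //; last first.
  by move=> s is_; rewrite zeta_star_KYE // /is_index all_rev.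
rewrite -(@binom_shift_tuples _ _ (size k - i) n) ?size_drop //; apply: eq_bigr => l _.
congr (_%:R * _); apply: eq_bigr => j _; by rewrite nth_drop.
Qed.

(** The two extreme cuts have an empty factor. At every other cut [a] heads the left factor and [b]
    heads the reversed right factor, the shape to which [star_telescope] applies. *)
Lemma zeta_Shat_star_KY_ends a c b : is_index (a :: rcons c b) ->
  zeta_Shat_star_KY R (a :: rcons c b) =
  fps_const (K (a :: rcons c b))
  + (-1) ^+ (a + sumn c + b) * Kt (b :: rcons (rev c) a)
  + \sum_(q < (size c).+1) (-1) ^+ (sumn (drop q c) + b)
      * (fps_const (K (a :: take q c)) * Kt (b :: rev (drop q c))).
Proof.
move=> ik; have sE : size (a :: rcons c b) = (size c).+2 by rewrite /= size_rcons.
rewrite zeta_Shat_star_KYE // sE big_ord_recl [X in _ + X]big_ord_recr /=.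
rewrite rmorph1 mulr1 drop_oversize ?size_rcons // take_oversize ?size_rcons //.
rewrite [X in _ + (_ + X)]/= rmorph1 expr0 mul1r mulr1 sumn_rcons rev_cons rev_rcons addnA.
rewrite [LHS]addrA [LHS]addrAC [X in X + _ = _]addrC; congr (_ + _ + _).
apply: eq_bigr => q _; have qc : (q <= size c)%N by rewrite -ltnS.
rewrite /bump /= drop_rcons // sumn_rcons rev_rcons -mulrA -cats1 takel_cat //.
Qed.

Lemma zeta_Shat_star_KY_seq1 a : (0 < a)%N ->
  zeta_Shat_star_KY R [:: a] = fps_const (K [:: a]) + (-1) ^+ a * Kt [:: a].
Proof.
move=> a0; rewrite zeta_Shat_star_KYE /is_index /= ?a0 // !big_ord_recl big_ord0 addr0.
rewrite /= addn0 !rmorph1 !mulr1 mul1r addrC //.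
Qed.

End TupleSum.

(** Both sides are the sum of F (a - j) (j + 1) over 0 <= j < a, read from opposite ends, each with
    its last summand split off. *)
Lemma sum_flip (V : nmodType) (F : nat -> nat -> V) a : (0 < a)%N ->
  \sum_(j < a.-1) F (a - j)%N j.+1 + F 1%N a = \sum_(j < a.-1) F j.+1 (a - j)%N + F a 1%N.
Proof.
case: a => // a _ /=.
transitivity (\sum_(j < a.+1) F (a.+1 - j)%N j.+1); first by rewrite big_ord_recr /= subSnn.
rewrite (reindex_inj rev_ord_inj) big_ord_recr /=; congr (_ + F _ _); [|lia|lia].
by apply: eq_bigr => j _; have ja := ltn_ord j; congr F; lia.
Qed.

Lemma signrB (A : pzRingType) n j : (j <= n)%N -> (-1) ^+ (n - j) = (-1) ^+ n * (-1) ^+ j :> A.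
Proof. by move=> jn; rewrite -{2}(subnK jn) exprD -mulrA -expr2 sqrr_sign mulr1. Qed.

Lemma fps_series_constM (R : comNzRingType) (g f : fps R) :
  fps_series (fun j => fps_const (g j) * f) = g * f.
Proof.
rewrite -[in RHS](fps_series_const g) mulrC mul_fps_series.
by apply: eq_fps_series => j; rewrite mulrC.
Qed.

Lemma others_rev ks i : (i < size ks)%N ->
  others (rev ks) (size ks - i.+1) = rev (others ks i).
Proof.
move=> ir; rewrite /others drop_rev take_rev rev_cat -subSn // subSS.
by rewrite subnBA ?addKn // ?subKn // ltnW.
Qed.

Section Assembly.
Variable R : realType.
Implicit Types ks : seq nat.

Local Notation K := (zigzags (zreg R)).
Local Notation Kt := (binom_shift K).

Lemma sumn_others ks i : (i < size ks)%N -> (nth 0 ks i + sumn (others ks i))%N = sumn ks.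
Proof. by move=> ir; rewrite -(sumn_rot i ks) rot_others. Qed.

Lemma is_index_cyclic ks i j : is_index ks -> (i < size ks)%N -> (j < (nth 0%N ks i).-1)%N ->
  is_index (j.+1 :: rcons (others ks i) (nth 0 ks i - j)%N).
Proof.
move=> ik _ hj; rewrite /is_index /= all_rcons -/(is_index _) is_index_others // andbT.
by lia.
Qed.

Lemma cyclic_sum_zigzag ks : is_index ks -> ks != [::] ->
  \sum_(i < size ks) \sum_(j < (nth 0%N ks i).-1)
     Kt (j.+1 :: rcons (others ks i) (nth 0 ks i - j)%N) =
  \sum_(i < size ks) fps_series (fun m =>
     (-1) ^+ m * Kt (nth 0%N ks i :: rcons (others ks i) m.+1) *+ (m != 0))
  + Kt [:: (sumn ks).+1] *+ sumn ks
  - fps_const ((ks == nseq (size ks) 1%N)%:R * (sumn ks)%:R * zeta R [:: (sumn ks).+1]).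
Proof.
move=> ik k0; have KtE h : is_index h -> binom_shift (zeta_star_KY R) h = Kt h.
  by apply: eq_binom_shift_index => s; apply: zeta_star_KYE.
have := cyclic_sum_formula R ik k0; rewrite (KtE [:: (sumn ks).+1]) //.
under eq_bigr do under eq_bigr do rewrite KtE ?is_index_cyclic //.
move->; congr (_ + _ - _); apply: eq_bigr => i _; apply: eq_fps_series => m.
rewrite KtE ?rot_others //.
by rewrite -rot_others // /is_index all_rcons /= -/(is_index _) is_index_rot.
Qed.

Lemma cyclic_sum_rev ks : is_index ks -> ks != [::] ->
  \sum_(i < size ks) \sum_(j < (nth 0%N ks i).-1)
     Kt (j.+1 :: rcons (rev (others ks i)) (nth 0 ks i - j)%N) =
  \sum_(i < size ks) fps_series (fun m =>
     (-1) ^+ m * Kt (nth 0%N ks i :: rcons (rev (others ks i)) m.+1) *+ (m != 0))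
  + Kt [:: (sumn ks).+1] *+ sumn ks
  - fps_const ((ks == nseq (size ks) 1%N)%:R * (sumn ks)%:R * zeta R [:: (sumn ks).+1]).
Proof.
move=> ik k0; have := @cyclic_sum_zigzag (rev ks).
rewrite /is_index all_rev -/(is_index _) -size_eq0 size_rev size_eq0 sumn_rev => /(_ ik k0).
have -> : (rev ks == nseq (size ks) 1%N) = (ks == nseq (size ks) 1%N).
  by rewrite -[nseq _ _]revK rev_nseq (inj_eq (inv_inj revK)) rev_nseq.
rewrite (reindex_inj rev_ord_inj) [X in _ = X + _ - _ -> _](reindex_inj rev_ord_inj) /=.
have E (i : 'I_(size ks)) : nth 0%N (rev ks) (size ks - i.+1) = nth 0%N ks i.
  by rewrite nth_rev ?subnSK ?subKn // ?leq_subr //; have := ltn_ord i; lia.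
under eq_bigr do rewrite others_rev // E.
by under [X in _ = X + _ - _ -> _]eq_bigr do rewrite others_rev // E.
Qed.

(** The cut with empty right factor carries no t, so the cyclic formula is used at t = 0, where the
    series over m != 0 disappears. *)
Lemma cyclic_sum_positive ks : is_index ks -> ks != [::] ->
  \sum_(i < size ks) \sum_(j < (nth 0%N ks i).-1)
     K (j.+1 :: rcons (others ks i) (nth 0 ks i - j)%N) =
  (sumn ks)%:R * zeta R [:: (sumn ks).+1]
  - (ks == nseq (size ks) 1%N)%:R * (sumn ks)%:R * zeta R [:: (sumn ks).+1].
Proof.
move=> ik k0; have := congr1 (@^~ 0%N) (cyclic_sum_zigzag ik k0).
rewrite fpsB fpsD fpsMn [LHS]fps_sum [X in _ = X + _ - _ -> _]fps_sum.
rewrite [X in _ = X + _ - _ -> _]big1 ?add0r; last first.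
  by move=> i _; rewrite /fps_series big_ord1 mulr0n.
rewrite binom_shift_coef0 -zeta_star_KYE // zeta_star_KY1; last first.
  have s0 : (0 < size ks)%N by rewrite lt0n size_eq0.
  by rewrite ltnS (leq_trans s0) // size_leq_sumn.
rewrite [fps_const _ _]/(_ * _ * _) => E; rewrite [X in _ = X - _]mulr_natl -E.
by apply: eq_bigr => i _; rewrite fps_sum; apply: eq_bigr => j _; rewrite binom_shift_coef0.
Qed.

Definition inner_cuts a b c : fps R :=
  \sum_(q < (size c).+1) (-1) ^+ (sumn (drop q c) + b)
      * (fps_const (K (a :: take q c)) * Kt (b :: rev (drop q c))).

(** On the right only the left factor depends on j, so the series over j is [head_series]. On the
    left the sign of a cut depends on j through k_i - j, which is the alternating sign of
    [cut_sum]. *)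
Lemma inner_cuts_sum ks : is_index ks ->
  \sum_(i < size ks) \sum_(j < (nth 0%N ks i).-1)
     inner_cuts j.+1 (nth 0 ks i - j)%N (others ks i) =
  \sum_(i < size ks) fps_series (fun j => inner_cuts j.+1 (nth 0%N ks i) (others ks i))
  + \sum_(i < size ks) head_series (zreg R) (rot i ks)
  - (-1) ^+ sumn ks * \sum_(i < size ks) Kt (1%N :: rev (rot i ks)).
Proof.
move=> ik; rewrite -addrA -(cut_sum (zreg_shmul R) ik) -big_split /=.
apply: eq_bigr => i _; pose a := nth 0%N ks i; pose c := others ks i.
have -> : fps_series (fun j => inner_cuts j.+1 a c) = \sum_(q < (size c).+1)
    (-1) ^+ (sumn (drop q c) + a) * (head_series (zreg R) (take q c) * Kt (a :: rev (drop q c))).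
  rewrite fps_series_sum; apply: eq_bigr => q _.
  by rewrite -mul_fps_series fps_series_constM.
rewrite exchange_big /= -/c size_others // -big_split /=; apply: eq_bigr => q _.
rewrite -mulrDr addrC subrK mulr_sumr; apply: eq_bigr => j _.
have ja : (j <= a)%N by have := ltn_ord j; rewrite -/a; lia.
by rewrite -/a exprD signrB // exprD -!mulrA.
Qed.

Lemma zeta_Shat_star_KY_cyclic ks : is_index ks -> ks != [::] ->
  \sum_(i < size ks) \sum_(j < (nth 0%N ks i).-1)
     zeta_Shat_star_KY R (j.+1 :: rcons (others ks i) (nth 0 ks i - j)%N)
  = \sum_(i < size ks)
      fps_series (fun j => zeta_Shat_star_KY R (j.+1 :: rcons (others ks i) (nth 0%N ks i)))
    + zeta_Shat_star_KY R [:: (sumn ks).+1] *+ sumn ks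
    - fps_const ((ks == nseq (size ks) 1%N)%:R *
                 (1 + (-1) ^+ (sumn ks).+1) * (sumn ks)%:R * zeta R [:: (sumn ks).+1]).
Proof.
move=> ik k0; set k := sumn ks; set sg : fps R := (-1) ^+ k.+1.
pose Kr i a b := Kt (a :: rcons (rev (others ks i)) b).
have L (i : 'I_(size ks)) (j : 'I_(nth 0%N ks i).-1) :
    zeta_Shat_star_KY R (j.+1 :: rcons (others ks i) (nth 0 ks i - j)%N) =
    fps_const (K (j.+1 :: rcons (others ks i) (nth 0 ks i - j)%N))
    + sg * Kr i (nth 0 ks i - j)%N j.+1
    + inner_cuts j.+1 (nth 0 ks i - j)%N (others ks i).
  have hj := ltn_ord j.
  rewrite zeta_Shat_star_KY_ends ?is_index_cyclic //; congr (_ + _ ^+ _ * _ + _).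
  by rewrite /k -(sumn_others (ltn_ord i)); lia.
have S (i : 'I_(size ks)) :
    fps_series (fun j => zeta_Shat_star_KY R (j.+1 :: rcons (others ks i) (nth 0%N ks i))) =
    head_series (zreg R) (rot i.+1 ks)
    + sg * fps_series (fun j => (-1) ^+ j * Kr i (nth 0%N ks i) j.+1)
    + fps_series (fun j => inner_cuts j.+1 (nth 0%N ks i) (others ks i)).
  have ii j : is_index (j.+1 :: rcons (others ks i) (nth 0%N ks i)).
    by rewrite /is_index /= -rotS_others // -/(is_index _) is_index_rot.
  rewrite (eq_fps_series (fun j => zeta_Shat_star_KY_ends R (ii j))).
  rewrite !fps_seriesD; congr (_ + _ + _).
    by rewrite -[RHS]fps_series_const rotS_others.
  rewrite mul_fps_series; apply: eq_fps_series => j; rewrite mulrA -exprD; congr (_ ^+ _ * _).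
  by rewrite /k -(sumn_others (ltn_ord i)); lia.
(* The summands with j = 0 end in 1 and are not limits of sums. The boundary term of the interior
   cuts completes the range of j; flipping it leaves convergent values together with
   [Kr i (nth 0 ks i) 1], which is the summand j = 0 of the series on the right. *)
have N : \sum_(i < size ks) \sum_(j < (nth 0%N ks i).-1) Kr i (nth 0 ks i - j)%N j.+1
    + \sum_(i < size ks) Kt (1%N :: rev (rot i ks)) =
    \sum_(i < size ks) fps_series (fun j => (-1) ^+ j * Kr i (nth 0%N ks i) j.+1)
    + Kt [:: k.+1] *+ k
    - fps_const ((ks == nseq (size ks) 1%N)%:R * k%:R * zeta R [:: k.+1]).
  transitivity (\sum_(i < size ks) \sum_(j < (nth 0%N ks i).-1)
       Kr i j.+1 (nth 0 ks i - j)%N + \sum_(i < size ks) Kr i (nth 0%N ks i) 1%N).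
    rewrite -!big_split; apply: eq_bigr => i _.
    rewrite rot_others // rev_cons -/(Kr i 1%N _).
    by apply: (sum_flip (Kr i)); apply: (all_nthP 0%N ik).
  rewrite cyclic_sum_rev // -/k [LHS]addrAC; congr (_ - _); rewrite [LHS]addrAC; congr (_ + _).
  rewrite -big_split; apply: eq_bigr => i _; apply: fpsP => n /=.
  rewrite fpsD /fps_series !big_ord_recl /= mulr0n fps0 add0r addrC subn0 expr0 mul1r.
  by congr (_ + _); apply: eq_bigr => j _; rewrite mulr1n.
have P : \sum_(i < size ks) \sum_(j < (nth 0%N ks i).-1)
     fps_const (K (j.+1 :: rcons (others ks i) (nth 0 ks i - j)%N)) =
   fps_const (zeta R [:: k.+1]) *+ k
   - fps_const ((ks == nseq (size ks) 1%N)%:R * k%:R * zeta R [:: k.+1]).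
  under eq_bigr do rewrite -rmorph_sum.
  rewrite -rmorph_sum cyclic_sum_positive // rmorphB; congr (_ - _).
  by rewrite mulr_natl rmorphMn.
have Z : zeta_Shat_star_KY R [:: k.+1] = fps_const (zeta R [:: k.+1]) + sg * Kt [:: k.+1].
  rewrite zeta_Shat_star_KY_seq1 // -zeta_star_KYE // zeta_star_KY1 // ltnS /k.
  by apply: leq_trans (size_leq_sumn ik); rewrite lt0n size_eq0.
(* The exceptional term arises twice, from the extreme cut with empty right factor and, with the
   sign [sg], from the other one. *)
have D : fps_const ((ks == nseq (size ks) 1%N)%:R * (1 + (-1) ^+ k.+1) * k%:R * zeta R [:: k.+1]) =
   (1 + sg) * fps_const ((ks == nseq (size ks) 1%N)%:R * k%:R * zeta R [:: k.+1]).
  have -> : 1 + sg = fps_const (1 + (-1) ^+ k.+1).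
    by rewrite rmorphD rmorph1 rmorphXn rmorphN1.
  rewrite -rmorphM; congr fps_const; ring.
rewrite Z D.
under eq_bigr do under eq_bigr do rewrite L.
under eq_bigr do rewrite 2!big_split.
rewrite 2!big_split /= inner_cuts_sum // P.
under [X in _ = X + _ - _]eq_bigr do rewrite S.
(* The extreme cuts of the series on the right give [head_series] of [rot i.+1], possibly divergent;
   summed over rotations they equal the boundary term [head_series] of the interior cuts, and the
   two cancel. *)
rewrite 2!big_split /= (sum_rotS (head_series (zreg R))).
under [X in _ + X + _ = _]eq_bigr do rewrite -mulr_sumr.
rewrite -!mulr_sumr.
have -> : (-1) ^+ sumn ks = - sg by rewrite /sg exprS mulN1r opprK.
move: N; set X := \sum_(i < size ks) \sum_(j < _) _; set T := \sum_(i < size ks) Kt _.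
set Y := \sum_(i < size ks) fps_series (fun j => _ * _); set Q := _ *+ k.
set c := fps_const _; move/(canRL (addrK _)) ->.
rewrite mulrnDl -mulrnAr -/Q.
set H := \sum_(i < size ks) head_series _ _; set I := \sum_(i < size ks) fps_series _.
set W := _ *+ k.
move: X T Y Q c H I W sg {P Z D L S} => X T Y Q c H I W sg.
ring.
Qed.

End Assembly.

Theorem theorem2p4 (R : realType) (k : nat) (k_gt0 : (0 < k)%N)
    (ks : seq nat) (ks_index : is_index ks) (ks_nonempty : ks != [::])
    (ks_weight : sumn ks = k) :
  \sum_(i < size ks) \sum_(j < (nth 0%N ks i).-1)
     zeta_Shat_star_KY R
       (j.+1 :: drop i.+1 ks ++ take i ks ++ [:: (nth 0 ks i - j)%N])
  = \sum_(i < size ks)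
      fps_series (fun j => zeta_Shat_star_KY R
                             (j.+1 :: drop i.+1 ks ++ take i.+1 ks))
    + zeta_Shat_star_KY R [:: k.+1] *+ k
    - fps_const ((ks == nseq (size ks) 1%N)%:R *
                 (1 + (-1) ^+ k.+1) * k%:R * zeta R [:: k.+1]).
Proof.
rewrite -ks_weight; under eq_bigr do under eq_bigr do rewrite catA cats1.
rewrite zeta_Shat_star_KY_cyclic //; congr (_ + _ - _); apply: eq_bigr => i _.
by rewrite -rotS_others.
Qed.
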